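(* Let $K$ be a field of characteristic $0$ and $G$ a finite abelian group. The graded space $\mathcal E(\mathcal T_G)$ is a graded connected Hopf subalgebra of $K[\mathsf G]$ containing $\Sigma(G)$. As an algebra, it is freely generated by $$\{\mathsf b^{\mathcal T_G}_{(|\vee T)^g}\;:\; g\in G,\ n\ge1,\ T\in Y_{n-1}\},$$ where $|$ is the tree with no internal vertex and $\vee$ is the grafting operation. Moreover, the assignment $G\rightsquigarrow\mathcal E(\mathcal T_G)$ is a covariant functor from the category of finite abelian groups to the category of graded connected Hopf algebras (a homomorphism $f:G\to G'$ acting by the restriction of $f_*:\sigma^{\mathbf g}\mapsto\sigma^{f(\mathbf g)}$).
   Context: $G_n=G^n\rtimes\mathfrak S_n$ is the wreath product; its elements are written $\sigma^{\mathbf g}=\sigma\cdot(g_1,\dots,g_n)$ and identified with coloured words $\sigma(1)^{g_1}\cdots\sigma(n)^{g_n}$; multiplication is determined by $\sigma\cdot(g_1,\dots,g_n)=(g_{\sigma^{-1}(1)},\dots,g_{\sigma^{-1}(n)})\cdot\sigma$; $\mathfrak S_n\subseteq G_n$ via trivial colours. Hopf algebra $K[\mathsf G]=\bigoplus_{n\ge0}KG_n$: for $\sigma\in\mathfrak S_n$, $\tau\in\mathfrak S_m$, $\sigma\times\tau\in\mathfrak S_{n+m}$ maps $a\in[1,n]$ to $\sigma(a)$ and $n+b$ to $n+\tau(b)$; $\sigma^{\mathbf g}\times\tau^{\mathbf h}=(\sigma\times\tau)^{\mathbf g\cdot\mathbf h}$. $X_{(n,m)}$ is the set of $u\in\mathfrak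 S_{n+m}$ increasing on $[1,n]$ and on $[n+1,n+m]$. For $\alpha\in G_n$, $\beta\in G_m$: $\alpha*\beta=\sum_{u\in X_{(n,m)}}u(\alpha\times\beta)$. For $\alpha\in G_n$ and $i\in[0,n]$ let $\alpha_{(i)}\in G_i$, $\alpha_{(n-i)}\in G_{n-i}$ be the unique elements with $\alpha^{-1}=u(\alpha_{(i)}\times\alpha_{(n-i)})^{-1}$ for some $u\in X_{(i,n-i)}$; $\Delta(\alpha)=\sum_{i=0}^n\alpha_{(i)}\otimes\alpha_{(n-i)}$. With these, $K[\mathsf G]$ is known to be a graded connected Hopf algebra, functorial in $G$ via $f_*(\sigma^{\mathbf g})=\sigma^{f(\mathbf g)}$, $f(\mathbf g)=(f(g_1),\dots,f(g_n))$. The rainbow decomposition of $\sigma^{\mathbf g}$ is the unique factorization $\sigma_1^{g_1}\cdots\sigma_k^{g_k}$ of the coloured word into nonempty monochromatic words with $g_i\ne g_{i+1}$. $\mathrm{std}(w)$ for $w=a_1\cdots a_n$ is the unique $\sigma\in\mathfrak S_n$ with, for $i<j$, $\sigma(i)>\sigma(j)\iff a_i>a_j$. Trees: $Y_n$ is the set of planar binary trees with $n$ internal vertices; $Y_0=\{|\}$. The grafting $T'\vee T''$ is the planar binary tree whose root has left subtree $T'$ and right subtree $T''$. For $\sigma\in\mathfrak S_n$, $n\ge1$, written $\sigma=w'\cdot1\cdot w''$, $\mathcal T(\sigma)=\mathcal T(\mathrm{std}(w'))\vee\mathcal T(\mathrm{std}(w''))$, with $\mathcal T$ of the empty word equal to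 $|$; for words $w$ put $\mathcal T(w)=\mathcal T(\mathrm{std}(w))$. For $\sigma^{\mathbf g}\in G_n$ with rainbow decomposition $\sigma_1^{g_1}\cdots\sigma_k^{g_k}$, $\mathcal T_G(\sigma^{\mathbf g})=(\mathcal T(\sigma_1)^{g_1},\dots,\mathcal T(\sigma_k)^{g_k})$, a sequence of coloured trees. For a value $e$ of $\mathcal T_G$ on $G_n$, $\mathsf b^{\mathcal T_G}_e=\sum_{\alpha\in G_n,\ \mathcal T_G(\alpha)=e}\alpha$, and $\mathcal E(\mathcal T_G)$ is the graded span of these elements; $(|\vee T)^g$ denotes a sequence of length one. $\Sigma(G)$ (Mantaci-Reutenauer Hopf algebra): for $\sigma\in\mathfrak S_n$ let $D(\sigma)=(i_1,i_2-i_1,\dots,n-i_r)$ where $\{i_1<\dots<i_r\}=\{i\in[1,n-1]:\sigma(i)>\sigma(i+1)\}$; $D(w)=D(\mathrm{std}(w))$; $D_G(\sigma^{\mathbf g})=D(\sigma_1)^{g_1}\cdots D(\sigma_k)^{g_k}$, where $\mathbf c^g$ denotes the word obtained by colouring each part of $\mathbf c$ by $g$. $\Sigma(G)$ is the graded span of the elements $\sum_{\alpha\in G_n,\ D_G(\alpha)=e}\alpha$. *)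

(* Defs.v *)
From HB Require Import structures.
From mathcomp Require Import all_boot all_order all_algebra all_fingroup.
From mathcomp Require Import finmap.
From mathcomp Require Export monalg.

Set Implicit Arguments.
Unset Strict Implicit.
Unset Printing Implicit Defensive.

Import GRing.Theory.
Local Open Scope ring_scope.

(* Vector spaces are subspaces of free ones: {malg K[X]} is the K-vector      *)
(* space with basis X (written << x >> for x in X), and {malg K[X * Y]} is    *)
(* the tensor product of {malg K[X]} and {malg K[Y]}, << (x, y) >> being the  *)
(* tensor product of << x >> and << y >>.                                     *)

Section LinearExtension.
Variables (K : fieldType) (X : choiceType) (V : lmodType K) (f : X -> V).

Definition lext (x : {malg K[X]}) : V := \sum_(k <- msupp x) x@_k *: f k.

Lemma lextEw (d : {fset X}) (x : {malg K[X]}) :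
  (msupp x `<=` d)%fset -> lext x = \sum_(k <- d) x@_k *: f k.
Proof.
move=> le_xd; rewrite /lext (big_fset_incl _ le_xd) //.
by move=> k _ /mcoeff_outdom ->; rewrite scale0r.
Qed.

Lemma lext_is_linear : linear lext.
Proof.
move=> c x y; set d := (msupp x `|` msupp y)%fset.
have le_x : (msupp x `<=` d)%fset by apply: fsubsetUl.
have le_y : (msupp y `<=` d)%fset by apply: fsubsetUr.
have le_cxy : (msupp (c *: x + y) `<=` d)%fset.
  apply: fsubset_trans (msuppD_le _ _) _; rewrite fsubUset le_y andbT.
  exact: fsubset_trans (msuppZ_le _ _) le_x.
rewrite (lextEw le_x) (lextEw le_y) (lextEw le_cxy) scaler_sumr -big_split /=.
by apply: eq_bigr => k _; rewrite mcoeffD mcoeffZ scalerDl scalerA.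
Qed.

HB.instance Definition _ :=
  GRing.isLinear.Build K {malg K[X]} V *:%R lext lext_is_linear.

End LinearExtension.

Section Tensor.
Variable K : fieldType.

Definition lspan (V : lmodType K) (B : V -> Prop) (x : V) : Prop :=
  exists s : seq (K * V),
    (forall p, p \in s -> B p.2) /\ x = \sum_(p <- s) p.1 *: p.2.

Definition tens (X Y : choiceType) (x : {malg K[X]}) (y : {malg K[Y]}) :
    {malg K[(X * Y)%type]} :=
  \sum_(a <- msupp x) \sum_(b <- msupp y) << x@_a * y@_b *g (a, b) >>.

Definition tens_map (X X' Y Y' : choiceType) (f : {malg K[X]} -> {malg K[X']})
    (g : {malg K[Y]} -> {malg K[Y']}) : {malg K[(X * Y)%type]} -> {malg K[(X' * Y')%type]} :=
  lext (fun p => tens (f << p.1 >>) (g << p.2 >>)).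

Definition tens_assoc (X Y Z : choiceType) :
    {malg K[(X * (Y * Z))%type]} -> {malg K[(X * Y * Z)%type]} :=
  lext (fun p => << (p.1, p.2.1, p.2.2) >>).

Definition tens_sub (X Y : choiceType) (P : {malg K[X]} -> Prop)
    (Q : {malg K[Y]} -> Prop) : {malg K[(X * Y)%type]} -> Prop :=
  lspan (fun z => exists x y, [/\ P x, Q y & z = tens x y]).

End Tensor.

Section GradedHopf.
Variable K : fieldType.

Record hopf_data (X : choiceType) := HopfData {
  hmulT : {linear {malg K[(X * X)%type]} -> {malg K[X]}};
  hone : {malg K[X]};
  hcomul : {linear {malg K[X]} -> {malg K[(X * X)%type]}};
  hcounit : {linear {malg K[X]} -> K^o}
}.

Section Ops.
Variables (X : choiceType) (H : hopf_data X).

Definition hmul (x y : {malg K[X]}) : {malg K[X]} := hmulT H (tens x y).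

(* (a (x) b) (c (x) d) = ac (x) bd *)
Definition hmul2 (s t : {malg K[(X * X)%type]}) : {malg K[(X * X)%type]} :=
  lext (fun p => lext (fun q => tens (hmul << p.1 >> << q.1 >>)
                                     (hmul << p.2 >> << q.2 >>)) t) s.

End Ops.

Section Graded.
Variables (X : choiceType) (H : hopf_data X) (A : nat -> {malg K[X]} -> Prop).

Definition direct_sum (x : {malg K[X]}) : Prop :=
  exists (n : nat) (a : nat -> {malg K[X]}),
    (forall i, A i (a i)) /\ x = \sum_(i < n) a i.

Definition tens_degree (n : nat) (z : {malg K[(X * X)%type]}) : Prop :=
  exists t : nat -> {malg K[(X * X)%type]},
    (forall i, (i <= n)%N -> tens_sub (A i) (A (n - i)%N) (t i))
    /\ z = \sum_(i < n.+1) t i.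

Record is_antipode (S : {linear {malg K[X]} -> {malg K[X]}}) : Prop := {
  antipode_graded : forall n x, A n x -> A n (S x);
  antipode_l : forall x, direct_sum x ->
    hmulT H (tens_map S idfun (hcomul H x)) = hcounit H x *: hone H;
  antipode_r : forall x, direct_sum x ->
    hmulT H (tens_map idfun S (hcomul H x)) = hcounit H x *: hone H
}.

(* The direct sum of the A n, with the operations restricted from H, is a     *)
(* graded connected Hopf algebra.                                             *)
Record graded_connected_hopf : Prop := {
  gch_zero : forall n, A n 0;
  gch_lin : forall n c x y, A n x -> A n y -> A n (c *: x + y);
  gch_direct : forall n (a : nat -> {malg K[X]}), (forall i, A i (a i)) ->
    \sum_(i < n) a i = 0 -> forall i, (i < n)%N -> a i = 0;
  gch_mul : forall i j x y, A i x -> A j y -> A (i + j)%N (hmul H x y);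
  gch_comul : forall n x, A n x -> tens_degree n (hcomul H x);
  gch_counit : forall n x, A n.+1 x -> hcounit H x = 0;
  gch_connected : forall x, A 0%N x <-> exists c, x = c *: hone H;
  gch_mulA : forall x y z, direct_sum x -> direct_sum y -> direct_sum z ->
    hmul H x (hmul H y z) = hmul H (hmul H x y) z;
  gch_mul1 : forall x, direct_sum x -> hmul H (hone H) x = x;
  gch_mulr1 : forall x, direct_sum x -> hmul H x (hone H) = x;
  gch_comulA : forall x, direct_sum x ->
    tens_assoc (tens_map idfun (hcomul H) (hcomul H x))
    = tens_map (hcomul H) idfun (hcomul H x);
  gch_counitl : forall x, direct_sum x ->
    lext (fun p => hcounit H << p.1 >> *: << p.2 >>) (hcomul H x) = x;
  gch_counitr : forall x, direct_sum x ->
    lext (fun p => hcounit H << p.2 >> *: << p.1 >>) (hcomul H x) = x;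
  gch_comul1 : hcomul H (hone H) = tens (hone H) (hone H);
  gch_comulM : forall x y, direct_sum x -> direct_sum y ->
    hcomul H (hmul H x y) = hmul2 H (hcomul H x) (hcomul H y);
  gch_counit1 : hcounit H (hone H) = 1;
  gch_counitM : forall x y, direct_sum x -> direct_sum y ->
    hcounit H (hmul H x y) = hcounit H x * hcounit H y :> K;
  gch_antipode : exists S, is_antipode S
}.

End Graded.

Record graded_connected_hopf_subalgebra (X : choiceType) (H : hopf_data X)
    (A B : nat -> {malg K[X]} -> Prop) : Prop := {
  gchs_ambient : graded_connected_hopf H A;
  gchs_sub : forall n x, B n x -> A n x;
  gchs_hopf : graded_connected_hopf H B;
  gchs_antipode : forall S, is_antipode H A S ->
    forall n x, B n x -> B n (S x)
}.

Record graded_hopf_morphism (X X' : choiceType)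
    (H : hopf_data X) (A : nat -> {malg K[X]} -> Prop)
    (H' : hopf_data X') (A' : nat -> {malg K[X']} -> Prop)
    (phi : {linear {malg K[X]} -> {malg K[X']}}) : Prop := {
  ghm_graded : forall n x, A n x -> A' n (phi x);
  ghm_one : phi (hone H) = hone H';
  ghm_mul : forall x y, direct_sum A x -> direct_sum A y ->
    phi (hmul H x y) = hmul H' (phi x) (phi y);
  ghm_counit : forall x, direct_sum A x -> hcounit H' (phi x) = hcounit H x;
  ghm_comul : forall x, direct_sum A x ->
    tens_map phi phi (hcomul H x) = hcomul H' (phi x);
  ghm_antipode : forall S S', is_antipode H A S -> is_antipode H' A' S' ->
    forall x, direct_sum A x -> phi (S x) = S' (phi x)
}.

(* {malg K[{fmonom I}]} is the free associative K-algebra on I.               *)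
Definition freely_generated (X : choiceType) (H : hopf_data X)
    (E : {malg K[X]} -> Prop) (I : choiceType) (gen : I -> {malg K[X]}) : Prop :=
  exists Phi : {linear {malg K[{fmonom I}]} -> {malg K[X]}},
    [/\ Phi 1 = hone H,
        forall p q, Phi (p * q) = hmul H (Phi p) (Phi q),
        forall i, Phi << fmu i >> = gen i,
        injective Phi
      & forall x, E x <-> exists p, Phi p = x].

End GradedHopf.

Section ColouredPermutations.
Variable G : finGroupType.

(* CPerm sigma g stands for sigma . (g_1, ..., g_n), i.e. for the coloured    *)
(* word sigma(1)^{g_1} ... sigma(n)^{g_n}; 'I_n = {0, ..., n-1} replaces      *)
(* [1, n].                                                                    *)
Record cperm (n : nat) := CPerm {
  cp_perm : 'S_n;
  cp_col : {ffun 'I_n -> G}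
}.

Section WreathGroup.
Variable n : nat.
Implicit Types a b c : cperm n.

Definition cperm_pair a : 'S_n * {ffun 'I_n -> G} := (cp_perm a, cp_col a).
Definition pair_cperm (p : 'S_n * {ffun 'I_n -> G}) : cperm n := CPerm p.1 p.2.
Lemma cperm_pairK : cancel cperm_pair pair_cperm. Proof. by case. Qed.

HB.instance Definition _ := Finite.copy (cperm n) (can_type cperm_pairK).

Local Open Scope group_scope.

(* (s * t) x = t (s x) in {perm _}: here cp_perm b * cp_perm a is the         *)
(* composite "cp_perm b, then cp_perm a".  The colours come from              *)
(* (g_1, ..., g_n) . tau = tau . (g_{tau(1)}, ..., g_{tau(n)}).               *)
Definition cperm_mul a b : cperm n :=
  CPerm (cp_perm b * cp_perm a)
        [ffun i => cp_col a (cp_perm b i) * cp_col b i].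

Definition cperm_one : cperm n := CPerm 1 [ffun=> 1].

Definition cperm_inv a : cperm n :=
  CPerm (cp_perm a)^-1 [ffun i => (cp_col a ((cp_perm a)^-1 i))^-1].

Lemma cperm_mulA : associative cperm_mul.
Proof.
move=> a b c; congr CPerm; first by rewrite /= mulgA.
by apply/ffunP=> i; rewrite !ffunE /= ?ffunE permM mulgA.
Qed.

Lemma cperm_mul1 : left_id cperm_one cperm_mul.
Proof.
case=> s g; congr CPerm; first by rewrite /= mulg1.
by apply/ffunP=> i; rewrite !ffunE mul1g.
Qed.

Lemma cperm_mulV : left_inverse cperm_one cperm_inv cperm_mul.
Proof.
case=> s g; congr CPerm; first by rewrite /= mulgV.
by apply/ffunP=> i; rewrite !ffunE /= permK mulVg.
Qed.

HB.instance Definition _ :=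
  Finite_isGroup.Build (cperm n) cperm_mulA cperm_mul1 cperm_mulV.

Definition of_perm (u : 'S_n) : cperm n := CPerm u [ffun=> 1].

End WreathGroup.

Definition sum_fun n m (s : 'S_n) (t : 'S_m) (k : 'I_(n + m)) : 'I_(n + m) :=
  match split k with
  | inl i => lshift m (s i)
  | inr j => rshift n (t j)
  end.

Lemma sum_fun_inj n m (s : 'S_n) (t : 'S_m) : injective (sum_fun s t).
Proof.
move=> k l; rewrite /sum_fun.
case: (split_ordP k) => i ->; case: (split_ordP l) => j -> /eqP.
- by rewrite eq_lshift => /eqP/perm_inj ->.
- by rewrite eq_lrshift.
- by rewrite eq_rlshift.
- by rewrite eq_rshift => /eqP/perm_inj ->.
Qed.

Definition cperm_sum n m (a : cperm n) (b : cperm m) : cperm (n + m) :=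
  CPerm (perm (@sum_fun_inj n m (cp_perm a) (cp_perm b)))
        [ffun k => match split k with
                   | inl i => cp_col a i
                   | inr j => cp_col b j
                   end].

Definition grassmannian n m : {set 'S_(n + m)} :=
  [set u : 'S_(n + m) |
     [forall i : 'I_n, forall j : 'I_n,
        (i < j)%N ==> (u (lshift m i) < u (lshift m j))%N]
  && [forall i : 'I_m, forall j : 'I_m,
        (i < j)%N ==> (u (rshift n i) < u (rshift n j))%N]].

Definition gcperm := {n : nat & cperm n}.
HB.instance Definition _ := Choice.on gcperm.

Definition gc n (a : cperm n) : gcperm := Tagged cperm a.

End ColouredPermutations.

Section ColouredPermutationAlgebra.
Variables (K : fieldType) (G : finGroupType).

Definition KG_mul_basis (p : gcperm G * gcperm G) : {malg K[gcperm G]} :=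
  \sum_(u in grassmannian (tag p.1) (tag p.2))
    << gc (of_perm G u * cperm_sum (tagged p.1) (tagged p.2))%g >>.

(* For each i there is exactly one pair (b, c) in G_i x G_{n-i} with          *)
(* a^-1 = u (b x c)^-1 for some u in X_(i, n-i), so the inner sum has exactly *)
(* one term.  The equation is stated in the disjoint union gcperm G to        *)
(* compare elements of G_n and of G_{i + (n - i)}.                            *)
Definition KG_comul_basis (a : gcperm G) : {malg K[(gcperm G * gcperm G)%type]} :=
  \sum_(i < (tag a).+1)
    \sum_(p : cperm G i * cperm G (tag a - i) |
          [exists u in grassmannian i (tag a - i),
             gc (tagged a)^-1%g
             == gc (of_perm G u * (cperm_sum p.1 p.2)^-1)%g])
      << (gc p.1, gc p.2) >>.

Definition KG : hopf_data K (gcperm G) :=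
  HopfData (lext KG_mul_basis) << gc (cperm_one G 0) >> (lext KG_comul_basis)
    (lext (fun a : gcperm G => (tag a == 0%N)%:R : K^o)).

Definition KG_part (n : nat) (x : {malg K[gcperm G]}) : Prop :=
  forall a, a \in msupp x -> tag a = n.

Section ClassSums.
Variables (T : eqType) (stat : forall n, cperm G n -> T).

Definition class_sum (n : nat) (e : T) : {malg K[gcperm G]} :=
  \sum_(a : cperm G n | stat a == e) << gc a >>.

Definition class_span (n : nat) : {malg K[gcperm G]} -> Prop :=
  lspan (fun x => exists a : cperm G n, x = class_sum n (stat a)).

End ClassSums.

End ColouredPermutationAlgebra.

Arguments class_sum K {G T} stat n e.
Arguments class_span K {G T} stat n _.
(* The linear map f_*.                                                        *)
Definition push (K : fieldType) (G G' : finGroupType) (f : G -> G') :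
    {linear {malg K[gcperm G]} -> {malg K[gcperm G']}} :=
  lext (fun a => << gc (CPerm (cp_perm (tagged a))
                             [ffun i => f (cp_col (tagged a) i)]) >>).

(* Words on the positive integers are sequences of type seq nat.              *)

(* std(w) as the word sigma(1) ... sigma(n) with values in [1, n]: equal      *)
(* letters are ranked from left to right.                                     *)
Definition std (w : seq nat) : seq nat :=
  [seq (count (fun b => b < nth 0 w i) w
        + count_mem (nth 0 w i) (take i w)).+1%N | i <- iota 0 (size w)]%N.

Inductive tree := Leaf | Graft of tree & tree.

Fixpoint tree_encode (t : tree) : GenTree.tree unit :=
  match t with
  | Leaf => GenTree.Leaf tt
  | Graft l r => GenTree.Node 0 [:: tree_encode l; tree_encode r]
  end.

Fixpoint tree_decode (t : GenTree.tree unit) : tree :=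
  match t with
  | GenTree.Node _ [:: l; r] => Graft (tree_decode l) (tree_decode r)
  | _ => Leaf
  end.

Lemma tree_encodeK : cancel tree_encode tree_decode.
Proof. by elim=> //= l -> r ->. Qed.

HB.instance Definition _ := Countable.copy tree (can_type tree_encodeK).

(* T belongs to Y_n iff internal T = n.                                       *)
Fixpoint internal (t : tree) : nat :=
  match t with
  | Leaf => 0
  | Graft l r => (internal l + internal r).+1
  end.

(* The recursion T(w' 1 w'') = T(std w') \/ T(std w''), with a bound k on the *)
(* length of the word.                                                        *)
Fixpoint word_tree_rec (k : nat) (w : seq nat) : tree :=
  match k, w with
  | k'.+1, _ :: _ =>
      let s := std w in
      let i := index 1%N s in
      Graft (word_tree_rec k' (take i s)) (word_tree_rec k' (drop i.+1 s))
  | _, _ => Leaf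
  end.

Definition word_tree (w : seq nat) : tree := word_tree_rec (size w) w.

(* D(w) = (i_1, i_2 - i_1, ..., n - i_r) *)
Definition descents (s : seq nat) : seq nat :=
  [seq i <- iota 1 (size s).-1 | (nth 0 s i < nth 0 s i.-1)%N].

Definition descent_comp (w : seq nat) : seq nat :=
  let s := std w in
  pairmap (fun i j => j - i)%N 0%N (rcons (descents s) (size s)).

(* The rainbow decomposition: monochromatic words paired with their colours.  *)
Fixpoint rainbow (C : eqType) (w : seq (nat * C)) : seq (seq nat * C) :=
  match w with
  | [::] => [::]
  | (a, c) :: w' =>
      match rainbow w' with
      | (v, d) :: r => if c == d then (a :: v, c) :: r
                       else ([:: a], c) :: (v, d) :: r
      | [::] => [:: ([:: a], c)]
      end
  end.

Section ColouredStatistics.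
Variables (G : finGroupType) (n : nat).

Definition cword (a : cperm G n) : seq (nat * G) :=
  [seq ((cp_perm a i).+1, cp_col a i) | i <- enum 'I_n].

Definition tree_stat (a : cperm G n) : seq (tree * G) :=
  [seq (word_tree p.1, p.2) | p <- rainbow (cword a)].

Definition descent_stat (a : cperm G n) : seq (nat * G) :=
  flatten [seq [seq (c, p.2) | c <- descent_comp p.1]
          | p <- rainbow (cword a)].

End ColouredStatistics.

Section TreeHopf.
Variables (K : fieldType) (G : finGroupType).

Definition tree_part : nat -> {malg K[gcperm G]} -> Prop :=
  class_span K (@tree_stat G).

Definition mantaci_reutenauer_part : nat -> {malg K[gcperm G]} -> Prop :=
  class_span K (@descent_stat G).

(* b_{(| \/ T)^g}: for T in Y_{n-1}, the index n is (internal T).+1.          *)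
Definition tree_generator (p : tree * G) : {malg K[gcperm G]} :=
  class_sum K (@tree_stat G) (internal p.1).+1 [:: (Graft Leaf p.1, p.2)].

End TreeHopf.

Arguments KG_part K G n x : clear implicits.
Arguments tree_part K G n _ : clear implicits.
Arguments mantaci_reutenauer_part K G n _ : clear implicits.
Arguments tree_generator K G p : clear implicits.

(* Main.v *)
Require Import Defs.
From HB Require Import structures.
From mathcomp Require Import all_boot all_order all_algebra all_fingroup.
From mathcomp Require Import finmap zify.

Set Implicit Arguments.
Unset Strict Implicit.
Unset Printing Implicit Defensive.

Import GRing.Theory.
Local Open Scope ring_scope.

(** Every coloured word represents a coloured permutation by standardisation,
    so an element [x] of the algebra of coloured permutations is a function on
    coloured words, which sends [w] to the coefficient [x@_(stdw w)]. In these
    terms a product is a convolution along the ways of cutting a word in two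
    ([hmul_coef]), and the coefficient of a coproduct at a pair of words, the
    first below the second, is a sum over their shuffles ([comul_coef]). The
    axioms of a bialgebra become identities between sums over cuts and
    shuffles ([KG_bialgebra]). An antipode exists by Takeuchi's geometric
    series, and the antipode axiom determines it by recursion on the degree,
    because the algebra is connected ([gch_takeuchi], [left_antipodeS]).

    The sequence of coloured trees of a word carries the same information as
    its colours together with the domination relation inside its monochromatic
    factors, where a position dominates another one when it has the smallest
    letter between them ([word_statP]). This relation restricts to prefixes
    and suffixes, and for shuffles of two separated words along a given pattern
    it is determined by the relations of the two words ([tree_equiv_along]).
    Hence the functions on words that are constant on the classes form a
    subspace stable under all operations ([class_span_subbialgebra]); it is
    spanned by the sums of the classes ([class_spanP]), and any antipode
    preserves it by the recursion. Descents are read off domination, so the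
    Mantaci-Reutenauer sums are sums of such classes.

    For freeness, a word is cut at its coloured left-to-right minima. Each
    piece is monochromatic and starts with its smallest letter, which makes it
    an element of the class of a generator; the resulting monomial [lead w]
    depends only on the class of [w], and this gives a bijection between
    classes and monomials in the generators ([eq_lead], [lead_surj]). The
    product of the generators indexed by [m] is the sum of the coloured
    permutations that can be cut along [m], and such a word has a strictly
    shorter leading monomial unless this is [m] itself ([monomial_coef],
    [fits_leq]). So the passage from monomials to class sums is unitriangular
    for the length of monomials: the generators are free ([free_map_inj]) and
    they generate ([class_sum_image]).

    Pushing colours forward along a homomorphism commutes with the product and
    the coproduct, and maps class functions to class functions, since the lifts
    of the colours of two equivalent words correspond to each other inside
    classes ([push_graded]). Compatibility with antipodes follows from the
    recursion ([antipode_natural]). *)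

(** * Linear maps between free vector spaces *)

Section FreeSpaces.
Variable K : fieldType.

Lemma malg_ind (X : choiceType) (P : {malg K[X]} -> Prop) :
    (forall c x y, P x -> P y -> P (c *: x + y)) -> P 0 ->
    (forall k, P << k >>) -> forall x, P x.
Proof.
move=> P_lin P_0 P_U x; rewrite [x]monalgE.
elim/big_ind: _ => // [y z Py Pz|k _]; first by rewrite -[y]scale1r; apply: P_lin.
have ->: << x@_k *g k >> = x@_k *: << k >> + 0 :> {malg K[X]}.
  by apply/malgP=> l; rewrite addr0 mcoeffZ !mcoeffU mulr_natr.
exact: P_lin.
Qed.

Lemma mcoeff_basis (X : choiceType) (k l : X) :
  (<< k >> : {malg K[X]})@_l = (k == l)%:R.
Proof. exact: mcoeffU. Qed.

Lemma lextU (X : choiceType) (V : lmodType K) (f : X -> V) k :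
  lext f (<< k >> : {malg K[X]}) = f k.
Proof. by rewrite /lext msuppU oner_eq0 big_seq_fset1 mcoeffUU scale1r. Qed.

Lemma form_ext (X : choiceType) (f g : {malg K[X]} -> K) :
    (forall c x y, f (c *: x + y) = c * f x + f y) ->
    (forall c x y, g (c *: x + y) = c * g x + g y) ->
    (forall k, f << k >> = g << k >>) ->
  f =1 g.
Proof.
move=> flin glin eq_fg; apply: malg_ind => [c x y IHx IHy||//].
  by rewrite flin glin IHx IHy.
have zero (h : {malg K[X]} -> K) :
    (forall c x y, h (c *: x + y) = c * h x + h y) -> h 0 = 0.
  by move/(_ (-1) 0 0); rewrite scaler0 add0r mulN1r addNr.
by rewrite !zero.
Qed.

(** Dualises a formula on basis elements: if the coefficient of [p] in
    [L << k >>] counts the occurrences of [k] in a list, then the coefficient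
    of [p] in [L x] sums those of [x] over this list. *)
Lemma coef_of_basis (X Y : choiceType) (L : {malg K[X]} -> {malg K[Y]}) (p : Y)
    (I : Type) (r : seq I) (e : I -> X) :
    (forall c x y, L (c *: x + y) = c *: L x + L y) ->
    (forall k, (L << k >>)@_p = \sum_(i <- r) (k == e i)%:R) ->
  forall x, (L x)@_p = \sum_(i <- r) x@_(e i).
Proof.
move=> Llin LU; apply: form_ext => [c x y|c x y|k].
- by rewrite Llin mcoeffD mcoeffZ.
- rewrite mulr_sumr -big_split; apply: eq_bigr => i _.
  by rewrite mcoeffD mcoeffZ.
by rewrite LU; apply: eq_bigr => i _; rewrite mcoeff_basis.
Qed.

Lemma malg_ext (X : choiceType) (V : lmodType K)
    (f g : {linear {malg K[X]} -> V}) :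
  (forall k, f << k >> = g << k >>) -> f =1 g.
Proof.
move=> eq_fg; apply: malg_ind => // [c x y fx fy|]; last by rewrite !linear0.
by rewrite !linearP fx fy.
Qed.

Definition restrict (X : choiceType) (P : pred X) : {malg K[X]} -> {malg K[X]} :=
  lext (fun p => if P p then << p >> else 0).

Lemma restrictE (X : choiceType) (P : pred X) x p :
  (restrict P x)@_p = if P p then x@_p else 0.
Proof.
apply: (form_ext (f := fun x => (restrict P x)@_p)
  (g := fun x => if P p then x@_p else 0)) => [c y z|c y z|q].
- by rewrite /restrict linearP mcoeffD mcoeffZ.
- by case: ifP => _; rewrite ?mcoeffD ?mcoeffZ // mulr0 addr0.
rewrite /restrict lextU; have [<-|ne_qp] := eqVneq q p.
  by case: ifP => _; rewrite ?mcoeff0.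
by case: (P q); case: (P p); rewrite ?mcoeff_basis ?(negPf ne_qp) ?mcoeff0.
Qed.

Section Tensors.
Variables X Y : choiceType.
Implicit Types (x : {malg K[X]}) (y : {malg K[Y]}).

Lemma tensE x y p : (tens x y)@_p = x@_p.1 * y@_p.2.
Proof.
case: p => a b; rewrite /tens /= raddf_sum /=.
transitivity (\sum_(a' <- msupp x) x@_a' * y@_b *+ (a' == a)).
  apply: eq_bigr => a' _; rewrite raddf_sum /=.
  transitivity (\sum_(b' <- msupp y) (x@_a' * y@_b' *+ (a' == a)) *+ (b' == b)).
    apply: eq_bigr => b' _; rewrite mcoeffU xpair_eqE -mulrnA mulnb.
    by case: (_ == _); case: (_ == _).
  case: (boolP (b \in msupp y)) => yb; last first.
    rewrite (mcoeff_outdom yb) mulr0 mul0rn big_seq big1 // => b' yb'.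
    by rewrite (_ : (b' == b) = false) //; apply: contraNF yb => /eqP<-.
  rewrite (big_fsetD1 b) //= eqxx big_seq big1 ?addr0 // => b'.
  by rewrite in_fsetD1 => /andP[/negPf-> _].
case: (boolP (a \in msupp x)) => xa; last first.
  rewrite (mcoeff_outdom xa) mul0r big_seq big1 // => a' xa'.
  by rewrite (_ : (a' == a) = false) //; apply: contraNF xa => /eqP<-.
rewrite (big_fsetD1 a) //= eqxx big_seq big1 ?addr0 // => a'.
by rewrite in_fsetD1 => /andP[/negPf-> _].
Qed.

Lemma tensU a b :
  tens << a >> << b >> = << (a, b) >> :> {malg K[(X * Y)%type]}.
Proof.
apply/malgP=> -[a' b']; rewrite tensE /= !mcoeff_basis xpair_eqE -natrM mulnb.
by [].
Qed.

Lemma tensPl c x x' y : tens (c *: x + x') y = c *: tens x y + tens x' y.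
Proof.
apply/malgP=> p.
by rewrite mcoeffD mcoeffZ !tensE mcoeffD mcoeffZ mulrDl mulrA.
Qed.

Lemma tensPr c x y y' : tens x (c *: y + y') = c *: tens x y + tens x y'.
Proof.
apply/malgP=> p.
by rewrite mcoeffD mcoeffZ !tensE mcoeffD mcoeffZ mulrDr mulrCA.
Qed.

Lemma tens0l y : tens (0 : {malg K[X]}) y = 0.
Proof. by apply/malgP=> p; rewrite tensE !mcoeff0 mul0r. Qed.

Lemma tens0r x : tens x (0 : {malg K[Y]}) = 0.
Proof. by apply/malgP=> p; rewrite tensE !mcoeff0 mulr0. Qed.

Lemma tensZl c x y : tens (c *: x) y = c *: tens x y.
Proof. by rewrite -[c *: x]addr0 tensPl tens0l addr0. Qed.

Lemma tensZr c x y : tens x (c *: y) = c *: tens x y.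
Proof. by rewrite -[c *: y]addr0 tensPr tens0r addr0. Qed.

End Tensors.

HB.instance Definition _ (X X' Y Y' : choiceType)
    (f : {malg K[X]} -> {malg K[X']}) (g : {malg K[Y]} -> {malg K[Y']}) :=
  GRing.Linear.on (tens_map f g).
HB.instance Definition _ (X Y Z : choiceType) :=
  GRing.Linear.on (@tens_assoc K X Y Z).

Lemma tens_mapP (X X' Y Y' : choiceType) (f : {malg K[X]} -> {malg K[X']})
    (g : {malg K[Y]} -> {malg K[Y']}) c u v :
  tens_map f g (c *: u + v) = c *: tens_map f g u + tens_map f g v.
Proof. exact: linearP. Qed.

Lemma tens_map0 (X X' Y Y' : choiceType) (f : {malg K[X]} -> {malg K[X']})
    (g : {malg K[Y]} -> {malg K[Y']}) : tens_map f g 0 = 0.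
Proof. exact: raddf0. Qed.

Lemma tens_assocP (X Y Z : choiceType) c u v :
  tens_assoc (c *: u + v) = c *: tens_assoc u + tens_assoc v
  :> {malg K[(X * Y * Z)%type]}.
Proof. exact: linearP. Qed.

Lemma tens_assoc0 (X Y Z : choiceType) :
  tens_assoc 0 = 0 :> {malg K[(X * Y * Z)%type]}.
Proof. exact: raddf0. Qed.

Lemma tens_assocU (X Y Z : choiceType) a b c :
  tens_assoc << (a, (b, c)) >> = << (a, b, c) >> :> {malg K[(X * Y * Z)%type]}.
Proof. by rewrite /tens_assoc lextU. Qed.

Lemma tens_mapU (X X' Y Y' : choiceType) (f : {malg K[X]} -> {malg K[X']})
    (g : {malg K[Y]} -> {malg K[Y']}) a b :
  tens_map f g << (a, b) >> = tens (f << a >>) (g << b >>).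
Proof. by rewrite /tens_map lextU. Qed.

Lemma tens_mapE (X X' Y Y' : choiceType)
    (f : {linear {malg K[X]} -> {malg K[X']}})
    (g : {linear {malg K[Y]} -> {malg K[Y']}}) x y :
  tens_map f g (tens x y) = tens (f x) (g y).
Proof.
elim/malg_ind: x => [c x x' IHx IHx'||a].
- by rewrite tensPl linearP /= IHx IHx' linearP tensPl.
- by rewrite tens0l !raddf0 tens0l.
elim/malg_ind: y => [c y y' IHy IHy'||b].
- by rewrite tensPr linearP /= IHy IHy' linearP tensPr.
- by rewrite tens0r !raddf0 tens0r.
by rewrite tensU /tens_map lextU.
Qed.

Section Span.
Variables (V : lmodType K) (B : V -> Prop).

Lemma lspan_ind (P : V -> Prop) :
    P 0 -> (forall c x y, P x -> P y -> P (c *: x + y)) ->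
    (forall x, B x -> P x) ->
  forall x, lspan B x -> P x.
Proof.
move=> P0 Plin PB x [s [sB ->{x}]].
elim: s sB => [|[c v] s IHs] sB; first by rewrite big_nil.
rewrite big_cons; apply: Plin; first by apply/PB/(sB (c, v))/mem_head.
by apply: IHs => p sp; apply: sB; rewrite inE sp orbT.
Qed.

Lemma lspan0 : lspan B 0.
Proof. by exists [::]; split=> //; rewrite big_nil. Qed.

Lemma lspan_gen x : B x -> lspan B x.
Proof.
move=> Bx; exists [:: (1, x)]; rewrite big_seq1 scale1r; split=> // p.
by rewrite inE => /eqP->.
Qed.

Lemma lspanP c x y : lspan B x -> lspan B y -> lspan B (c *: x + y).
Proof.
move=> [s [sB ->]] [t [tB ->]]; exists ([seq (c * p.1, p.2) | p <- s] ++ t).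
split=> [p|].
  by rewrite mem_cat => /orP[/mapP[q sq ->]|/tB//]; apply: (sB q).
rewrite big_cat big_map scaler_sumr; congr (_ + _).
by apply: eq_bigr => p _; rewrite scalerA.
Qed.

End Span.

Lemma lspan_sum (V : lmodType K) (B : V -> Prop) (I : Type) (r : seq I)
    (P : pred I) (F : I -> V) :
  (forall i, P i -> lspan B (F i)) -> lspan B (\sum_(i <- r | P i) F i).
Proof.
move=> BF; elim/big_ind: _ => // [|x y Bx By]; first exact: lspan0.
by rewrite -[x]scale1r; apply: lspanP.
Qed.

End FreeSpaces.

(** * Antipodes of graded connected bialgebras *)

Section GenericHopf.
Variables (K : fieldType) (X : choiceType) (H : hopf_data K X).
Local Notation V := {malg K[X]}.
Local Notation one := (hone H).
Local Notation mul := (hmul H).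

Lemma hmulPl c x x' y : mul (c *: x + x') y = c *: mul x y + mul x' y.
Proof. by rewrite /hmul tensPl linearP. Qed.

Lemma hmulPr c x y y' : mul x (c *: y + y') = c *: mul x y + mul x y'.
Proof. by rewrite /hmul tensPr linearP. Qed.

Lemma hmul0l y : mul 0 y = 0. Proof. by rewrite /hmul tens0l linear0. Qed.
Lemma hmul0r x : mul x 0 = 0. Proof. by rewrite /hmul tens0r linear0. Qed.

Lemma hmulZl c x y : mul (c *: x) y = c *: mul x y.
Proof. by rewrite /hmul tensZl linearZ. Qed.

Lemma hmulZr c x y : mul x (c *: y) = c *: mul x y.
Proof. by rewrite /hmul tensZr linearZ. Qed.

(** The axioms of a Hopf algebra that are inherited by every subspace stable
    under the operations. *)
Record bialgebra : Prop := {
  bi_mulA : forall x y z, mul x (mul y z) = mul (mul x y) z;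
  bi_mul1 : forall x, mul one x = x;
  bi_mulr1 : forall x, mul x one = x;
  bi_comulA : forall x,
    tens_assoc (tens_map idfun (hcomul H) (hcomul H x))
    = tens_map (hcomul H) idfun (hcomul H x);
  bi_counitl : forall x,
    lext (fun p => hcounit H << p.1 >> *: << p.2 >>) (hcomul H x) = x;
  bi_counitr : forall x,
    lext (fun p => hcounit H << p.2 >> *: << p.1 >>) (hcomul H x) = x;
  bi_comul1 : hcomul H one = tens one one;
  bi_comulM : forall x y,
    hcomul H (mul x y) = hmul2 H (hcomul H x) (hcomul H y);
  bi_counit1 : hcounit H one = 1;
  bi_counitM : forall x y,
    hcounit H (mul x y) = hcounit H x * hcounit H y :> K
}.

(** The axioms that have to be checked for each graded subspace; only the
    antipode is missing from them, and connectedness provides it. *)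
Record graded_subbialgebra (A : nat -> V -> Prop) : Prop := {
  gs_zero : forall n, A n 0;
  gs_lin : forall n c x y, A n x -> A n y -> A n (c *: x + y);
  gs_direct : forall n (a : nat -> V), (forall i, A i (a i)) ->
    \sum_(i < n) a i = 0 -> forall i, (i < n)%N -> a i = 0;
  gs_mul : forall i j x y, A i x -> A j y -> A (i + j)%N (mul x y);
  gs_comul : forall n x, A n x -> tens_degree A n (hcomul H x);
  gs_counit : forall n x, A n.+1 x -> hcounit H x = 0;
  gs_connected : forall x, A 0%N x <-> exists c, x = c *: one
}.

Hypothesis bi : bialgebra.

Lemma gch_of_sub A : graded_subbialgebra A ->
  (exists S, is_antipode H A S) -> graded_connected_hopf H A.
Proof. by case: bi => ? ? ? ? ? ? ? ? ? ? [? ? ? ? ? ? ?] ?; split=> //; eauto. Qed.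

Section Sub.
Variable A : nat -> V -> Prop.
Hypothesis gA : graded_subbialgebra A.

Lemma part_direct_sum n x : A n x -> direct_sum A x.
Proof.
move=> Ax; exists n.+1, (fun i => if i == n then x else 0); split=> [i|].
  by case: eqP => [->//|_]; apply: (gs_zero gA).
rewrite big_ord_recr /= eqxx big1 ?add0r // => i _.
by rewrite ltn_eqF // ltn_ord.
Qed.

Lemma part_sum n (I : Type) (r : seq I) (P : pred I) (F : I -> V) :
  (forall i, P i -> A n (F i)) -> A n (\sum_(i <- r | P i) F i).
Proof.
move=> AF; elim/big_ind: _ => // [|x y Ax Ay]; first exact: (gs_zero gA).
by rewrite -[x]scale1r; apply: (gs_lin gA).
Qed.

Lemma part_opp n x : A n x -> A n (- x).
Proof. by move=> Ax; rewrite -scaleN1r -[_ *: x]addr0; apply: (gs_lin gA) Ax (gs_zero gA n). Qed.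

(** Connectedness pins down the last graded component of the coproduct: it
    lies in the tensor product with the scalars, and the counit axiom then
    identifies it. This is what makes antipodes computable by recursion on
    the degree. *)
Lemma comul_top n x : A n.+1 x ->
  exists t : nat -> {malg K[(X * X)%type]},
    (forall i, (i <= n)%N -> tens_sub (A i) (A (n.+1 - i)%N) (t i))
    /\ hcomul H x = \sum_(i < n.+1) t i + tens x one.
Proof.
move=> Ax; have [t [tA Dx]] := gs_comul gA Ax.
exists t; split=> [i le_in|]; first exact/tA/leqW.
rewrite Dx big_ord_recr /=; congr (_ + _).
have [y Dy]: exists y, t n.+1 = tens y one.
  have := tA n.+1 (leqnn _); rewrite subnn.
  move: (t n.+1); apply: lspan_ind => [|c ? ? [y ->] [z ->]|? [y [z []]]].
  - by exists 0; rewrite tens0l.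
  - by exists (c *: y + z); rewrite tensPl.
  move=> _ /(gs_connected gA)[c ->] ->.
  by exists (c *: y); rewrite tensZl tensZr.
suff yx : y = x by rewrite Dy yx.
pose cr : {linear {malg K[(X * X)%type]} -> V} :=
  lext (fun p : X * X => (hcounit H << p.2 >> : K) *: (<< p.1 >> : V)).
have crE u v : cr (tens u v) = hcounit H v *: u.
  elim/malg_ind: u => [c u u' IHu IHu'||a].
  - by rewrite tensPl linearP /= IHu IHu' scalerDr !scalerA mulrC.
  - by rewrite tens0l linear0 scaler0.
  elim/malg_ind: v => [c v v' IHv IHv'||b].
  - by rewrite tensPr !linearP /= IHv IHv' scalerDl scalerA.
  - by rewrite tens0r !linear0 scale0r.
  by rewrite tensU /cr /= lextU.
have := bi_counitr bi x; rewrite -[lext _ _]/(cr _) Dx linear_sum big_ord_recr /=.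
rewrite Dy crE (bi_counit1 bi) scale1r big1 ?add0r //= => i _.
have := tA i (ltnW (ltn_ord i)); move: (t i).
apply: lspan_ind => [|c u v eu ev|_ [u [v [_ Av ->]]]].
- by rewrite linear0.
- by rewrite linearP /= eu ev scaler0 addr0.
by rewrite crE; move: Av; rewrite subSn -1?ltnS // => /(gs_counit gA)->; rewrite scale0r.
Qed.

Definition left_antipode (S : {linear V -> V}) : Prop := forall n x, A n x ->
  hmulT H (tens_map S idfun (hcomul H x)) = hcounit H x *: one.

Lemma left_antipode1 (S : {linear V -> V}) : left_antipode S -> S one = one.
Proof.
move=> antiS; have A1: A 0 one by apply/(gs_connected gA); exists 1; rewrite scale1r.
have := antiS 0%N one A1; rewrite (bi_comul1 bi) tens_mapE -[LHS]/(mul _ _).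
by rewrite (bi_mulr1 bi) (bi_counit1 bi) scale1r.
Qed.

(** The last term of the coproduct contributes [S x] itself to the antipode
    axiom, and the other terms involve [S] in lower degree only. *)
Lemma left_antipodeS (S : {linear V -> V}) n x
    (t : nat -> {malg K[(X * X)%type]}) : left_antipode S -> A n.+1 x ->
    hcomul H x = \sum_(i < n.+1) t i + tens x one ->
  S x = - \sum_(i < n.+1) hmulT H (tens_map S idfun (t i)).
Proof.
move=> antiS Ax Dx; have := antiS _ _ Ax.
rewrite (gs_counit gA Ax) scale0r Dx !linearD /= tens_mapE.
rewrite -[hmulT H (tens _ _)]/(mul _ _) (bi_mulr1 bi).
rewrite (linear_sum (tens_map S idfun)) (linear_sum (hmulT H)) /= addrC.
by move/eqP; rewrite addr_eq0 => /eqP.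
Qed.

Lemma left_antipode_graded (S : {linear V -> V}) : left_antipode S ->
  forall n x, A n x -> A n (S x).
Proof.
move=> antiS; elim/ltn_ind => -[_ x Ax|n IHn x Ax].
  have /(gs_connected gA)[c ->] := Ax; rewrite linearZ left_antipode1 //.
  by apply/(gs_connected gA); exists c.
have [t [tA Dx]] := comul_top Ax; rewrite (left_antipodeS antiS Ax Dx).
apply/part_opp/part_sum => i _.
have := tA i; rewrite -ltnS => /(_ (ltn_ord i)).
move: (t i); apply: lspan_ind => [|c u v Au Av|_ [u [v [Au Av ->]]]].
- by rewrite !linear0; apply: (gs_zero gA).
- by rewrite !linearP; apply: (gs_lin gA).
rewrite tens_mapE -[n.+1](subnKC (ltnW (ltn_ord i))); apply: (gs_mul gA) => //.
exact: IHn.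
Qed.

End Sub.

(** ** Takeuchi's formula

    In the convolution algebra, the identity is the unit [cunit] plus an
    operator [proj] that kills degree 0, and the antipode is the geometric
    series of [- proj]. The [k]-th power of [proj] vanishes in degree less
    than [k], so that the series is finite in each degree; it is a two-sided
    inverse because the powers of [proj] commute with [proj]. *)

Fact conv_key : {c : (V -> V) -> (V -> V) -> {linear V -> V} |
  forall f g x, c f g x = hmulT H (tens_map f g (hcomul H x))}.
Proof. by exists (fun f g => (hmulT H \o tens_map f g) \o hcomul H). Qed.

(** The convolution product of linear maps, characterised by [convE]. *)
Definition conv : (V -> V) -> (V -> V) -> {linear V -> V} := sval conv_key.

Lemma convE f g x : conv f g x = hmulT H (tens_map f g (hcomul H x)).
Proof. exact: (svalP conv_key). Qed.

Definition cunit : {linear V -> V} :=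
  lext (fun a : X => (hcounit H << a >> : K) *: one).
Definition proj : {linear V -> V} := lext (fun a : X => << a >> - cunit << a >>).

Lemma cunitE x : cunit x = hcounit H x *: one.
Proof.
elim/malg_ind: x => [c x y IHx IHy||a]; last by rewrite /cunit /= lextU.
  by rewrite !linearP /= IHx IHy scalerDl scalerA.
by rewrite !linear0 scale0r.
Qed.

Lemma projE x : proj x = x - cunit x.
Proof.
elim/malg_ind: x => [c x y IHx IHy||a]; last by rewrite /proj /= lextU.
  by rewrite (linearP proj) (linearP cunit) IHx IHy scalerBr opprD addrACA.
by rewrite (linear0 proj) (linear0 cunit) subr0.
Qed.

Lemma convPr (f g g' h : V -> V) c :
    (forall x, h x = c *: g x + g' x) ->
  forall x, conv f h x = c *: conv f g x + conv f g' x.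
Proof.
move=> hE x; suff E: tens_map f h (hcomul H x)
    = c *: tens_map f g (hcomul H x) + tens_map f g' (hcomul H x).
  by rewrite (convE f h) (convE f g) (convE f g') E (linearP (hmulT H)).
rewrite /tens_map /lext scaler_sumr -big_split; apply: eq_bigr => p _ /=.
by rewrite hE tensPr scalerDr !scalerA mulrC.
Qed.

Lemma convPl (f g g' h : V -> V) c :
    (forall x, h x = c *: g x + g' x) ->
  forall x, conv h f x = c *: conv g f x + conv g' f x.
Proof.
move=> hE x; suff E: tens_map h f (hcomul H x)
    = c *: tens_map g f (hcomul H x) + tens_map g' f (hcomul H x).
  by rewrite (convE h f) (convE g f) (convE g' f) E (linearP (hmulT H)).
rewrite /tens_map /lext scaler_sumr -big_split; apply: eq_bigr => p _ /=.
by rewrite hE tensPl scalerDr !scalerA mulrC.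
Qed.

Lemma eq_conv (f f' g g' : V -> V) x :
    (forall p, p \in msupp (hcomul H x) ->
       tens (f << p.1 >>) (g << p.2 >>) = tens (f' << p.1 >>) (g' << p.2 >>)) ->
  conv f g x = conv f' g' x.
Proof.
move=> eq_fg; rewrite (convE f g) (convE f' g').
suff ->: tens_map f g (hcomul H x) = tens_map f' g' (hcomul H x) by [].
by apply: eq_big_seq => p /eq_fg->.
Qed.

Lemma convA (f g h : {linear V -> V}) x :
  conv (conv f g) h x = conv f (conv g h) x.
Proof.
have [T TU]: exists T : {linear {malg K[(X * X * X)%type]} -> V},
    forall a b c, T << (a, b, c) >> = mul (mul (f << a >>) (g << b >>)) (h << c >>).
  exists (lext (fun p => mul (mul (f << p.1.1 >>) (g << p.1.2 >>)) (h << p.2 >>))).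
  by move=> a b c; rewrite /= lextU.
have Tl z : hmulT H (tens_map (conv f g) h z) = T (tens_map (hcomul H) idfun z).
  pose L : {linear _ -> V} := hmulT H \o tens_map (conv f g) h.
  pose R : {linear _ -> V} := T \o tens_map (hcomul H) idfun.
  suff: L =1 R by apply.
  apply: malg_ext => -[a b].
  rewrite -[L _]/(hmulT H (tens_map (conv f g) h << (a, b) >>)).
  rewrite -[R _]/(T (tens_map (hcomul H) idfun << (a, b) >>)) !tens_mapU.
  rewrite -[LHS]/(mul (conv f g << a >>) (h << b >>)) convE.
  elim/malg_ind: (hcomul H _) => [c y y' IHy IHy'||[a1 a2]].
  - rewrite tensPl (linearP T) tens_mapP (linearP (hmulT H)) hmulPl.
    exact: (congr2 (fun u v => c *: u + v) IHy IHy').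
  - by rewrite tens0l !tens_map0 !linear0 hmul0l.
  by rewrite tensU TU tens_mapU.
have Tr z : hmulT H (tens_map f (conv g h) z)
    = T (tens_assoc (tens_map idfun (hcomul H) z)).
  pose L : {linear _ -> V} := hmulT H \o tens_map f (conv g h).
  pose R : {linear _ -> V} := (T \o @tens_assoc K X X X) \o tens_map idfun (hcomul H).
  suff: L =1 R by apply.
  apply: malg_ext => -[a b].
  rewrite -[L _]/(hmulT H (tens_map f (conv g h) << (a, b) >>)).
  rewrite -[R _]/(T (tens_assoc (tens_map idfun (hcomul H) << (a, b) >>))).
  rewrite !tens_mapU -[LHS]/(mul (f << a >>) (conv g h << b >>)) convE.
  elim/malg_ind: (hcomul H _) => [c y y' IHy IHy'||[a1 a2]].
  - rewrite tensPr tens_assocP (linearP T) tens_mapP (linearP (hmulT H)) hmulPr.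
    exact: (congr2 (fun u v => c *: u + v) IHy IHy').
  - by rewrite tens0r tens_assoc0 tens_map0 !linear0 hmul0r.
  by rewrite tensU tens_assocU TU tens_mapU -(bi_mulA bi).
by rewrite [LHS]convE Tl [RHS]convE Tr (bi_comulA bi).
Qed.

Lemma conv_cunitr (f : {linear V -> V}) x : conv f cunit x = f x.
Proof.
pose L : {linear _ -> V} := hmulT H \o tens_map f cunit.
pose R : {linear _ -> V} :=
  f \o lext (fun p : X * X => (hcounit H << p.2 >> : K) *: (<< p.1 >> : V)).
have LR: L =1 R.
  apply: malg_ext => -[a b]; rewrite /L /R -[LHS]/(hmulT H (tens_map f cunit _)).
  rewrite tens_mapU cunitE -[LHS]/(mul _ _) hmulZr (bi_mulr1 bi).
  by rewrite /= lextU linearZ.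
by rewrite -[in RHS](bi_counitr bi x) convE; apply: LR.
Qed.

Lemma conv_cunitl (f : {linear V -> V}) x : conv cunit f x = f x.
Proof.
pose L : {linear _ -> V} := hmulT H \o tens_map cunit f.
pose R : {linear _ -> V} :=
  f \o lext (fun p : X * X => (hcounit H << p.1 >> : K) *: (<< p.2 >> : V)).
have LR: L =1 R.
  apply: malg_ext => -[a b]; rewrite /L /R -[LHS]/(hmulT H (tens_map cunit f _)).
  rewrite tens_mapU cunitE -[LHS]/(mul _ _) hmulZl.
  by rewrite (bi_mul1 bi) /= lextU linearZ.
by rewrite -[in RHS](bi_counitl bi x) convE; apply: LR.
Qed.

Variable deg : X -> nat.
Hypothesis deg_comul : forall a p,
  p \in msupp (hcomul H << a >>) -> (deg p.1 + deg p.2)%N = deg a.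
Hypothesis deg0 : forall a, deg a = 0%N -> << a >> = one.

Fixpoint proj_pow k : {linear V -> V} :=
  if k is k'.+1 then conv (proj_pow k') proj else cunit.

Lemma proj_powS k : proj_pow k.+1 = conv (proj_pow k) proj.
Proof. by []. Qed.

Lemma proj_powSl k x : proj_pow k.+1 x = conv proj (proj_pow k) x.
Proof.
elim: k x => [|k IHk] x; first by rewrite [LHS]conv_cunitl conv_cunitr.
rewrite -[LHS]/(conv (proj_pow k.+1) proj x).
rewrite -[RHS]/(conv proj (conv (proj_pow k) proj) x) -convA.
by apply: eq_conv => p _; rewrite IHk.
Qed.

Lemma proj_pow_vanish k a : (deg a < k)%N -> proj_pow k << a >> = 0.
Proof.
elim: k a => // k IHk a; rewrite ltnS => le_ak.
rewrite proj_powS convE.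
rewrite /tens_map /lext big_seq big1 ?linear0 // => p /deg_comul deg_p.
have [lt_pk|le_kp] := ltnP (deg p.1) k.
  by rewrite IHk // tens0l scaler0.
have /deg0->: deg p.2 = 0%N by lia.
by rewrite projE cunitE (bi_counit1 bi) scale1r subrr tens0r scaler0.
Qed.

(** The partial sums of the geometric series of [- proj]. *)
Fixpoint alt_sum N : {linear V -> V} :=
  if N is N'.+1 then
    lext (fun a : X => (-1) ^+ N *: proj_pow N << a >> + alt_sum N' << a >>)
  else cunit.

Lemma alt_sumS N x :
  alt_sum N.+1 x = (-1) ^+ N.+1 *: proj_pow N.+1 x + alt_sum N x.
Proof.
elim/malg_ind: x => [c x y IHx IHy||a]; last by rewrite {1}/alt_sum /= lextU.
  rewrite !(linearP (alt_sum _)) (linearP (proj_pow _)) IHx IHy.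
  by rewrite !scalerDr !scalerA (mulrC c) addrACA.
by rewrite !(linear0 (alt_sum _)) (linear0 (proj_pow _)) scaler0 addr0.
Qed.

Lemma alt_sum_stable N a : (deg a <= N)%N ->
  alt_sum N << a >> = alt_sum (deg a) << a >>.
Proof.
elim: N => [|N IHN]; first by rewrite leqn0 => /eqP->.
rewrite leq_eqVlt ltnS => /predU1P[<-//|le_aN].
by rewrite alt_sumS proj_pow_vanish ?ltnS // scaler0 add0r IHN.
Qed.

Lemma idE (x : V) : idfun x = 1 *: proj x + cunit x.
Proof. by rewrite scale1r projE subrK. Qed.

Lemma alt_sum_convr N x :
  conv (alt_sum N) idfun x = (-1) ^+ N *: proj_pow N.+1 x + cunit x.
Proof.
elim: N => [|N IHN].
  by rewrite (convPr (alt_sum 0) idE) !scale1r conv_cunitr.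
rewrite (convPl idfun (alt_sumS N)) IHN (convPr (proj_pow N.+1) idE).
rewrite conv_cunitr scale1r -[conv (proj_pow N.+1) proj x]/(proj_pow N.+2 x).
rewrite scalerDr -addrA; congr (_ + _).
by rewrite addrA -scalerDl exprS mulN1r addNr scale0r add0r.
Qed.

Lemma alt_sum_convl N x :
  conv idfun (alt_sum N) x = (-1) ^+ N *: proj_pow N.+1 x + cunit x.
Proof.
elim: N => [|N IHN].
  by rewrite (convPl (alt_sum 0) idE) conv_cunitl (proj_powSl 0) expr0 !scale1r.
rewrite (convPr idfun (alt_sumS N)) IHN (convPl (proj_pow N.+1) idE).
rewrite conv_cunitl scale1r -proj_powSl scalerDr -addrA; congr (_ + _).
by rewrite addrA -scalerDl exprS mulN1r addNr scale0r add0r.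
Qed.

(** The antipode: each basis element only sees finitely many terms of the
    series. *)
Definition takeuchi : {linear V -> V} :=
  lext (fun a : X => alt_sum (deg a) << a >>).

Lemma takeuchiE N a : (deg a <= N)%N -> takeuchi << a >> = alt_sum N << a >>.
Proof. by move=> le_aN; rewrite /takeuchi /= lextU alt_sum_stable. Qed.

Lemma takeuchil x : hmulT H (tens_map takeuchi idfun (hcomul H x)) = hcounit H x *: one.
Proof.
rewrite -cunitE -convE; move: x; apply: malg_ext => a.
rewrite (@eq_conv takeuchi (alt_sum (deg a)) idfun idfun) => [|p /deg_comul deg_p].
  by rewrite alt_sum_convr proj_pow_vanish ?scaler0 ?add0r.
by rewrite -takeuchiE // -deg_p leq_addr.
Qed.

Lemma takeuchir x : hmulT H (tens_map idfun takeuchi (hcomul H x)) = hcounit H x *: one.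
Proof.
rewrite -cunitE -convE; move: x; apply: malg_ext => a.
rewrite (@eq_conv idfun idfun takeuchi (alt_sum (deg a))) => [|p /deg_comul deg_p].
  by rewrite alt_sum_convl proj_pow_vanish ?scaler0 ?add0r.
by rewrite -takeuchiE // -deg_p leq_addl.
Qed.

(** One antipode of the ambient bialgebra serves all its graded subspaces:
    by the recursion on the degree it preserves each of them. *)
Lemma gch_takeuchi A : graded_subbialgebra A -> graded_connected_hopf H A.
Proof.
move=> gA; apply: gch_of_sub => //; exists takeuchi; split=> [|x _|x _].
- by apply: (left_antipode_graded gA) => n x _; apply: takeuchil.
- exact: takeuchil.
- exact: takeuchir.
Qed.

End GenericHopf.

Lemma is_antipode_left (K : fieldType) (X : choiceType) (H : hopf_data K X)
    (A : nat -> {malg K[X]} -> Prop) S :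
  graded_subbialgebra H A -> is_antipode H A S -> left_antipode H A S.
Proof. by move=> gA antiS n x /(part_direct_sum gA)/(antipode_l antiS). Qed.

(** Both sides satisfy the recursion of [left_antipodeS], transported by the
    morphism. *)
Lemma antipode_natural (K : fieldType) (X X' : choiceType)
    (H : hopf_data K X) (H' : hopf_data K X')
    (A : nat -> {malg K[X]} -> Prop) (A' : nat -> {malg K[X']} -> Prop)
    (phi : {linear {malg K[X]} -> {malg K[X']}})
    (S : {linear {malg K[X]} -> {malg K[X]}})
    (S' : {linear {malg K[X']} -> {malg K[X']}}) :
    bialgebra H -> bialgebra H' ->
    graded_subbialgebra H A -> graded_subbialgebra H' A' ->
    (forall n x, A n x -> A' n (phi x)) ->
    phi (hone H) = hone H' ->
    (forall x y, phi (hmul H x y) = hmul H' (phi x) (phi y)) ->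
    (forall x, tens_map phi phi (hcomul H x) = hcomul H' (phi x)) ->
    left_antipode H A S -> left_antipode H' A' S' ->
  forall n x, A n x -> phi (S x) = S' (phi x).
Proof.
move=> bi bi' gA gA' phiA phi1 phiM phiD antiS antiS'.
elim/ltn_ind => -[_ x /(gs_connected gA)[c ->]|n IHn x Ax].
  rewrite !linearZ (left_antipode1 bi gA antiS) /=; congr (_ *: _).
  by rewrite phi1 (left_antipode1 bi' gA' antiS').
have [t [tA Dx]] := comul_top bi gA Ax.
rewrite (left_antipodeS bi gA antiS Ax Dx).
rewrite (@left_antipodeS _ _ _ bi' _ gA' _ _ _ (fun i => tens_map phi phi (t i))
          antiS' (phiA _ _ Ax)); last first.
  rewrite -phiD Dx linearD (linear_sum (tens_map phi phi)) /= tens_mapE.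
  by rewrite phi1.
rewrite raddfN raddf_sum; congr (- _); apply: eq_bigr => i _ /=.
have := tA i; rewrite -ltnS => /(_ (ltn_ord i)).
move: (t i); apply: lspan_ind => [|c u v eu ev|_ [u [v [Au _ ->]]]].
- by rewrite !raddf0.
- by rewrite !tens_mapP !linearP eu ev.
by rewrite !tens_mapE /= [LHS]phiM (IHn i).
Qed.

(** * Deconcatenation and shuffles of words *)

Section Words.
Variable T : eqType.
Implicit Types (a b : T) (u v w t : seq T).

Fixpoint splits w : seq (seq T * seq T) :=
  ([::], w) ::
  if w is a :: w' then [seq (a :: p.1, p.2) | p <- splits w'] else [::].

Fixpoint shuffle u : seq T -> seq (seq T) :=
  fix shuffle_u v :=
    match u, v with
    | [::], _ => [:: v]
    | _, [::] => [:: u]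
    | a :: u', b :: v' =>
        [seq a :: w | w <- shuffle u' v] ++ [seq b :: w | w <- shuffle_u v']
    end.

Lemma shuffle0s v : shuffle [::] v = [:: v]. Proof. by case: v. Qed.
Lemma shuffles0 u : shuffle u [::] = [:: u]. Proof. by case: u. Qed.

Lemma shuffle_cons a u b v : shuffle (a :: u) (b :: v) =
  [seq a :: w | w <- shuffle u (b :: v)] ++ [seq b :: w | w <- shuffle (a :: u) v].
Proof. by []. Qed.

Lemma splits_iota w :
  splits w = [seq (take i w, drop i w) | i <- iota 0 (size w).+1].
Proof.
elim: w => // a w IHw; rewrite [LHS]/= IHw -map_comp.
rewrite -[iota 0 (size (a :: w)).+1]/(0%N :: iota (1 + 0) (size w).+1) iotaDl.
by rewrite map_cons -map_comp.
Qed.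

Section Sums.
Variable M : nmodType.

Lemma sum_splits_cons (F : seq T * seq T -> M) a w :
  \sum_(p <- splits (a :: w)) F p
  = F ([::], a :: w) + \sum_(p <- splits w) F (a :: p.1, p.2).
Proof. by rewrite big_cons big_map. Qed.

Lemma sum_splits0 (F : seq T * seq T -> M) :
  \sum_(p <- splits [::]) F p = F ([::], [::]).
Proof. by rewrite big_seq1. Qed.

Lemma sum_shuffle_cons (F : seq T -> M) a u b v :
  \sum_(w <- shuffle (a :: u) (b :: v)) F w
  = \sum_(w <- shuffle u (b :: v)) F (a :: w)
    + \sum_(w <- shuffle (a :: u) v) F (b :: w).
Proof. by rewrite shuffle_cons big_cat !big_map. Qed.

Lemma sum_shuffle0s (F : seq T -> M) v : \sum_(w <- shuffle [::] v) F w = F v.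
Proof. by rewrite shuffle0s big_seq1. Qed.

Lemma sum_shuffles0 (F : seq T -> M) u : \sum_(w <- shuffle u [::]) F w = F u.
Proof. by rewrite shuffles0 big_seq1. Qed.

Lemma sum_splitsA (F : seq T -> seq T -> seq T -> M) w :
  \sum_(p <- splits w) \sum_(q <- splits p.1) F q.1 q.2 p.2
  = \sum_(p <- splits w) \sum_(q <- splits p.2) F p.1 q.1 q.2.
Proof.
elim: w F => [|a w IHw] F; first by rewrite !big_seq1.
rewrite !sum_splits_cons sum_splits0 /= -addrA; congr (_ + _).
rewrite -(IHw (fun x => F (a :: x))) -big_split /=.
by apply: eq_bigr => p _; rewrite sum_splits_cons.
Qed.

Lemma sum_shuffleA (F : seq T -> M) u v w :
  \sum_(t <- shuffle u v) \sum_(s <- shuffle t w) F s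
  = \sum_(t <- shuffle v w) \sum_(s <- shuffle u t) F s.
Proof.
elim: u v w F => [|a u IHu] v w F.
  by rewrite sum_shuffle0s; apply: eq_bigr => t _; rewrite sum_shuffle0s.
elim: v w F => [|b v IHv] w F; first by rewrite sum_shuffles0 sum_shuffle0s.
elim: w F => [|c w IHw] F.
  by rewrite sum_shuffles0; apply: eq_bigr => t _; rewrite sum_shuffles0.
rewrite !sum_shuffle_cons.
under eq_bigr => t _ do rewrite sum_shuffle_cons.
rewrite big_split /= IHu.
under [X in _ + X = _]eq_bigr => t _ do rewrite sum_shuffle_cons.
rewrite big_split /= IHv.
under [X in _ = X + _]eq_bigr => t _ do rewrite sum_shuffle_cons.
under [X in _ = _ + X]eq_bigr => t _ do rewrite sum_shuffle_cons.
rewrite !big_split /= sum_shuffle_cons.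
have := IHw (fun s => F (c :: s)); rewrite sum_shuffle_cons => IH.
by rewrite addrACA IH -!addrA; congr (_ + _); rewrite addrCA addrA.
Qed.

(** Cutting a shuffle of [u] and [v] cuts [u] and [v] independently: this is
    the compatibility of deconcatenation with shuffles, from which the
    compatibility of products with coproducts follows. *)
Lemma sum_splits_shuffle (F : seq T -> seq T -> M) u v :
  \sum_(w <- shuffle u v) \sum_(p <- splits w) F p.1 p.2
  = \sum_(p <- splits u) \sum_(q <- splits v)
      \sum_(w1 <- shuffle p.1 q.1) \sum_(w2 <- shuffle p.2 q.2) F w1 w2.
Proof.
elim: u v F => [|a u IHu] v F.
  rewrite sum_shuffle0s sum_splits0; apply: eq_bigr => p _ /=.
  by rewrite !sum_shuffle0s.
elim: v F => [|b v IHv] F.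
  rewrite sum_shuffles0; apply: eq_bigr => p _.
  by rewrite sum_splits0 !sum_shuffles0.
rewrite sum_shuffle_cons.
under eq_bigr => w _ do rewrite sum_splits_cons.
under [X in _ + X = _]eq_bigr => w _ do rewrite sum_splits_cons.
rewrite !big_split /= (IHu _ (fun x => F (a :: x))) (IHv (fun x => F (b :: x))).
pose S p q := \sum_(w1 <- shuffle p.1 q.1) \sum_(w2 <- shuffle p.2 q.2) F w1 w2.
pose Sa p q :=
  \sum_(w1 <- shuffle p.1 q.1) \sum_(w2 <- shuffle p.2 q.2) F (a :: w1) w2.
pose Sb p q :=
  \sum_(w1 <- shuffle p.1 q.1) \sum_(w2 <- shuffle p.2 q.2) F (b :: w1) w2.
transitivity
  (\sum_(w <- shuffle u (b :: v)) F [::] (a :: w)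
   + (\sum_(p <- splits u) Sa p ([::], b :: v)
      + \sum_(p <- splits u) \sum_(q <- splits v) Sa p (b :: q.1, q.2))
   + (\sum_(w <- shuffle (a :: u) v) F [::] (b :: w)
      + (\sum_(q <- splits v) Sb ([::], a :: u) q
         + \sum_(p <- splits u) \sum_(q <- splits v) Sb (a :: p.1, p.2) q))).
  congr (_ + _ + (_ + _)); last by rewrite sum_splits_cons.
  by rewrite -big_split; apply: eq_bigr => p _; rewrite sum_splits_cons.
transitivity
  (S ([::], a :: u) ([::], b :: v)
   + \sum_(q <- splits v) S ([::], a :: u) (b :: q.1, q.2)
   + (\sum_(p <- splits u) S (a :: p.1, p.2) ([::], b :: v)
      + \sum_(p <- splits u) \sum_(q <- splits v)
          S (a :: p.1, p.2) (b :: q.1, q.2))).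
  have ->: S ([::], a :: u) ([::], b :: v)
      = \sum_(w <- shuffle u (b :: v)) F [::] (a :: w)
        + \sum_(w <- shuffle (a :: u) v) F [::] (b :: w).
    by rewrite /S sum_shuffle0s sum_shuffle_cons.
  have ->: \sum_(q <- splits v) S ([::], a :: u) (b :: q.1, q.2)
      = \sum_(q <- splits v) Sb ([::], a :: u) q.
    by apply: eq_bigr => q _; rewrite /S /Sb !sum_shuffle0s.
  have ->: \sum_(p <- splits u) S (a :: p.1, p.2) ([::], b :: v)
      = \sum_(p <- splits u) Sa p ([::], b :: v).
    by apply: eq_bigr => p _; rewrite /S /Sa !sum_shuffles0.
  have ->: \sum_(p <- splits u) \sum_(q <- splits v)
             S (a :: p.1, p.2) (b :: q.1, q.2)
      = \sum_(p <- splits u) \sum_(q <- splits v) Sa p (b :: q.1, q.2)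
        + \sum_(p <- splits u) \sum_(q <- splits v) Sb (a :: p.1, p.2) q.
    rewrite -big_split; apply: eq_bigr => p _ /=; rewrite -big_split.
    by apply: eq_bigr => q _; rewrite /S sum_shuffle_cons.
  set A := \sum_(w <- shuffle u _) _; set A' := \sum_(w <- shuffle (_ :: _) _) _.
  set B := \sum_(p <- splits u) Sa _ _; set D := \sum_(q <- splits v) Sb _ _.
  by rewrite addrACA -[RHS]addrA; congr (_ + _); rewrite addrCA -addrA.
by rewrite [RHS]sum_splits_cons sum_splits_cons -big_split; congr (_ + _);
   apply: eq_bigr => p _; rewrite sum_splits_cons.
Qed.

End Sums.

Lemma shuffle_perm u v w : w \in shuffle u v -> perm_eq w (u ++ v).
Proof.
elim: u v w => [|a u IHu] v w; first by rewrite shuffle0s inE => /eqP->.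
elim: v w => [|b v IHv] w; first by rewrite shuffles0 inE cats0 => /eqP->.
rewrite shuffle_cons mem_cat => /orP[] /mapP[t t_sh ->].
  by rewrite /= perm_cons IHu.
rewrite -[b :: v]cat1s perm_sym perm_catCA /= perm_cons perm_sym.
exact: IHv t_sh.
Qed.

Lemma shuffle_size u v w : w \in shuffle u v -> size w = (size u + size v)%N.
Proof. by move=> /shuffle_perm/perm_size ->; rewrite size_cat. Qed.

Lemma splits_cat w p : p \in splits w -> w = p.1 ++ p.2.
Proof. by rewrite splits_iota => /mapP[i _ ->]; rewrite cat_take_drop. Qed.

Section Separated.
Variable P : pred T.

(** When [P] tells the letters of the two words apart, a shuffle determines
    both words as its subwords. *)
Lemma mem_shuffle u v w : all P u -> all (predC P) v ->
  (w \in shuffle u v) = (filter P w == u) && (filter (predC P) w == v).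
Proof.
have filterP0 s : (filter P s == [::]) = all (predC P) s.
  by rewrite all_predC has_filter negbK.
have filterC0 s : (filter (predC P) s == [::]) = all P s.
  by rewrite -[all P s]negbK -has_predC has_filter negbK.
elim: w u v => [|c w IHw] u v.
  case: u v => [|a u] [|b v] // _ _; apply/negP.
  by rewrite shuffle_cons mem_cat => /orP[] /mapP[].
case: u => [|a u].
  rewrite shuffle0s inE => _ nPv; apply/eqP/andP => [->|[]].
    by rewrite filterP0 nPv; split=> //; apply/eqP/all_filterP.
  by rewrite filterP0 => /all_filterP-> /eqP.
case: v => [|b v].
  rewrite shuffles0 inE => Pu _; apply/eqP/andP => [->|[]].
    by rewrite filterC0 Pu; split=> //; apply/eqP/all_filterP.
  by move/eqP=> <-; rewrite filterC0 => /all_filterP.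
move=> /[dup] Pau /andP[Pa Pu] /[dup] nPbv /andP[nPb nPv].
rewrite shuffle_cons mem_cat.
have mem_cons x l : (c :: w \in [seq x :: t | t <- l]) = (c == x) && (w \in l).
  apply/mapP/andP => [[t lt [-> ->]]|[/eqP-> wl]]; first by rewrite eqxx.
  by exists w.
rewrite !mem_cons !IHw //=; have [Pc|nPc] := boolP (P c).
  rewrite eqseq_cons -andbA; case: (c =P b) => [cb|_]; last by rewrite orbF.
  by rewrite cb (negPf nPb) in Pc.
rewrite eqseq_cons; case: (c =P a) => [ca|_]; first by rewrite ca Pa in nPc.
by rewrite /= andbCA.
Qed.

Lemma shuffle_uniq u v : all P u -> all (predC P) v -> uniq (shuffle u v).
Proof.
elim: u v => [|a u IHu] v; first by rewrite shuffle0s.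
elim: v => [|b v IHv]; first by rewrite shuffles0.
move=> /[dup] Pau /andP[Pa Pu] /[dup] nPbv /andP[nPb nPv].
rewrite shuffle_cons cat_uniq !map_inj_uniq => [|? ? []|? ? []] //.
rewrite IHu // IHv // andbT; apply/hasPn => _ /mapP[t _ ->].
by apply/negP => /mapP[s _ [ba _]]; move: nPb; rewrite /= ba Pa.
Qed.

End Separated.

End Words.

Lemma map_shuffle (T T' : eqType) (f : T -> T') u v :
  shuffle (map f u) (map f v) = map (map f) (shuffle u v).
Proof.
elim: u v => [|a u IHu] v; first by rewrite !shuffle0s.
elim: v => [|b v IHv]; first by rewrite !shuffles0.
rewrite !map_cons !shuffle_cons map_cat -!map_comp -map_cons IHu -map_comp.
by rewrite -map_cons IHv -map_comp.
Qed.

Local Open Scope nat_scope.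

(** * Standardisation and trees of words *)

Lemma count_lt (T : eqType) (p q : pred T) (x : T) (s : seq T) :
  x \in s -> q x -> ~~ p x -> subpred p q -> count p s < count q s.
Proof.
move=> + qx /negPf px pq; elim: s => //= y s IHs; rewrite inE.
case/predU1P=> [<-|/IHs lt_s]; first by rewrite qx px ltnS; apply: sub_count.
by have := pq y; case: (p y) => [->|_] //; lia.
Qed.

Section Letters.
Implicit Types (u v w : seq nat) (i j k l : nat).

(** The strict total order on the positions of a word that compares letters
    and breaks ties from left to right, as standardisation does. *)
Definition klt v i j : bool :=
  (nth 0 v i < nth 0 v j) || ((nth 0 v i == nth 0 v j) && (i < j)).

Definition same_order v v' : Prop :=
  size v = size v' /\
  forall i j, i < size v -> j < size v -> klt v i j = klt v' i j.

Lemma klt_irr v i : klt v i i = false.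
Proof. by rewrite /klt; lia. Qed.

Lemma klt_trans v i j k : klt v i j -> klt v j k -> klt v i k.
Proof. by rewrite /klt; lia. Qed.

Lemma klt_total v i j : i != j -> klt v i j = ~~ klt v j i.
Proof. by rewrite /klt; lia. Qed.

Lemma same_order_sym v v' : same_order v v' -> same_order v' v.
Proof. by case=> sz ord; split=> // i j; rewrite -sz => hi hj; rewrite ord. Qed.

Lemma klt_catl u v i j :
  i < size u -> j < size u -> klt (u ++ v) i j = klt u i j.
Proof. by rewrite /klt !nth_cat => -> ->. Qed.

Lemma klt_catr u v i j : klt (u ++ v) (size u + i) (size u + j) = klt v i j.
Proof.
by rewrite /klt !nth_cat !ifF ?addKn ?ltn_add2l //; apply/negP; lia.
Qed.

Lemma same_order_catl u v u' v' : size u = size u' ->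
  same_order (u ++ v) (u' ++ v') -> same_order u u'.
Proof.
move=> szu [_ ord]; split=> // i j ui uj.
by rewrite -(klt_catl v) // ord ?klt_catl -?szu // size_cat; lia.
Qed.

Lemma same_order_catr u v u' v' : size u = size u' ->
  same_order (u ++ v) (u' ++ v') -> same_order v v'.
Proof.
rewrite /same_order !size_cat => szu [sz ord]; split=> [|i j vi vj]; first by lia.
by rewrite -(klt_catr u) ord ?ltn_add2l // szu klt_catr.
Qed.

Lemma same_order_take k v v' : same_order v v' -> same_order (take k v) (take k v').
Proof.
move=> so; apply: (@same_order_catl _ (drop k v) _ (drop k v')); last by rewrite !cat_take_drop.
by rewrite !size_take so.1.
Qed.

Lemma same_order_drop k v v' : same_order v v' -> same_order (drop k v) (drop k v').
Proof.
move=> so; apply: (@same_order_catr (take k v) _ (take k v')); last by rewrite !cat_take_drop.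
by rewrite !size_take so.1.
Qed.

Lemma same_order_map f v : {mono f : x y / x < y} -> same_order (map f v) v.
Proof.
move=> fM; split=> [|i j]; rewrite size_map // /klt => vi vj.
rewrite !(nth_map 0) // fM; congr (_ || (_ && _)).
by apply/eqP/eqP => [|-> //]; have := fM (nth 0 v i) (nth 0 v j);
   have := fM (nth 0 v j) (nth 0 v i); lia.
Qed.

Lemma size_std v : size (std v) = size v.
Proof. by rewrite size_map size_iota. Qed.

Lemma count_nth (P : pred nat) v :
  count P v = count (fun i => P (nth 0 v i)) (iota 0 (size v)).
Proof. by rewrite -{1}(mkseq_nth 0 v) count_map. Qed.

Lemma nth_std v i : i < size v ->
  nth 0 (std v) i = (count (fun j => klt v j i) (iota 0 (size v))).+1.
Proof.
move=> vi; rewrite (nth_map 0) ?size_iota // nth_iota // add0n; congr _.+1.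
set n := size v; set x := nth 0 v i.
have -> : count_mem x (take i v)
    = count (fun j => (nth 0 v j == x) && (j < i)) (iota 0 n).
  rewrite [LHS]count_nth size_take vi -(subnKC (ltnW vi : i <= n)) iotaD count_cat.
  rewrite (@eq_in_count _ _ pred0 (iota (0 + i) _)) => [|j].
    rewrite count_pred0 addn0; apply: eq_in_count => j.
    by rewrite mem_iota => /andP[_ ji]; rewrite /= nth_take ?ji ?andbT.
  by rewrite mem_iota add0n => /andP[ij _]; rewrite ltnNge ij andbF.
rewrite (count_nth (fun b => b < x)) -/n.
rewrite -(count_predUI (fun j => nth 0 v j < x)).
rewrite (@eq_count _ (predI _ _) pred0) ?count_pred0 ?addn0 // => j /=.
by case: ltngtP.
Qed.

Lemma ltn_std v i j : i < size v -> j < size v ->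
  (nth 0 (std v) i < nth 0 (std v) j) = klt v i j.
Proof.
move=> vi vj; wlog suff mono : i j vi vj /
    klt v i j -> nth 0 (std v) i < nth 0 (std v) j.
  apply/idP/idP; last exact: mono.
  apply: contraLR => nij; rewrite -leqNgt.
  have [->//|neq_ij] := eqVneq i j; apply/ltnW/mono => //.
  by rewrite klt_total // eq_sym.
move=> ij; rewrite !nth_std // ltnS; apply: (@count_lt _ _ _ i) => //.
- by rewrite mem_iota.
- by rewrite klt_irr.
by move=> k ki; apply: klt_trans ki ij.
Qed.

Lemma nth_std_gt0 v i : i < size v -> 0 < nth 0 (std v) i.
Proof. by move=> vi; rewrite nth_std. Qed.

Lemma nth_std_le v i : i < size v -> nth 0 (std v) i <= size v.
Proof.
move=> vi; rewrite nth_std //.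
apply: (@leq_trans (count predT (iota 0 (size v)))).
  by apply: (@count_lt _ _ _ i); rewrite ?mem_iota ?klt_irr.
by rewrite count_predT size_iota.
Qed.

Lemma std_uniq v : uniq (std v).
Proof.
apply/(uniqP 0) => i j; rewrite !inE size_std => vi vj.
have := ltn_std vi vj; have := ltn_std vj vi => ji ij eq_ij.
move: ij ji; rewrite eq_ij ltnn => /esym ij /esym ji.
by apply/eqP; apply: contraFT ij => neq_ij; rewrite klt_total // ji.
Qed.

Lemma klt_std v i j : i < size v -> j < size v -> klt (std v) i j = klt v i j.
Proof.
move=> vi vj; rewrite {1}/klt ltn_std //.
have [->|neq_ij] := eqVneq i j; first by rewrite ltnn andbF orbF.
by rewrite nth_uniq ?size_std ?std_uniq // (negPf neq_ij) orbF.
Qed.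

Lemma same_order_std v : same_order (std v) v.
Proof. by split=> [|i j]; rewrite size_std // => vi vj; rewrite klt_std. Qed.

Lemma eq_std v v' : same_order v v' -> std v = std v'.
Proof.
case=> sz ord; apply: (@eq_from_nth _ 0) => [|i]; rewrite !size_std // => vi.
rewrite !nth_std -?sz //; congr _.+1; apply: eq_in_count => j.
by rewrite mem_iota add0n => /andP[_ vj]; rewrite ord.
Qed.

(** The factorisation [u a v] of a word at the leftmost occurrence of its
    smallest letter, which is the one that standardisation sends to 1. *)
Definition min_split u a v : bool := all (ltn a) u && all (leq a) v.

Lemma min_splitP w : w != [::] -> exists u a v, w = u ++ a :: v /\ min_split u a v.
Proof.
elim: w => // x [|y w] IHw _; first by exists [::], x, [::].
have [//|u [a [v [-> /andP[au av]]]]] := IHw.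
have [le_xa|lt_ax] := leqP x a.
  exists [::], x, (u ++ a :: v); split=> //; rewrite /min_split /= all_cat /= le_xa.
  by apply/andP; split; [apply: sub_all au|apply: sub_all av] => z /=; lia.
by exists (x :: u), a, v; rewrite /min_split /= lt_ax au av.
Qed.

Section MinSplit.
Variables (u : seq nat) (a : nat) (v : seq nat).
Hypothesis sp : min_split u a v.
Let w := u ++ a :: v.

Lemma klt_root i : i < size w -> klt w i (size u) = false.
Proof.
have /andP[au av] := sp; rewrite /w size_cat /= /klt !nth_cat ltnn subnn /=.
move=> wi; case: (ltnP i (size u)) => ui.
  by have /(_ i ui) := all_nthP 0 au; rewrite /=; lia.
have [->|ne] := eqVneq i (size u); first by rewrite subnn /=; lia.
have vi: i - (size u).+1 < size v by lia.
have -> : i - size u = (i - (size u).+1).+1 by lia.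
by have /(_ _ vi) := all_nthP 0 av; rewrite /=; lia.
Qed.

Lemma index_root : index 1 (std w) = size u.
Proof.
have wu: size u < size w by rewrite size_cat /=; lia.
have <-: nth 0 (std w) (size u) = 1.
  rewrite nth_std // (@eq_in_count _ _ pred0) ?count_pred0 // => i.
  by rewrite mem_iota => /andP[_]; apply: klt_root.
by rewrite index_uniq ?std_uniq ?size_std.
Qed.

End MinSplit.

(** Only the order of the letters matters, so the repeated standardisations
    in the definition of the tree may be skipped. *)
Lemma word_tree_recE k k' w w' : size w <= k -> size w' <= k' ->
  same_order w w' -> word_tree_rec k w = word_tree_rec k' w'.
Proof.
elim: k k' w w' => [|k IHk] [|k'] [|x w] [|x' w'] // le_wk le_wk' so;
  try by case: so.
rewrite /word_tree_rec -/word_tree_rec (eq_std so).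
have [//|u [a [v [Ew sp]]]] := @min_splitP (x' :: w').
have szs: size (std (x' :: w')) = size (x' :: w') by rewrite size_std.
have szw := so.1; move: szs szw le_wk le_wk'.
rewrite Ew (index_root sp) size_cat /= => szs szw le_wk le_wk'.
congr Graft; apply: IHk; rewrite ?size_take ?size_drop ?szs //; try lia;
  try by case: ifP; lia.
Qed.

Lemma eq_word_tree w w' : same_order w w' -> word_tree w = word_tree w'.
Proof. exact: word_tree_recE. Qed.

Lemma word_tree_split u a v : min_split u a v ->
  word_tree (u ++ a :: v) = Graft (word_tree u) (word_tree v).
Proof.
move=> sp; set w := u ++ a :: v.
have so := same_order_std w; have szw: size w = (size u + size v).+1.
  by rewrite size_cat addnS.
rewrite {1}/word_tree szw /word_tree_rec -/word_tree_rec.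
have -> : w = head 0 w :: behead w by rewrite /w; case: (u).
rewrite -[_ :: _]/(head 0 w :: behead w).
have <- : w = head 0 w :: behead w by rewrite /w; case: (u).
rewrite index_root //; congr Graft; apply: word_tree_recE => //.
- by rewrite size_take size_std szw; case: ifP; lia.
- by have := same_order_take (size u) so; rewrite take_size_cat.
- by rewrite size_drop size_std szw; lia.
have := same_order_drop (size u).+1 so.
by rewrite {2}/w -cat_rcons drop_size_cat ?size_rcons.
Qed.

Lemma internal_word_tree w : internal (word_tree w) = size w.
Proof.
elim: {w}(size w).+1 {-2}w (ltnSn (size w)) => // n IHn w; rewrite ltnS => le_wn.
have [->//|/min_splitP[u [a [v [Ew sp]]]]] := eqVneq w [::].
move: le_wn; rewrite Ew word_tree_split // size_cat /= => le_wn.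
by rewrite !IHn ?addnS //; lia.
Qed.

(** Position [k] dominates position [l] when it carries the smallest letter
    between them, that is, when it is [l] or an ancestor of [l] in the tree of
    the word. Unlike the tree, this relation visibly restricts to factors. *)
Definition dominates v k l : Prop :=
  forall x, minn k l <= x <= maxn k l -> ~~ klt v x k.

Lemma dominates_catl u v k l : k < size u -> l < size u ->
  dominates (u ++ v) k l <-> dominates u k l.
Proof.
move=> uk ul; split=> dom x xkl; have := dom x xkl.
  by rewrite klt_catl //; lia.
by rewrite klt_catl //; lia.
Qed.

Lemma dominates_catr u v k l :
  dominates (u ++ v) (size u + k) (size u + l) <-> dominates v k l.
Proof.
split=> dom x xkl.
  by rewrite -(klt_catr u); apply: dom; lia.
have ->: x = size u + (x - size u) by lia.
by rewrite klt_catr; apply: dom; lia.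
Qed.

Section MinSplitDominates.
Variables (u : seq nat) (a : nat) (v : seq nat).
Hypothesis sp : min_split u a v.
Let w := u ++ a :: v.

Lemma dominates_root l : l < size w -> dominates w (size u) l.
Proof.
move=> wl x xl; rewrite klt_root //.
by move: wl xl; rewrite size_cat /=; lia.
Qed.

Lemma not_dominates_root k l : k < size w -> k != size u ->
  minn k l <= size u <= maxn k l -> ~ dominates w k l.
Proof.
move=> wk ku ukl dom; have := dom _ ukl.
by rewrite klt_total 1?eq_sym // klt_root.
Qed.

Lemma dominates_splitr k l :
  dominates w ((size u).+1 + k) ((size u).+1 + l) <-> dominates v k l.
Proof. by rewrite -(size_rcons u a) /w -cat_rcons; apply: dominates_catr. Qed.

End MinSplitDominates.

(** The root of the tree is the position that dominates all others, and no
    other position dominates across it: the domination relation splits along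
    the factorisation at the smallest letter, exactly as the tree does. *)
Lemma eq_word_treeP w w' :
  word_tree w = word_tree w' <->
  size w = size w' /\
  forall k l, k < size w -> l < size w -> dominates w k l <-> dominates w' k l.
Proof.
elim: {w}(size w).+1 {-2}w (ltnSn (size w)) w' => // n IHn w + w'.
rewrite ltnS => le_wn.
have [->|/min_splitP[u [a [v [Ew sp]]]]] := eqVneq w [::].
  split=> [eq_t|[sz _]]; last by rewrite (@size0nil _ w').
  by have := internal_word_tree w'; rewrite -eq_t /= => <-.
have [->|/min_splitP[u' [a' [v' [Ew' sp']]]]] := eqVneq w' [::].
  split=> [eq_t|[sz _]]; last by rewrite (@size0nil _ w).
  by have := internal_word_tree w; rewrite eq_t Ew size_cat /=; lia.
rewrite Ew Ew' !word_tree_split //.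
move: le_wn; rewrite Ew size_cat /= => le_wn.
have /IHn/(_ u') IHu: size u < n by lia.
have /IHn/(_ v') IHv: size v < n by lia.
split=> [[/IHu[szu domu] /IHv[szv domv]]|[sz dom]].
  split=> [|k l]; first by rewrite !size_cat /= szu szv.
  move=> wk wl.
  have [->|ku] := eqVneq k (size u).
    split=> _; last by apply: dominates_root; rewrite // size_cat /=; lia.
    by rewrite szu; apply: dominates_root; rewrite // size_cat /=; lia.
  case: (boolP (minn k l <= size u <= maxn k l)) => [ukl|nukl].
    split=> [/(not_dominates_root sp)|/(not_dominates_root sp')] [];
      by rewrite -?szu // size_cat /=; lia.
  case: (ltnP k (size u)) => uk.
    have ul: l < size u by lia.
    rewrite dominates_catl // domu // dominates_catl -?szu //.
  pose k' := k - (size u).+1; pose l' := l - (size u).+1.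
  have ->: k = (size u).+1 + k' by lia.
  have ->: l = (size u).+1 + l' by lia.
  rewrite dominates_splitr // szu dominates_splitr //.
  by apply: domv; lia.
have szw': size (u' ++ a' :: v') = (size u' + size v').+1.
  by rewrite size_cat /= addnS.
move: sz; rewrite szw' => sz.
have szu: size u = size u'.
  apply/eqP; apply: contraT => ne_u.
  have [] := @not_dominates_root _ _ _ sp' (size u) (size u').
  - by rewrite szw'; lia.
  - by [].
  - by lia.
  by rewrite -dom; [apply: dominates_root; rewrite // size_cat /=| |]; lia.
have szv: size v = size v' by lia.
congr Graft.
  apply/IHu; split=> // k l uk ul.
  rewrite -(dominates_catl (a :: v)) // dom; try lia.
  by rewrite dominates_catl -?szu.
apply/IHv; split=> // k l vk vl; rewrite -(dominates_splitr u a) dom; try lia.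
by rewrite szu dominates_splitr.
Qed.

End Letters.

Local Open Scope nat_scope.

(** * Coloured words and sequences of coloured trees *)

Section ColouredWords.
Variable G : finGroupType.
Implicit Types (w r : seq (nat * G)) (u v : seq nat) (c d : G) (s t : seq G).

Definition monochrome s k l : Prop :=
  forall x, minn k l <= x <= maxn k l -> nth 1%g s x = nth 1%g s k.

Lemma monochrome_catl s t k l : k < size s -> l < size s ->
  monochrome (s ++ t) k l <-> monochrome s k l.
Proof.
move=> sk sl; split=> mono x xkl; have xs: x < size s by lia.
  by have := mono x xkl; rewrite !nth_cat sk xs.
by have := mono x xkl; rewrite !nth_cat sk xs.
Qed.

Lemma monochrome_catr s t k l :
  monochrome (s ++ t) (size s + k) (size s + l) <-> monochrome t k l.
Proof.
split=> mono x xkl.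
  have := mono (size s + x); rewrite !nth_cat !ltnNge !leq_addr /= !addKn.
  by apply; lia.
have ->: x = size s + (x - size s) by lia.
rewrite !nth_cat !ltnNge !leq_addr /= !addKn; apply: mono; lia.
Qed.

Lemma monochrome_nseq m c k l : k < m -> l < m -> monochrome (nseq m c) k l.
Proof. by move=> mk ml x xkl; rewrite !nth_nseq mk ifT //; lia. Qed.

Lemma not_monochrome_head m c s k l : ohead s != Some c ->
    minn k l < m -> m <= maxn k l -> maxn k l < m + size s ->
  ~ monochrome (nseq m c ++ s) k l.
Proof.
move=> sc lt_m le_m lt_s mono.
have /esym: nth 1%g (nseq m c ++ s) m = nth 1%g (nseq m c ++ s) (minn k l).
  by rewrite mono ?[RHS]mono //; lia.
rewrite !nth_cat !size_nseq ltnn subnn lt_m nth_nseq lt_m => Ec.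
by case: s sc lt_s mono Ec => [|d s] /=; [lia|move=> /eqP dc _ _ cd; rewrite cd in dc].
Qed.

(** Two words are equivalent when they have the same colours and the same
    domination relation inside their monochromatic factors. This is the
    equivalence that the sequence of coloured trees classifies. *)
Definition tree_equiv w w' : Prop :=
  unzip2 w = unzip2 w' /\
  forall k l, k < size w -> l < size w -> monochrome (unzip2 w) k l ->
    dominates (unzip1 w) k l <-> dominates (unzip1 w') k l.

Lemma tree_equiv_size w w' : tree_equiv w w' -> size w = size w'.
Proof. by case=> /(congr1 size); rewrite !size_map. Qed.

Lemma tree_equiv_sym w w' : tree_equiv w w' -> tree_equiv w' w.
Proof.
move=> tw; have szw := tree_equiv_size tw; case: tw => eq_c dom.
by split=> // k l; rewrite -szw -eq_c => wk wl mono; rewrite dom.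
Qed.

Definition block v c : seq (nat * G) := [seq (a, c) | a <- v].

Lemma unzip1_block v c : unzip1 (block v c) = v.
Proof. by rewrite /unzip1 -map_comp map_id. Qed.

Lemma unzip2_block v c : unzip2 (block v c) = nseq (size v) c.
Proof. by elim: v => //= a v ->. Qed.

Lemma size_block v c : size (block v c) = size v.
Proof. exact: size_map. Qed.

Lemma rainbow_block v c r : v != [::] -> ohead (unzip2 r) != Some c ->
  rainbow (block v c ++ r) = (v, c) :: rainbow r.
Proof.
case: v => // a v _ rc; elim: v a => [|b v IHv] a /=; last first.
  by move: (IHv b) => /= ->; rewrite eqxx.
case: r rc => [|[b d] r] //= dc.
have /negPf ncd: c != d by apply: contra_neq dc => ->.
case: (rainbow r) => [|[v e] q]; first by rewrite ncd.
by case: (d == e); rewrite ncd.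
Qed.

Lemma block_splitP w : w != [::] -> exists v c r,
  [/\ w = block v c ++ r, v != [::] & ohead (unzip2 r) != Some c].
Proof.
elim: w => // -[a c] [|bd w] IHw _; first by exists [:: a], c, [::].
have [//|v [d [r [Ew v0 rd]]]] := IHw.
have [Ecd|ne_cd] := eqVneq c d; first by exists (a :: v), c, r; rewrite Ew Ecd.
exists [:: a], c, (bd :: w); split=> //; rewrite Ew.
by case: v v0 {Ew} => // b v _ /=; apply: contra_neq ne_cd => -[].
Qed.

Definition word_stat w : seq (tree * G) :=
  [seq (word_tree p.1, p.2) | p <- rainbow w].

Lemma word_stat_block v c r : v != [::] -> ohead (unzip2 r) != Some c ->
  word_stat (block v c ++ r) = (word_tree v, c) :: word_stat r.
Proof. by move=> v0 rc; rewrite /word_stat rainbow_block. Qed.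

Lemma nseq_cat_inj m m' c c' s s' : 0 < m -> 0 < m' ->
    ohead s != Some c -> ohead s' != Some c' ->
    nseq m c ++ s = nseq m' c' ++ s' -> [/\ m = m', c = c' & s = s'].
Proof.
case: m m' => // m [//|m'] _ _ sc sc' [Ec].
rewrite -{c'}Ec in sc' *; move: m'; elim: m => [|m IHm] [|m'] //=.
- by move=> Es; rewrite Es eqxx in sc.
- by move=> Es; rewrite -Es eqxx in sc'.
by case=> /IHm[[->] _ ->].
Qed.

Lemma tree_equiv_block v c r v' c' r' :
    v != [::] -> ohead (unzip2 r) != Some c ->
    v' != [::] -> ohead (unzip2 r') != Some c' ->
  tree_equiv (block v c ++ r) (block v' c' ++ r') <->
  [/\ c = c', word_tree v = word_tree v' & tree_equiv r r'].
Proof.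
move=> v0 rc v0' rc'; rewrite /tree_equiv /unzip1 /unzip2 !map_cat.
rewrite -!/(unzip1 _) -!/(unzip2 _) !unzip1_block !unzip2_block size_cat size_block.
split=> [[eq_c dom]|[<- /eq_word_treeP[szv domv] [<- domr]]].
  have [||//|//|szv eq_cc eq_r] := nseq_cat_inj _ _ _ _ eq_c; rewrite ?lt0n ?size_eq0 //.
  split=> //.
    apply/eq_word_treeP; split=> // k l vk vl.
    rewrite -(dominates_catl (unzip1 r)) // dom ?dominates_catl -?szv //; try lia.
    rewrite monochrome_catl ?size_nseq //; exact: monochrome_nseq.
  split=> // k l rk rl mono.
  rewrite -(dominates_catr v) dom ?ltn_add2l //.
    by rewrite szv dominates_catr.
  by have := monochrome_catr (nseq (size v) c) (unzip2 r) k l;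
     rewrite size_nseq => ->.
split=> [|k l wk wl]; first by rewrite szv.
have [vk|vk] := ltnP k (size v); have [vl|vl] := ltnP l (size v).
- by move=> _; rewrite !dominates_catl -?szv //; apply: domv.
- by case/not_monochrome_head; rewrite // ?size_map; lia.
- by case/not_monochrome_head; rewrite // ?size_map; lia.
have ->: k = size v + (k - size v) by lia.
have ->: l = size v + (l - size v) by lia.
have := monochrome_catr (nseq (size v) c) (unzip2 r) (k - size v) (l - size v).
rewrite size_nseq => -> mono.
by rewrite dominates_catr szv dominates_catr; apply: domr; rewrite -?szv //; lia.
Qed.

(** The colours give back the lengths of the monochromatic blocks, and
    inside a block the tree carries the same information as the domination
    relation. *)
Lemma word_statP w w' : word_stat w = word_stat w' <-> tree_equiv w w'.
Proof.
elim: {w}(size w).+1 {-2}w (ltnSn (size w)) w' => // n IHn w + w'.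
rewrite ltnS => le_wn.
have [->|/block_splitP[v [c [r [Ew v0 rc]]]]] := eqVneq w [::].
  have [->|/block_splitP[v' [c' [r' [-> v0' rc']]]]] := eqVneq w' [::].
    by split.
  rewrite word_stat_block //; split=> // /tree_equiv_size.
  by case: (v') v0'.
have [->|/block_splitP[v' [c' [r' [Ew' v0' rc']]]]] := eqVneq w' [::].
  rewrite Ew word_stat_block //; split=> // /tree_equiv_size.
  by case: (v) v0.
rewrite Ew Ew' !word_stat_block // tree_equiv_block //.
have /IHn/(_ r') IHr: size r < n.
  by move: le_wn; rewrite Ew size_cat size_map; case: (v) v0 => //= *; lia.
by split=> [[-> -> /IHr]|[-> -> /IHr->]].
Qed.

End ColouredWords.

Local Open Scope nat_scope.

(** * Coloured permutations as standardised words *)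

Lemma std_perm_word v : perm_eq v (iota 1 (size v)) -> std v = v.
Proof.
move=> perm_v; have uniq_v: uniq v by rewrite (perm_uniq perm_v) iota_uniq.
apply: (@eq_from_nth _ 0) => [|i]; rewrite size_std // => vi.
rewrite (nth_map 0) ?size_iota // nth_iota // add0n.
set x := nth 0 v i.
have /count_memPn ->: x \notin take i v.
  have: uniq (take i v ++ drop i v) by rewrite cat_take_drop.
  by rewrite (drop_nth 0) // uniq_catC /= mem_cat negb_or => /andP[/andP[]].
have: x \in iota 1 (size v) by rewrite -(perm_mem perm_v) mem_nth.
rewrite mem_iota => /andP[x_gt0 x_le]; rewrite (seq.permP perm_v).
have ->: size v = x.-1 + (size v - x.-1) by lia.
rewrite iotaD count_cat (@eq_in_count _ _ predT) => [|y]; last first.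
  by rewrite mem_iota /=; lia.
rewrite (@eq_in_count _ _ pred0 (iota _ (_ - _))) => [|y]; last first.
  by rewrite mem_iota /=; lia.
by rewrite count_predT count_pred0 size_iota; lia.
Qed.

Lemma std_ltn v (i : 'I_(size v)) : (nth 0 (std v) i).-1 < size v.
Proof. by have := nth_std_gt0 (ltn_ord i); have := nth_std_le (ltn_ord i); lia. Qed.

Definition std_fun v (i : 'I_(size v)) : 'I_(size v) := Ordinal (std_ltn i).

Lemma std_fun_inj v : injective (@std_fun v).
Proof.
move=> i j /(congr1 val) eq_ij; apply: val_inj.
have {}eq_ij: nth 0 (std v) i = nth 0 (std v) j.
  have := nth_std_gt0 (ltn_ord i); have := nth_std_gt0 (ltn_ord j).
  by move: eq_ij; rewrite [val _]/= [val (std_fun j)]/=; lia.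
by have /(uniqP 0) := std_uniq v; apply=> //; rewrite inE size_std ltn_ord.
Qed.

Definition std_perm v : 'S_(size v) := perm (@std_fun_inj v).

Section Cperm.
Variable G : finGroupType.
Implicit Types (w : seq (nat * G)) (a b : gcperm G).

Definition word_of a : seq (nat * G) := cword (tagged a).

(** Every word represents a coloured permutation, with the same relative
    order and the same colours. Working with all representatives avoids
    standardising prefixes, suffixes and shuffles. *)
Definition stdw w : gcperm G :=
  gc (CPerm (std_perm (unzip1 w)) [ffun i : 'I_(size (unzip1 w)) => nth 1%g (unzip2 w) i]).

Definition order_equiv w w' : Prop :=
  unzip2 w = unzip2 w' /\ same_order (unzip1 w) (unzip1 w').

Lemma order_equiv_sym w w' : order_equiv w w' -> order_equiv w' w.
Proof. by case=> eq_c /same_order_sym; split. Qed.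

Lemma order_equiv_trans w1 w2 w3 :
  order_equiv w1 w2 -> order_equiv w2 w3 -> order_equiv w1 w3.
Proof.
case=> c12 [s12 o12] [c23 [s23 o23]]; split; first by rewrite c12.
by split=> [|i j wi wj]; [rewrite s12|rewrite o12 // o23 -?s12].
Qed.

Lemma order_equiv_tree w w' : order_equiv w w' -> tree_equiv w w'.
Proof.
case=> eq_c [_ ord]; split=> // k l wk wl _.
by split=> dom x xkl; have := dom x xkl; rewrite ord ?size_map //; lia.
Qed.

Lemma size_cword n (a : cperm G n) : size (cword a) = n.
Proof. by rewrite size_map size_enum_ord. Qed.

Lemma size_word_of a : size (word_of a) = tag a.
Proof. exact: size_cword. Qed.

Lemma unzip1_cword n (a : cperm G n) :
  unzip1 (cword a) = [seq (cp_perm a i).+1 | i <- enum 'I_n].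
Proof. by rewrite /unzip1 -map_comp. Qed.

Lemma unzip2_cword n (a : cperm G n) :
  unzip2 (cword a) = [seq cp_col a i | i <- enum 'I_n].
Proof. by rewrite /unzip2 -map_comp. Qed.

Lemma cword_inj n : injective (@cword G n).
Proof.
move=> a b eq_ab; have eq1 := congr1 unzip1 eq_ab; have eq2 := congr1 unzip2 eq_ab.
move: eq1 eq2; rewrite !unzip1_cword !unzip2_cword => /eq_in_map eq1 /eq_in_map eq2.
case: a b eq1 eq2 {eq_ab} => [s g] [t h] /= eq1 eq2; congr CPerm.
  by apply/permP=> i; apply/val_inj; case: (eq1 i (mem_enum _ i)).
by apply/ffunP=> i; apply: eq2 (mem_enum _ i).
Qed.

Lemma word_of_inj : injective word_of.
Proof.
move=> [n a] [m b] eq_ab; have := congr1 size eq_ab; rewrite !size_word_of /=.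
move=> eq_nm; subst m; congr existT; exact: cword_inj eq_ab.
Qed.

Lemma perm_cword n (a : cperm G n) : perm_eq (unzip1 (cword a)) (iota 1 n).
Proof.
apply: uniq_perm; rewrite ?iota_uniq //.
  by rewrite unzip1_cword map_inj_uniq ?enum_uniq // => i j [/val_inj/perm_inj].
move=> x; rewrite unzip1_cword mem_iota; apply/mapP/idP => [[i _ ->]|].
  by have := ltn_ord (cp_perm a i); lia.
move=> xn; have lt_xn: x.-1 < n by lia.
exists ((cp_perm a)^-1%g (Ordinal lt_xn)); first by rewrite mem_enum.
by rewrite permKV /=; lia.
Qed.

Lemma tag_stdw w : tag (stdw w) = size w.
Proof. exact: size_map. Qed.

Lemma unzip1_word_stdw w : unzip1 (word_of (stdw w)) = std (unzip1 w).
Proof.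
rewrite unzip1_cword; apply: (@eq_from_nth _ 0) => [|i].
  by rewrite size_map size_enum_ord size_std.
rewrite size_map size_enum_ord => wi.
rewrite (nth_map (Ordinal wi)) ?size_enum_ord //.
have -> : nth (Ordinal wi) (enum 'I_(size (unzip1 w))) i = Ordinal wi.
  by apply: val_inj; rewrite /= nth_enum_ord.
by rewrite permE /= prednK // nth_std_gt0.
Qed.

Lemma unzip2_word_stdw w : unzip2 (word_of (stdw w)) = unzip2 w.
Proof.
rewrite unzip2_cword; apply: (@eq_from_nth _ 1%g) => [|i].
  by rewrite size_map size_enum_ord; apply: etrans (size_map _ _) (esym (size_map _ _)).
rewrite size_map size_enum_ord => wi.
rewrite (nth_map (Ordinal wi)) ?size_enum_ord // ffunE.
by rewrite nth_enum_ord.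
Qed.

Lemma stdw_equiv w : order_equiv (word_of (stdw w)) w.
Proof.
split; first exact: unzip2_word_stdw.
by rewrite unzip1_word_stdw; apply: same_order_std.
Qed.

Lemma eq_stdw w w' : order_equiv w w' -> stdw w = stdw w'.
Proof.
case=> eq2 /eq_std eq1; apply: word_of_inj.
rewrite -[LHS]zip_unzip -[RHS]zip_unzip.
by rewrite !unzip1_word_stdw !unzip2_word_stdw eq1 eq2.
Qed.

Lemma word_of_perm w : perm_eq (unzip1 w) (iota 1 (size w)) -> word_of (stdw w) = w.
Proof.
move=> perm_w; rewrite -[LHS]zip_unzip -[RHS]zip_unzip.
rewrite unzip1_word_stdw unzip2_word_stdw std_perm_word //.
by rewrite size_map.
Qed.

Lemma word_ofK : cancel word_of stdw.
Proof.
move=> a; apply: word_of_inj; rewrite word_of_perm //.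
by rewrite size_word_of; apply: perm_cword.
Qed.

Lemma stdw_gc n w : size w = n -> exists a : cperm G n, gc a = stdw w.
Proof.
by rewrite -tag_stdw; case: (stdw w) => m a /= <-; exists a.
Qed.

Lemma gc_inj n : injective (@gc G n).
Proof. by move=> a b /eqP; rewrite /gc eq_Tagged => /eqP. Qed.

Lemma eq_gc n (a b : cperm G n) : (gc a == gc b) = (a == b).
Proof. exact: eq_Tagged. Qed.

Lemma order_equiv_take k w w' :
  order_equiv w w' -> order_equiv (take k w) (take k w').
Proof.
by case=> eq_c so; rewrite /order_equiv /unzip1 /unzip2 !map_take -/(unzip2 _) eq_c;
   split=> //; apply: same_order_take.
Qed.

Lemma order_equiv_drop k w w' :
  order_equiv w w' -> order_equiv (drop k w) (drop k w').
Proof.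
by case=> eq_c so; rewrite /order_equiv /unzip1 /unzip2 !map_drop -/(unzip2 _) eq_c;
   split=> //; apply: same_order_drop.
Qed.

End Cperm.

Local Open Scope nat_scope.

(** * The product on words *)

Lemma enum_ord_cat n m : enum 'I_(n + m) =
  [seq lshift m i | i <- enum 'I_n] ++ [seq rshift n j | j <- enum 'I_m].
Proof.
apply: (inj_map val_inj); rewrite [LHS](val_enum_ord (n + m)) iotaD map_cat.
rewrite -(map_comp _ _ (enum 'I_n)) -(map_comp _ _ (enum 'I_m)); congr (_ ++ _).
  by rewrite -(val_enum_ord n); apply: eq_map.
by rewrite add0n -[n in LHS]addn0 iotaDl -(val_enum_ord m) -(map_comp _ _ (enum 'I_m)).
Qed.

Lemma nth_map_ord (T : Type) (d : T) n (f : 'I_n -> T) k (lt_kn : k < n) :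
  nth d [seq f i | i <- enum 'I_n] k = f (Ordinal lt_kn).
Proof.
rewrite (nth_map (Ordinal lt_kn) d f (s := enum 'I_n)) ?size_enum_ord //.
by congr f; apply: val_inj; rewrite /= nth_enum_ord.
Qed.

Lemma grassmannianP n m (u : 'S_(n + m)) : reflect
  ((forall i j : 'I_n, i < j -> u (lshift m i) < u (lshift m j)) /\
   (forall i j : 'I_m, i < j -> u (rshift n i) < u (rshift n j)))
  (u \in grassmannian n m).
Proof.
rewrite inE; apply: (iffP andP) => -[u1 u2]; split.
- by move=> i j ij; move/forallP/(_ i)/forallP/(_ j)/implyP: u1; apply.
- by move=> i j ij; move/forallP/(_ i)/forallP/(_ j)/implyP: u2; apply.
- by apply/forallP=> i; apply/forallP=> j; apply/implyP; apply: u1.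
- by apply/forallP=> i; apply/forallP=> j; apply/implyP; apply: u2.
Qed.

Lemma ord_mono n (f : 'I_n -> nat) : (forall i j : 'I_n, i < j -> f i < f j) ->
  forall i j : 'I_n, (f i < f j) = (i < j).
Proof.
move=> fM i j; apply/idP/idP; last exact: fM.
by apply: contraLR; rewrite -!leqNgt leq_eqVlt => /predU1P[/val_inj->|/fM/ltnW].
Qed.

Section Bridge.
Variable G : finGroupType.
Local Notation x0 := (0, 1%g : G).
Implicit Types (w : seq (nat * G)).

Lemma order_equiv_enum n (f g : 'I_n -> nat * G) :
    (forall i, (f i).2 = (g i).2) ->
    (forall i j, ((f i).1 < (f j).1) = ((g i).1 < (g j).1)) ->
  order_equiv [seq f i | i <- enum 'I_n] [seq g i | i <- enum 'I_n].
Proof.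
move=> eq2 ord; split; first by rewrite /unzip2 -!(map_comp _ _ (enum 'I_n)); apply: eq_map.
rewrite /same_order /unzip1 -!(map_comp _ _ (enum 'I_n)).
rewrite !(size_map _ (enum 'I_n)) size_enum_ord; split=> // i j ni nj.
rewrite /klt !(nth_map_ord _ _ ni) !(nth_map_ord _ _ nj) /=.
by have := ord (Ordinal ni) (Ordinal nj); have := ord (Ordinal nj) (Ordinal ni); lia.
Qed.

Lemma order_equiv_enumP n (f g : 'I_n -> nat * G) :
    injective (fst \o f) -> injective (fst \o g) ->
    order_equiv [seq f i | i <- enum 'I_n] [seq g i | i <- enum 'I_n] ->
  (forall i, (f i).2 = (g i).2) /\
  (forall i j, ((f i).1 < (f j).1) = ((g i).1 < (g j).1)).
Proof.
move=> f_inj g_inj []; rewrite /unzip2 -!(map_comp _ _ (enum 'I_n)) => eq2 [_ ord].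
split=> [i|i j].
  have := congr1 (fun s => nth 1%g s i) eq2.
  rewrite !(nth_map_ord _ _ (ltn_ord i)) /=; congr (_ = _); congr (snd _).
    by congr (_ _); apply: val_inj.
  by congr (_ _); apply: val_inj.
have f1 (h : 'I_n -> nat * G) (k : 'I_n) : nth 0 (unzip1 [seq h i | i <- enum 'I_n]) k = (h k).1.
  rewrite /unzip1 -(map_comp _ _ (enum 'I_n)) (nth_map_ord _ _ (ltn_ord k)) /=.
  by congr (h _).1; apply: val_inj.
have [->|ne_ij] := eqVneq i j; first by rewrite !ltnn.
have sz (h : 'I_n -> nat * G) : size (unzip1 [seq h i | i <- enum 'I_n]) = n.
  by rewrite size_map (size_map _ (enum 'I_n)) size_enum_ord.
have := ord j i; have := ord i j.
rewrite !sz => /(_ (ltn_ord i) (ltn_ord j)) + /(_ (ltn_ord j) (ltn_ord i)).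
rewrite /klt !f1.
have: (f i).1 != (f j).1 by apply: contra_neq ne_ij => /f_inj.
have: (g i).1 != (g j).1 by apply: contra_neq ne_ij => /g_inj.
lia.
Qed.

Definition letter n (c : cperm G n) i : nat * G := ((cp_perm c i).+1, cp_col c i).

Lemma cword_cat n m (c : cperm G (n + m)) : cword c =
  [seq letter c (lshift m i) | i <- enum 'I_n]
  ++ [seq letter c (rshift n j) | j <- enum 'I_m].
Proof.
rewrite /cword enum_ord_cat map_cat.
by rewrite -(map_comp _ _ (enum 'I_n)) -(map_comp _ _ (enum 'I_m)).
Qed.

Lemma take_cword n m (c : cperm G (n + m)) :
  take n (cword c) = [seq letter c (lshift m i) | i <- enum 'I_n].
Proof. by rewrite cword_cat take_size_cat // size_map size_enum_ord. Qed.

Lemma drop_cword n m (c : cperm G (n + m)) :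
  drop n (cword c) = [seq letter c (rshift n j) | j <- enum 'I_m].
Proof. by rewrite cword_cat drop_size_cat // size_map size_enum_ord. Qed.

Lemma stdw_cword n (a : cperm G n) : stdw (cword a) = gc a.
Proof. exact: (word_ofK (gc a)). Qed.

Section Product.
Variables (n m : nat) (a : cperm G n) (b : cperm G m).

Lemma cperm_sum_l i : letter (cperm_sum a b) (lshift m i) = letter a i.
Proof.
rewrite /letter /cperm_sum /= permE /sum_fun ffunE.
by have /= -> := unsplitK (inl i : 'I_n + 'I_m).
Qed.

Lemma cperm_sum_r j :
  letter (cperm_sum a b) (rshift n j) = ((n + cp_perm b j).+1, cp_col b j).
Proof.
rewrite /letter /cperm_sum /= permE /sum_fun ffunE.
by have /= -> := unsplitK (inr j : 'I_n + 'I_m).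
Qed.

Lemma cperm_sum_perm_l i :
  cp_perm (cperm_sum a b) (lshift m i) = lshift m (cp_perm a i).
Proof. by apply/val_inj; case: (cperm_sum_l i). Qed.

Lemma cperm_sum_perm_r j :
  cp_perm (cperm_sum a b) (rshift n j) = rshift n (cp_perm b j).
Proof. by apply/val_inj; case: (cperm_sum_r j). Qed.

Lemma letter_mul_perm (u : 'S_(n + m)) k :
  letter (of_perm G u * cperm_sum a b)%g k
  = ((u (cp_perm (cperm_sum a b) k)).+1, cp_col (cperm_sum a b) k).
Proof. by rewrite /letter permM ffunE /= ffunE mul1g. Qed.

(** Multiplying on the left by a permutation that increases on both
    intervals relabels the letters of the word and keeps their relative order
    inside each of its two parts; every word with two parts of the given
    orders arises in this way. *)
Lemma mem_product (c : cperm G (n + m)) :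
  (exists2 u, u \in grassmannian n m & c = (of_perm G u * cperm_sum a b)%g)
  <-> stdw (take n (cword c)) = gc a /\ stdw (drop n (cword c)) = gc b.
Proof.
split=> [[u /grassmannianP[u1 u2] ->]|[]].
  rewrite take_cword drop_cword -!stdw_cword; split; apply: eq_stdw.
    apply: order_equiv_enum => [i|i j]; rewrite !letter_mul_perm /=.
      by case: (cperm_sum_l i).
    by rewrite !ltnS !cperm_sum_perm_l (ord_mono u1).
  apply: order_equiv_enum => [i|i j]; rewrite !letter_mul_perm /=.
    by case: (cperm_sum_r i).
  by rewrite !ltnS !cperm_sum_perm_r (ord_mono u2).
rewrite take_cword drop_cword -!stdw_cword.
move=> /(congr1 (@word_of G)) eq_a /(congr1 (@word_of G)) eq_b.
have equiv_a: order_equiv [seq letter c (lshift m i) | i <- enum 'I_n] (cword a).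
  apply: order_equiv_trans (stdw_equiv (cword a)).
  by rewrite -[word_of (stdw (cword a))]eq_a; apply/order_equiv_sym/stdw_equiv.
have equiv_b: order_equiv [seq letter c (rshift n j) | j <- enum 'I_m] (cword b).
  apply: order_equiv_trans (stdw_equiv (cword b)).
  by rewrite -[word_of (stdw (cword b))]eq_b; apply/order_equiv_sym/stdw_equiv.
have letter_inj k (d : cperm G k) : injective (fst \o letter d).
  by move=> i j [/val_inj/perm_inj].
have [||col_a ord_a] := order_equiv_enumP _ _ equiv_a; try exact: letter_inj.
  by move=> i j /letter_inj/lshift_inj.
have [||col_b ord_b] := order_equiv_enumP _ _ equiv_b; try exact: letter_inj.
  by move=> i j /letter_inj/rshift_inj.
pose s := cp_perm (cperm_sum a b); pose u := (s^-1 * cp_perm c)%g.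
have uE k : u (s k) = cp_perm c k by rewrite permM permK.
exists u.
  apply/grassmannianP; split=> i j ij.
    have Es k : lshift m k = s (lshift m ((cp_perm a)^-1 k)%g).
      by rewrite /s cperm_sum_perm_l permKV.
    rewrite (Es i) (Es j) !uE -ltnS; have := ord_a ((cp_perm a)^-1 i)%g ((cp_perm a)^-1 j)%g.
    by rewrite /= => ->; rewrite !permKV.
  have Es k : rshift n k = s (rshift n ((cp_perm b)^-1 k)%g).
    by rewrite /s cperm_sum_perm_r permKV.
  rewrite (Es i) (Es j) !uE -ltnS; have := ord_b ((cp_perm b)^-1 i)%g ((cp_perm b)^-1 j)%g.
  by rewrite /= => ->; rewrite !permKV.
apply: cword_inj; rewrite !cword_cat; congr (_ ++ _); apply: eq_map => i.
  rewrite letter_mul_perm uE /letter; congr pair.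
  by rewrite [LHS]col_a; case: (cperm_sum_l i).
rewrite letter_mul_perm uE /letter; congr pair.
by rewrite [LHS]col_b; case: (cperm_sum_r i).
Qed.

End Product.

Lemma product_decomposition n m (c : cperm G (n + m)) :
  exists (a : cperm G n) (b : cperm G m),
    exists2 u, u \in grassmannian n m & c = (of_perm G u * cperm_sum a b)%g.
Proof.
have [|a Ea] := @stdw_gc G n (take n (cword c)).
  by rewrite size_take size_cword; case: ifP; lia.
have [|b Eb] := @stdw_gc G m (drop n (cword c)).
  by rewrite size_drop size_cword; lia.
by exists a, b; apply/mem_product; rewrite Ea Eb.
Qed.

Lemma product_decomposition_inj n m (a a' : cperm G n) (b b' : cperm G m)
    (u u' : 'S_(n + m)) :
    u \in grassmannian n m -> u' \in grassmannian n m ->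
    (of_perm G u * cperm_sum a b = of_perm G u' * cperm_sum a' b')%g ->
  [/\ u = u', a = a' & b = b'].
Proof.
move=> Xu Xu' eq_c.
have [ta tb] := (mem_product a b _).1 (ex_intro2 _ _ u Xu erefl).
have [ta' tb'] := (mem_product a' b' _).1 (ex_intro2 _ _ u' Xu' eq_c).
have Ea: a = a' by apply: gc_inj; rewrite -ta -ta'.
have Eb: b = b' by apply: gc_inj; rewrite -tb -tb'.
split=> //; move: eq_c; rewrite -Ea -Eb => /mulIg/(congr1 (@cp_perm G _)).
by [].
Qed.

End Bridge.

Local Open Scope ring_scope.

Section Coefficients.
Variables (K : fieldType) (G : finGroupType).
Implicit Types (u v w : seq (nat * G)).

Lemma sum_indicator (I : finType) (A P : pred I) :
    (forall i j, A i -> A j -> P i -> P j -> i = j) ->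
  \sum_(i | A i) (P i)%:R = ([exists i, A i && P i])%:R :> K.
Proof.
move=> inj_P; have [/existsP[i /andP[Ai Pi]]|none] := boolP [exists i, A i && P i].
  rewrite (bigD1 i) //= Pi big1 ?addr0 // => j /andP[Aj ne_ji].
  by case: (boolP (P j)) => // Pj; rewrite (inj_P j i) ?eqxx in ne_ji.
rewrite big1 // => i Ai; case: (boolP (P i)) => // Pi.
by case/existsP: none; exists i; rewrite Ai.
Qed.

Lemma mul_basis_coef p w :
  (KG_mul_basis K p)@_(stdw w)
  = \sum_(q <- splits w) ((stdw q.1, stdw q.2) == p :> gcperm G * gcperm G)%:R.
Proof.
case: p => [[n a] [m b]]; rewrite /KG_mul_basis raddf_sum /=.
under eq_bigr => u _ do rewrite mcoeff_basis.
have [sz_w|ne_sz] := eqVneq (size w) (n + m)%N; last first.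
  rewrite big1 => [|u _]; last first.
    by case: eqP => // /(congr1 tag); rewrite tag_stdw /= => Ew; rewrite Ew eqxx in ne_sz.
  rewrite big_seq big1 // => q /splits_cat Ew; case: eqP => //.
  move/(congr1 (fun r => (tag r.1, tag r.2))).
  rewrite !tag_stdw => -[En Em].
  by rewrite Ew size_cat En Em eqxx in ne_sz.
have [c Ec] := stdw_gc sz_w; rewrite -Ec.
under eq_bigr => u _ do rewrite eq_gc.
rewrite sum_indicator => [|u u' Xu Xu' /eqP <- /eqP/esym/product_decomposition_inj[] //].
have equiv_w: order_equiv w (cword c).
  by apply: order_equiv_sym; have := stdw_equiv w; rewrite -Ec.
rewrite splits_iota big_map (bigD1_seq n) ?iota_uniq ?mem_iota //; last first.
  by rewrite /= sz_w ltnS leq_addr.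
rewrite big_seq_cond big1 => [|i /andP[]]; last first.
  rewrite mem_iota sz_w => /andP[_ le_i] ne_in; case: eqP => //.
  move=> /(congr1 (fun r => tag r.1)); rewrite tag_stdw /= size_take sz_w => E.
  by move: ne_in E; case: ltnP => [_ /eqP//|]; lia.
rewrite [RHS]addr0; congr (_%:R); congr nat_of_bool; apply/existsP/eqP.
  case=> u /andP[Xu /eqP Eu].
  have [|ta tb] := (mem_product a b c).1 _; first by exists u.
  rewrite -[RHS]/(gc a, gc b) -ta -tb.
  by congr pair; apply: eq_stdw; [apply: order_equiv_take|apply: order_equiv_drop].
move=> Eab; have Ea : stdw (take n w) = gc a := congr1 fst Eab.
have Eb : stdw (drop n w) = gc b := congr1 snd Eab.
have [|u Xu Eu] := (mem_product a b c).2 _; last by exists u; rewrite Xu Eu eqxx.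
rewrite -Ea -Eb; split; apply: eq_stdw; apply: order_equiv_sym.
  exact: order_equiv_take.
exact: order_equiv_drop.
Qed.

(** Dual form of [mem_product]: as functions on words, elements multiply by
    convolution along deconcatenation. *)
Lemma hmul_coef x y w :
  (hmul (KG K G) x y)@_(stdw w)
  = \sum_(q <- splits w) x@_(stdw q.1) * y@_(stdw q.2).
Proof.
suff lextE z : (lext (@KG_mul_basis K G) z)@_(stdw w)
    = \sum_(q <- splits w) z@_(stdw q.1, stdw q.2).
  by rewrite lextE; apply: eq_bigr => q _; rewrite tensE.
apply: (coef_of_basis (L := lext (@KG_mul_basis K G))) => [c z1 z2|p].
  exact: linearP.
rewrite lextU mul_basis_coef; apply: eq_bigr => q _.
by rewrite eq_sym.
Qed.

End Coefficients.

Local Open Scope nat_scope.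

(** * Shuffling equivalent words along the same pattern *)

(** What matters about a shuffle of the positions of two words of lengths
    [n] and [m]: it reads every position, and increasingly on each side. *)
Definition shuffle_pattern n m k : Prop :=
  [/\ size k = n + m,
      forall t, t < n + m -> nth 0 k t < n + m,
      forall q, q < n + m -> exists2 t, t < n + m & nth 0 k t = q
    & forall s t, s < t < n + m -> (nth 0 k s < n) = (nth 0 k t < n) ->
        nth 0 k s < nth 0 k t].

Lemma pairwise_separated (T : eqType) (P : pred T) (r : rel T) w :
    pairwise r (filter P w) -> pairwise r (filter (predC P) w) ->
  pairwise (fun x y => (P x == P y) ==> r x y) w.
Proof.
elim: w => //= x w IHw; have [Px|nPx] /= := boolP (P x).
  rewrite all_filter => /andP[rx pw1] pw2; rewrite IHw // andbT.
  by apply: sub_all rx => y /=; case: (P y).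
rewrite all_filter => pw1 /andP[rx pw2]; rewrite IHw // andbT.
by apply: sub_all rx => y /=; case: (P y).
Qed.

Lemma shuffle_iota_pattern n m k :
  k \in shuffle (iota 0 n) (iota n m) -> shuffle_pattern n m k.
Proof.
have all_l: all (fun x => x < n) (iota 0 n) by apply/allP=> x; rewrite mem_iota.
have all_r: all (predC (fun x => x < n)) (iota n m).
  by apply/allP=> x; rewrite mem_iota /= -leqNgt => /andP[].
rewrite (mem_shuffle _ all_l all_r) => /andP[/eqP kl /eqP kr].
have perm_k: perm_eq k (iota 0 (n + m)).
  by rewrite iotaD -kl add0n -kr perm_sym perm_filterC.
have size_k: size k = n + m by rewrite (perm_size perm_k) size_iota.
have mem_k q : (q \in k) = (q < n + m) by rewrite (perm_mem perm_k) mem_iota.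
split=> //.
- by move=> t tn; rewrite -mem_k mem_nth ?size_k.
- move=> q qn; exists (index q k); first by rewrite -size_k index_mem mem_k.
  by rewrite nth_index ?mem_k.
have sorted_iota a b : pairwise ltn (iota a b).
  by rewrite -sorted_pairwise ?iota_ltn_sorted //; apply: ltn_trans.
have: pairwise (fun x y => ((x < n) == (y < n)) ==> (x < y)) k.
  by apply: (@pairwise_separated _ (fun x => x < n)); rewrite ?kl ?kr.
move=> /(pairwiseP 0) pw s t; rewrite -size_k => /andP[st tk] same.
by have := pw s t (ltn_trans st tk) tk st; rewrite same eqxx.
Qed.

(** Makes the shuffles of different words comparable: they are read along
    the same shuffles of positions. *)
Lemma shuffle_index (T : eqType) (x0 : T) u v : shuffle u v =
  [seq [seq nth x0 (u ++ v) x | x <- k]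
  | k <- shuffle (iota 0 (size u)) (iota (size u) (size v))].
Proof.
rewrite -map_shuffle; congr shuffle; apply: (@eq_from_nth _ x0).
- by rewrite size_map size_iota.
- by move=> i ui; rewrite (nth_map 0) ?size_iota // nth_iota // nth_cat ui.
- by rewrite size_map size_iota.
move=> i vi; rewrite (nth_map 0) ?size_iota // nth_iota //.
by rewrite nth_cat ltnNge leq_addr /= addKn.
Qed.

Section Letters.
Implicit Types (u v k : seq nat).

Definition along w k : seq nat := [seq nth 0 w x | x <- k].

(** When the letters of [u] are smaller than those of [v], letters from
    different words compare in a way that depends on the pattern only. *)
Lemma klt_along n m u v k s t :
    size u = n -> size v = m -> {in u & v, forall x y, x < y} ->
    shuffle_pattern n m k -> s < n + m -> t < n + m ->
  klt (along (u ++ v) k) s t =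
  if (nth 0 k s < n) == (nth 0 k t < n)
  then klt (u ++ v) (nth 0 k s) (nth 0 k t) else nth 0 k s < n.
Proof.
move=> szu szv uv [szk kn _ kmono] sn tn.
have val_k x : x < n + m -> nth 0 (along (u ++ v) k) x = nth 0 (u ++ v) (nth 0 k x).
  by move=> xn; rewrite (nth_map 0) ?szk.
rewrite {1}/klt !val_k //; case: ifP => [/eqP same|/negbT diff].
  rewrite /klt /=; congr (_ || (_ && _)).
  have mst: s < t -> nth 0 k s < nth 0 k t.
    by move=> st; apply: kmono; rewrite ?st.
  have mts: t < s -> nth 0 k t < nth 0 k s.
    by move=> ts; apply: kmono; rewrite ?ts.
  apply/idP/idP => [/mst//|]; apply: contraTT; rewrite -!leqNgt leq_eqVlt.
  by case/predU1P=> [->//|/mts/ltnW].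
have cross x y : x < n + m -> y < n + m -> nth 0 k x < n -> n <= nth 0 k y ->
    nth 0 (u ++ v) (nth 0 k x) < nth 0 (u ++ v) (nth 0 k y).
  move=> xn yn xl yr; rewrite !nth_cat szu xl (ltnNge (nth 0 k y)) yr /=.
  apply: uv.
    by rewrite mem_nth ?szu.
  by rewrite mem_nth // szv; have := kn y yn; lia.
have [sl|sr] := ltnP (nth 0 k s) n; have [tl|tr] := ltnP (nth 0 k t) n.
- by rewrite sl tl in diff.
- by rewrite cross.
- by have := cross t s tn sn tl sr; lia.
- by move: diff; rewrite !ltnNge sr tr.
Qed.

Lemma same_order_along n m u v u' v' k :
    size u = n -> size v = m ->
    {in u & v, forall x y, x < y} -> {in u' & v', forall x y, x < y} ->
    shuffle_pattern n m k -> same_order u u' -> same_order v v' ->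
  same_order (along (u ++ v) k) (along (u' ++ v') k).
Proof.
move=> szu szv uv uv' pat [szu' ou] [szv' ov]; have [szk kn _ _] := pat.
split=> [|s t]; rewrite !size_map // szk => sn tn.
rewrite (klt_along szu szv) // (@klt_along n m) // -?szu' -?szv' //.
case: ifP => // /eqP same; have := kn s sn; have := kn t tn.
have [sl|sr] := ltnP (nth 0 k s) n => kt ks.
  have tl: nth 0 k t < n by rewrite -same.
  by rewrite !klt_catl -?szu' ?szu // ou // szu.
have tr: n <= nth 0 k t by rewrite leqNgt -same -leqNgt.
have cat_r w w' x y : size w = n -> n <= x -> n <= y ->
    klt (w ++ w') x y = klt w' (x - n) (y - n).
  by move=> <- wx wy; rewrite -(klt_catr w w') !subnKC.
by rewrite !cat_r -?szu' // ov // szv; lia.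
Qed.

End Letters.

Section ColouredPatterns.
Variable G : finGroupType.
Local Notation x0 := (0, 1%g : G).
Implicit Types (u v w : seq (nat * G)) (k : seq nat).

Definition calong w k : seq (nat * G) := [seq nth x0 w x | x <- k].

Lemma nth_unzip1 w x : nth 0 (unzip1 w) x = (nth x0 w x).1.
Proof. by elim: w x => [|a w IHw] [|x] //=. Qed.

Lemma nth_unzip2 w x : nth 1%g (unzip2 w) x = (nth x0 w x).2.
Proof. by elim: w x => [|a w IHw] [|x] //=. Qed.

Lemma unzip1_calong w k : unzip1 (calong w k) = along (unzip1 w) k.
Proof. by rewrite /unzip1 -map_comp; apply: eq_map => x /=; rewrite -nth_unzip1. Qed.

Lemma unzip2_calong w k :
  unzip2 (calong w k) = [seq nth 1%g (unzip2 w) x | x <- k].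
Proof. by rewrite /unzip2 -map_comp; apply: eq_map => x /=; rewrite -nth_unzip2. Qed.

Definition below u v : Prop := {in unzip1 u & unzip1 v, forall x y, x < y}.

Section Along.
Variables u v u' v' : seq (nat * G).
Hypotheses (uv : below u v) (uv' : below u' v').
Let n := size u.
Let m := size v.

Lemma order_equiv_along k : shuffle_pattern n m k ->
    order_equiv u u' -> order_equiv v v' ->
  order_equiv (calong (u ++ v) k) (calong (u' ++ v') k).
Proof.
move=> pat [cu ou] [cv ov]; split.
  by rewrite !unzip2_calong /unzip2 !map_cat -!/(unzip2 _) cu cv.
rewrite !unzip1_calong /unzip1 !map_cat -!/(unzip1 _).
by apply: (same_order_along _ _ uv uv' pat) => //; rewrite size_map.
Qed.

Lemma dominates_cat_equiv x y : tree_equiv u u' -> tree_equiv v v' ->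
    x < n + m -> y < n + m -> (x < n) = (y < n) ->
    monochrome (unzip2 (u ++ v)) x y ->
  dominates (unzip1 (u ++ v)) x y -> dominates (unzip1 (u' ++ v')) x y.
Proof.
move=> tu tv xn yn; have [szu szv] := (tree_equiv_size tu, tree_equiv_size tv).
case: tu tv => cu du [cv dv].
rewrite /unzip1 /unzip2 !map_cat -!/(unzip1 _) -!/(unzip2 _).
have [xl|xr] := ltnP x n; have [yl|yr] //= := ltnP y n => _.
  rewrite monochrome_catl ?size_map // => mono.
  by rewrite !dominates_catl ?size_map -?szu // (du x y).
have Ex : x = n + (x - n) by lia.
have Ey : y = n + (y - n) by lia.
have := monochrome_catr (unzip2 u) (unzip2 v) (x - n) (y - n).
have := dominates_catr (unzip1 u) (unzip1 v) (x - n) (y - n).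
have := dominates_catr (unzip1 u') (unzip1 v') (x - n) (y - n).
rewrite !size_map -szu -/n -Ex -Ey => -> -> -> mono.
by rewrite (dv (x - n) (y - n)) //; rewrite -/m; lia.
Qed.

(** Position [x] dominates [y] in a shuffle when it is smaller than the
    letters of both words that are read between them. For the letters of the
    other word this depends on the pattern only; for those of its own word it
    is domination inside a factor of that word, which is monochromatic when
    the factor of the shuffle is. *)
Lemma dominates_along k x y : shuffle_pattern n m k ->
    tree_equiv u u' -> tree_equiv v v' -> x < n + m -> y < n + m ->
    monochrome (unzip2 (calong (u ++ v) k)) x y ->
    dominates (unzip1 (calong (u ++ v) k)) x y ->
  dominates (unzip1 (calong (u' ++ v') k)) x y.
Proof.
move=> pat tu tv xn yn mono dom z xyz; have zn: z < n + m by lia.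
have [szu szv] := (tree_equiv_size tu, tree_equiv_size tv).
have [szk kn ksur kmono] := pat.
have kltE s t : s < n + m -> t < n + m -> klt (unzip1 (calong (u ++ v) k)) s t =
    if (nth 0 k s < n) == (nth 0 k t < n)
    then klt (unzip1 (u ++ v)) (nth 0 k s) (nth 0 k t) else nth 0 k s < n.
  move=> sn tn; rewrite unzip1_calong /unzip1 map_cat -!/(unzip1 _).
  by apply: (klt_along (m := m)); rewrite ?size_map.
have kltE' s t : s < n + m -> t < n + m -> klt (unzip1 (calong (u' ++ v') k)) s t =
    if (nth 0 k s < n) == (nth 0 k t < n)
    then klt (unzip1 (u' ++ v')) (nth 0 k s) (nth 0 k t) else nth 0 k s < n.
  move=> sn tn; rewrite unzip1_calong /unzip1 map_cat -!/(unzip1 _).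
  by apply: (klt_along (m := m)); rewrite ?size_map -?szu -?szv.
have := dom z xyz; rewrite kltE // kltE' //; case: ifP => // /eqP same _.
(* The positions of [u ++ v] between those read at [x] and [z] are read
   between [x] and [z], since a pattern is increasing on each side. *)
have reach q : minn (nth 0 k x) (nth 0 k z) <= q <= maxn (nth 0 k x) (nth 0 k z) ->
    exists t, [/\ t < n + m, nth 0 k t = q, (nth 0 k t < n) = (nth 0 k x < n)
                 & minn x z <= t <= maxn x z].
  have kx := kn x xn; have kz := kn z zn; move=> q_xz.
  have [|t tn Eq] := ksur q; first by lia.
  have same_t: (nth 0 k t < n) = (nth 0 k x < n) by move: same; rewrite Eq; lia.
  exists t; split=> //.
  have m1 : x < t -> nth 0 k x < nth 0 k t.
    by move=> xt; apply: kmono; rewrite ?xt.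
  have m2 : t < x -> nth 0 k t < nth 0 k x.
    by move=> tx; apply: kmono; rewrite ?tx.
  have m3 : z < t -> nth 0 k z < nth 0 k t.
    by move=> zt; apply: kmono; rewrite ?zt ?same_t.
  have m4 : t < z -> nth 0 k t < nth 0 k z.
    by move=> tz; apply: kmono; rewrite ?tz ?same_t.
  have m5 : x < z -> nth 0 k x < nth 0 k z.
    by move=> xz; apply: kmono; rewrite ?xz.
  have m6 : z < x -> nth 0 k z < nth 0 k x.
    by move=> zx; apply: kmono; rewrite ?zx.
  by rewrite -Eq in q_xz; lia.
have read_col t : t < n + m -> nth 1%g (unzip2 (calong (u ++ v) k)) t
    = nth 1%g (unzip2 (u ++ v)) (nth 0 k t).
  by move=> tn; rewrite unzip2_calong (nth_map 0) ?szk.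
apply: (dominates_cat_equiv tu tv (kn x xn) (kn z zn) (esym same)); last by lia.
  move=> q /reach[t [tn <- _ t_xz]]; rewrite -!read_col //; apply: mono; lia.
move=> q /reach[t [tn <- same_t t_xz]].
by have := dom t; rewrite kltE // same_t eqxx; apply; lia.
Qed.

End Along.

Lemma tree_equiv_along u v u' v' k : below u v -> below u' v' ->
    shuffle_pattern (size u) (size v) k ->
    tree_equiv u u' -> tree_equiv v v' ->
  tree_equiv (calong (u ++ v) k) (calong (u' ++ v') k).
Proof.
move=> uv uv' pat tu tv; have [szk _ _ _] := pat.
have [szu szv] := (tree_equiv_size tu, tree_equiv_size tv).
have eq_c: unzip2 (calong (u ++ v) k) = unzip2 (calong (u' ++ v') k).
  by rewrite !unzip2_calong /unzip2 !map_cat -!/(unzip2 _) tu.1 tv.1.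
split=> // x y; rewrite size_map szk => xn yn mono; split=> dom.
  exact: dominates_along dom.
by apply: (@dominates_along u' v' u v); rewrite -?szu -?szv -?eq_c //; apply: tree_equiv_sym.
Qed.

Lemma sum_shuffle_equiv (M : nmodType) (F : seq (nat * G) -> M) u v u' v' :
    size u = size u' -> size v = size v' ->
    (forall k, shuffle_pattern (size u) (size v) k ->
       F (calong (u ++ v) k) = F (calong (u' ++ v') k)) ->
  (\sum_(w <- shuffle u v) F w = \sum_(w <- shuffle u' v') F w)%R.
Proof.
move=> szu szv eqF; rewrite !(shuffle_index x0) -szu -szv !big_map.
by apply: eq_big_seq => k /shuffle_iota_pattern; apply: eqF.
Qed.

End ColouredPatterns.

Local Open Scope nat_scope.

(** * The coproduct on words *)

Section CoproductWords.
Variable G : finGroupType.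
Implicit Types (u v w : seq (nat * G)).

Lemma cperm_sumV n m (b : cperm G n) (c : cperm G m) :
  ((cperm_sum b c)^-1 = cperm_sum b^-1 c^-1)%g.
Proof.
apply/eqP; rewrite eq_invg_mul; apply/eqP.
congr CPerm; [apply/permP=> k|apply/ffunP=> k].
  rewrite permM perm1; case: (split_ordP k) => i ->.
    by rewrite !cperm_sum_perm_l -permM mulVg perm1.
  by rewrite !cperm_sum_perm_r -permM mulVg perm1.
rewrite !ffunE; case: (split_ordP k) => i ->.
  rewrite cperm_sum_perm_l; set x := cp_perm b^-1%g i.
  by have /= -> := unsplitK (inl x : 'I_n + 'I_m); rewrite ffunE mulgV.
rewrite cperm_sum_perm_r; set x := cp_perm c^-1%g i.
by have /= -> := unsplitK (inr x : 'I_n + 'I_m); rewrite ffunE mulgV.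
Qed.

(** Puts a word above another one without changing its relative order. *)
Definition shift_word i w : seq (nat * G) := [seq (i + l.1, l.2) | l <- w].

Lemma size_shift_word i w : size (shift_word i w) = size w.
Proof. exact: size_map. Qed.

Lemma order_equiv_shift i w : order_equiv (shift_word i w) w.
Proof.
split; first by rewrite /unzip2 -map_comp.
have -> : unzip1 (shift_word i w) = [seq i + x | x <- unzip1 w].
  by rewrite /unzip1 -!map_comp.
by apply: same_order_map => x y; rewrite ltn_add2l.
Qed.

Lemma cword_sum n m (b : cperm G n) (c : cperm G m) :
  cword (cperm_sum b c) = cword b ++ shift_word n (cword c).
Proof.
rewrite cword_cat; congr (_ ++ _).
  by apply: eq_map => x; rewrite cperm_sum_l.
rewrite /shift_word -(map_comp _ _ (enum 'I_m)); apply: eq_map => x.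
by rewrite cperm_sum_r /= addnS.
Qed.

Definition small i (l : nat * G) : bool := l.1 <= i.

Lemma all_small_cword n (b : cperm G n) : all (small n) (cword b).
Proof. by apply/allP=> _ /mapP[x _ ->]; rewrite /small /=. Qed.

Lemma all_large_shift n w : all (fun l => 0 < l.1) w ->
  all (predC (small n)) (shift_word n w).
Proof.
move=> w0; rewrite all_map; apply: sub_all w0 => l /=.
by rewrite /small /= -ltnNge; lia.
Qed.

Lemma all_pos_cword n (b : cperm G n) : all (fun l => 0 < l.1) (cword b).
Proof. by apply/allP=> _ /mapP[x _ ->]. Qed.

Lemma sorted_enum_ord n : sorted (fun x y : 'I_n => x < y) (enum 'I_n).
Proof.
by have := iota_ltn_sorted 0 n; rewrite -val_enum_ord sorted_map.
Qed.

Lemma filter_small n m (s : 'S_(n + m)) : s \in grassmannian n m ->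
  filter (fun x => (s^-1)%g x < n) (enum 'I_(n + m))
    = [seq s (lshift m i) | i <- enum 'I_n] /\
  filter (fun x => n <= (s^-1)%g x) (enum 'I_(n + m))
    = [seq s (rshift n j) | j <- enum 'I_m].
Proof.
move=> /grassmannianP[s1 s2].
have ltr : transitive (fun x y : 'I_(n + m) => x < y).
  by move=> x y z; apply: ltn_trans.
have irr : irreflexive (fun x y : 'I_(n + m) => x < y) by move=> x; apply: ltnn.
split; apply: (irr_sorted_eq ltr irr).
- exact: sorted_filter (sorted_enum_ord _).
- rewrite sorted_map; apply: sub_sorted (sorted_enum_ord n).
  by move=> x y; apply: s1.
- move=> x; rewrite mem_filter mem_enum andbT; apply/idP/mapP => [lt_n|[y _ ->]].
    exists (Ordinal lt_n); first by rewrite mem_enum.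
    by rewrite -[LHS](permKV s); congr (s _); apply: val_inj.
  by rewrite permK /=.
- exact: sorted_filter (sorted_enum_ord _).
- rewrite sorted_map; apply: sub_sorted (sorted_enum_ord m).
  by move=> x y; apply: s2.
move=> x; rewrite mem_filter mem_enum andbT; apply/idP/mapP => [le_n|[y _ ->]].
  have lt_m: (s^-1)%g x - n < m by have := ltn_ord ((s^-1)%g x); lia.
  exists (Ordinal lt_m); first by rewrite mem_enum.
  by rewrite -[LHS](permKV s); congr (s _); apply: val_inj; rewrite /= subnKC.
by rewrite permK /= leq_addr.
Qed.

Lemma filter_cword n m (d : cperm G (n + m)) (s : 'S_(n + m)) b c :
    s \in grassmannian n m -> d = cperm_sum b c ->
  filter (small n) (cword (d * (of_perm G s)^-1)%g) = cword b /\
  filter (predC (small n)) (cword (d * (of_perm G s)^-1)%g) = shift_word n (cword c).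
Proof.
move=> Xs Ed; set a := (d * _)%g.
have letter_a x : letter a x = letter d ((s^-1)%g x).
  have Einv: ((of_perm G s)^-1 = of_perm G s^-1)%g.
    by congr CPerm; apply/ffunP=> y; rewrite !ffunE invg1.
  rewrite /a Einv /letter permM; congr (_, _).
  by rewrite ffunE [cp_col (of_perm _ _) x]ffunE mulg1.
have small_a x : small n (letter a x) = ((s^-1)%g x < n).
  rewrite letter_a Ed; case: (split_ordP ((s^-1)%g x)) => i Ei; rewrite Ei.
    by rewrite cperm_sum_l /small /= !ltn_ord.
  by rewrite cperm_sum_r /small /= !ltnNge leq_addr.
have [fl fr] := filter_small Xs.
have el: filter (preim (letter a) (small n)) (enum 'I_(n + m))
    = [seq s (lshift m i) | i <- enum 'I_n].
  by rewrite -fl; apply: eq_filter; apply: small_a.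
have er: filter (preim (letter a) (predC (small n))) (enum 'I_(n + m))
    = [seq s (rshift n j) | j <- enum 'I_m].
  rewrite -fr; apply: eq_filter => x.
  by rewrite -[LHS]/(~~ small n (letter a x)) small_a -leqNgt.
rewrite -[cword a]/([seq letter a x | x <- enum 'I_(n + m)]).
rewrite !(filter_map _ _ (enum 'I_(n + m))) el er.
rewrite -(map_comp _ _ (enum 'I_n)) -(map_comp _ _ (enum 'I_m)); split.
  apply: eq_map => i; rewrite -[LHS]/(letter a _) letter_a permK Ed.
  exact: cperm_sum_l.
rewrite /shift_word -(map_comp _ _ (enum 'I_m)); apply: eq_map => i.
rewrite -[LHS]/(letter a _) letter_a permK Ed cperm_sum_r /=.
by rewrite addnS.
Qed.

(** In [(b x c) u^-1] the letters of value at most [n], read from left to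
    right, spell [b], the others spell the shifted word of [c], and the
    permutation [u] records their positions: the coproduct of a word restricts
    it to its small and to its large letters. *)
Lemma mem_coproduct n m (a : cperm G (n + m)) b c :
  [exists u in grassmannian n m,
     gc a^-1%g == gc (of_perm G u * (cperm_sum b c)^-1)%g]
  = (cword a \in shuffle (cword b) (shift_word n (cword c))).
Proof.
rewrite (mem_shuffle _ (all_small_cword b) (all_large_shift _ (all_pos_cword c))).
apply/exists_inP/andP => [[u Xu]|[/eqP Eb /eqP Ec]].
  rewrite eq_gc => /eqP Ea.
  have -> : a = (cperm_sum b c * (of_perm G u)^-1)%g.
    by rewrite -[a]invgK Ea invMg invgK.
  by have [-> ->] := filter_cword Xu (erefl (cperm_sum b c)).
have [b' [c' [u Xu Ea]]] := product_decomposition a^-1%g.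
exists u => //; rewrite eq_gc Ea; apply/eqP; congr (_ * _)%g.
have Ea' : a = (cperm_sum b'^-1 c'^-1 * (of_perm G u)^-1)%g.
  by rewrite -cperm_sumV -invMg -Ea invgK.
have [Eb' Ec'] := filter_cword Xu (erefl (cperm_sum b'^-1 c'^-1)%g).
rewrite -Ea' Eb in Eb'; rewrite -Ea' Ec in Ec'.
have -> : b = b'^-1%g by apply: cword_inj.
have -> : c = c'^-1%g.
  apply: cword_inj; move: Ec'; apply: inj_map => -[x g] [y h] [].
  by move=> /addnI-> ->.
by rewrite cperm_sumV !invgK.
Qed.

End CoproductWords.

Local Open Scope ring_scope.

Section CoproductCoefficients.
Variables (K : fieldType) (G : finGroupType).
Implicit Types (u v w : seq (nat * G)).

Lemma comul_inner n m m' (a : cperm G (n + m)) (b : cperm G n) (c : cperm G m) :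
    m' = m ->
  [exists p : cperm G n * cperm G m',
     [exists u in grassmannian n m',
        gc a^-1%g == gc (of_perm G u * (cperm_sum p.1 p.2)^-1)%g]
     && ((gc p.1, gc p.2) == (gc b, gc c))]
  = [exists u in grassmannian n m,
       gc a^-1%g == gc (of_perm G u * (cperm_sum b c)^-1)%g].
Proof.
move=> ->; apply/existsP/idP => [[[b' c'] /andP[]]|abc].
  move=> + /eqP Ep; have -> : b' = b by apply: gc_inj; exact: (congr1 fst Ep).
  by have -> : c' = c by apply: gc_inj; exact: (congr1 snd Ep).
by exists (b, c); rewrite abc eqxx.
Qed.

Lemma comul_basis_coef_cword a n m (b : cperm G n) (c : cperm G m) :
  (KG_comul_basis K a)@_(gc b, gc c)
  = (word_of a \in shuffle (cword b) (shift_word n (cword c)))%:R.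
Proof.
case: a => N a; rewrite /KG_comul_basis raddf_sum /=.
have [EN|ne_N] := eqVneq N (n + m)%N; last first.
  rewrite big1 => [|i _]; last first.
    rewrite raddf_sum big1 // => p _ /=; rewrite mcoeff_basis.
    case: eqP => // /(congr1 (fun r => (tag r.1, tag r.2))) /= [Ei Em].
    by case/eqP: ne_N; rewrite -Em -Ei subnKC // -ltnS.
  case: (boolP (_ \in _)) => // /shuffle_size.
  by rewrite size_shift_word !size_cword => EN; case/eqP: ne_N.
subst N; have lt_n: (n < (n + m).+1)%N by rewrite ltnS leq_addr.
rewrite (bigD1 (Ordinal lt_n)) //= [X in _ + X]big1 ?addr0 => [|i ne_i]; last first.
  rewrite raddf_sum big1 // => p _ /=; rewrite mcoeff_basis.
  case: eqP => // /(congr1 (fun r => tag r.1)) /= Ei.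
  by case/eqP: ne_i; apply: val_inj.
rewrite raddf_sum /=; under eq_bigr => p _ do rewrite mcoeff_basis.
rewrite sum_indicator => [|[p1 p2] [q1 q2] _ _ /eqP <- /eqP Eq]; last first.
  congr pair; apply: gc_inj; first by have := congr1 fst Eq.
  by have := congr1 snd Eq.
by congr (_%:R); congr nat_of_bool; rewrite -mem_coproduct; apply: comul_inner; rewrite addKn.
Qed.

Lemma below_cword n (b : cperm G n) m (c : cperm G m) :
  below (cword b) (shift_word n (cword c)).
Proof.
move=> x y; rewrite unzip1_cword => /mapP[i _ ->].
case/mapP=> _ /mapP[_ /mapP[j _ ->] ->] -> /=.
by rewrite addnS ltnS; apply: leq_trans (ltn_ord _) (leq_addr _ _).
Qed.

(** The choice of separated representatives is immaterial. *)
Lemma sum_shuffle_stdw (M : nmodType) (F : gcperm G -> M) u v u' v' :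
    below u v -> below u' v' -> order_equiv u u' -> order_equiv v v' ->
  \sum_(w <- shuffle u v) F (stdw w) = \sum_(w <- shuffle u' v') F (stdw w).
Proof.
move=> uv uv' ou ov.
have [szu szv] := (tree_equiv_size (order_equiv_tree ou), tree_equiv_size (order_equiv_tree ov)).
apply: sum_shuffle_equiv => // k pat; congr F; apply: eq_stdw.
exact: order_equiv_along.
Qed.

Lemma comul_basis_coef a u v : below u v ->
  (KG_comul_basis K a)@_(stdw u, stdw v) = \sum_(w <- shuffle u v) (a == stdw w)%:R.
Proof.
move=> uv; have [b Eb] := @stdw_gc G _ u erefl; have [c Ec] := @stdw_gc G _ v erefl.
have eb: order_equiv u (cword b) by apply: order_equiv_sym; have := stdw_equiv u; rewrite -Eb.
have ec: order_equiv v (cword c) by apply: order_equiv_sym; have := stdw_equiv v; rewrite -Ec.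
rewrite -Eb -Ec comul_basis_coef_cword.
set v' := shift_word (size u) (cword c).
rewrite (@sum_shuffle_stdw _ (fun d => (a == d)%:R) u v (cword b) v') //; last 2 first.
- exact: below_cword.
- by apply: order_equiv_trans ec _; apply/order_equiv_sym/order_equiv_shift.
have perm_sh w : w \in shuffle (cword b) v' -> word_of (stdw w) = w.
  move=> w_sh; apply: word_of_perm; rewrite (shuffle_size w_sh).
  have := perm_cword (cperm_sum b c); rewrite cword_sum.
  rewrite /v' size_shift_word !size_cword; apply: perm_trans.
  apply: perm_map; apply: (perm_trans (y := cword b ++ v')) => //.
  move: w_sh; rewrite (mem_shuffle _ (all_small_cword b) (all_large_shift _ (all_pos_cword c))).
  by case/andP=> /eqP <-; rewrite -/v' => /eqP <-; rewrite perm_sym perm_filterC.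
under eq_big_seq => w w_sh.
  have -> : (a == stdw w) = (pred1 (word_of a) w).
    rewrite /= -[X in X == word_of a](perm_sh w w_sh) eq_sym.
    by apply/eqP/eqP => [->//|/word_of_inj].
  over.
rewrite -natr_sum /=; congr (_%:R); rewrite -count_uniq_mem ?sum1_count //.
  by rewrite -sum1_count big_mkcond /=; apply: eq_bigr => w _; case: (w == _).
exact: shuffle_uniq (all_small_cword b) (all_large_shift _ (all_pos_cword c)).
Qed.

(** Dual form of [mem_coproduct]. Only the order type of a shuffle enters, so
    any two words may represent the two components as long as one of them is
    below the other. *)
Lemma comul_coef x u v : below u v ->
  (hcomul (KG K G) x)@_(stdw u, stdw v) = \sum_(w <- shuffle u v) x@_(stdw w).
Proof.
move=> uv; apply: coef_of_basis => [c y z|a]; first exact: linearP.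
by rewrite /= lextU comul_basis_coef.
Qed.

End CoproductCoefficients.

(** * The bialgebra of coloured permutations *)

Section KGBialgebra.
Variables (K : fieldType) (G : finGroupType).
Local Notation V := {malg K[gcperm G]}.
Local Notation H := (KG K G).
Implicit Types (u v w t : seq (nat * G)) (x y : V) (z : {malg K[(gcperm G * gcperm G)%type]}).

Lemma malg_wordP x y : (forall w, x@_(stdw w) = y@_(stdw w)) -> x = y.
Proof. by move=> eq_xy; apply/malgP=> a; rewrite -[a]word_ofK. Qed.

Lemma below_shift u v i : all (fun l => l.1 <= i)%N u -> all (fun l => 0 < l.1)%N v ->
  below u (shift_word i v).
Proof.
move=> /allP ui /allP v0 _ _ /mapP[l /ui l_i ->] /mapP[_ /mapP[k /v0 k0 ->] ->] /=.
lia.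
Qed.

(** Tensors may be compared where the formula [comul_coef] applies: any two
    coloured permutations are represented by words, one below the other. *)
Lemma malg_word2P (x y : {malg K[(gcperm G * gcperm G)%type]}) :
  (forall u v, below u v -> x@_(stdw u, stdw v) = y@_(stdw u, stdw v)) -> x = y.
Proof.
move=> eq_xy; apply/malgP=> -[a b]; rewrite -[a]word_ofK -[b]word_ofK.
rewrite -(eq_stdw (order_equiv_shift (tag a) (word_of b))).
by apply: eq_xy; apply: below_cword.
Qed.

Lemma malg_word3P (x y : {malg K[(gcperm G * gcperm G * gcperm G)%type]}) :
  (forall u v w, below u v -> below u w -> below v w ->
     x@_(stdw u, stdw v, stdw w) = y@_(stdw u, stdw v, stdw w)) -> x = y.
Proof.
move=> eq_xy; apply/malgP=> -[[a b] c]; rewrite -[a]word_ofK -[b]word_ofK -[c]word_ofK.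
rewrite -(eq_stdw (order_equiv_shift (tag a) (word_of b))).
rewrite -(eq_stdw (order_equiv_shift (tag a + tag b) (word_of c))).
have pos (d : gcperm G) : all (fun l => 0 < l.1)%N (word_of d) by apply: all_pos_cword.
have small_word (d : gcperm G) : all (fun l => l.1 <= tag d)%N (word_of d).
  exact: all_small_cword.
apply: eq_xy; apply: below_shift; rewrite ?pos ?small_word //.
  by apply: sub_all (small_word a) => l; lia.
by rewrite all_map; apply: sub_all (small_word b) => l /=; lia.
Qed.

Lemma below_shufflel u v w t : below u w -> below v w -> t \in shuffle u v -> below t w.
Proof.
move=> uw vw /shuffle_perm/(perm_map fst) p x y; rewrite (perm_mem p) map_cat mem_cat.
by case/orP; [apply: uw|apply: vw].
Qed.

Lemma below_shuffler u v w t : below u v -> below u w -> t \in shuffle v w -> below u t.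
Proof.
move=> uv uw /shuffle_perm/(perm_map fst) p x y xu; rewrite (perm_mem p) map_cat mem_cat.
by case/orP; [apply: uv|apply: uw].
Qed.

Lemma below_cat u1 u2 v1 v2 : below (u1 ++ u2) (v1 ++ v2) -> below u1 v1 /\ below u2 v2.
Proof.
by move=> uv; split=> x y xu yv; apply: uv; rewrite /unzip1 map_cat mem_cat ?xu ?yv ?orbT.
Qed.

Lemma eq_tag0 (a b : gcperm G) : tag a = 0%N -> tag b = 0%N -> a = b.
Proof.
rewrite -!size_word_of => a0 b0; apply: word_of_inj.
by rewrite (size0nil a0) (size0nil b0).
Qed.

Lemma stdw_nil : gc (cperm_one G 0) = stdw [::].
Proof. by apply: eq_tag0; rewrite ?tag_stdw. Qed.

Lemma eq_stdw_nil w : (stdw [::] == stdw w) = (w == [::]).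
Proof.
apply/eqP/eqP => [/(congr1 tag)|->//]; rewrite !tag_stdw => /esym.
exact: size0nil.
Qed.

Lemma one_coef w : (hone H)@_(stdw w) = (w == [::])%:R.
Proof. by rewrite /= stdw_nil mcoeff_basis eq_stdw_nil. Qed.

Lemma tag0 (a : gcperm G) : (tag a == 0)%N = (a == stdw [::]).
Proof.
apply/eqP/eqP => [a0|->]; last by rewrite tag_stdw.
by apply: eq_tag0; rewrite ?tag_stdw.
Qed.

Lemma counit_coef x : hcounit H x = x@_(stdw [::]).
Proof.
rewrite /=; elim/malg_ind: x => [c x y IHx IHy||a].
- by rewrite linearP /= IHx IHy mcoeffD mcoeffZ.
- by rewrite linear0 mcoeff0.
by rewrite lextU mcoeff_basis tag0.
Qed.

Lemma sum_splits_nil (F : seq (nat * G) -> K) w :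
  \sum_(q <- splits w) F q.1 * (q.2 == [::])%:R = F w.
Proof.
elim: w F => [|a w IHw] F; first by rewrite sum_splits0 mulr1.
by rewrite sum_splits_cons mulr0 add0r (IHw (fun s => F (a :: s))).
Qed.

Lemma tens_id_comul_coef z u v w : below v w ->
  (tens_map idfun (hcomul H) z)@_(stdw u, (stdw v, stdw w))
  = \sum_(t <- shuffle v w) z@_(stdw u, stdw t).
Proof.
move=> vw; apply: (coef_of_basis (L := tens_map idfun (hcomul H)))
  => [c s r|[a b]]; first exact: tens_mapP.
rewrite tens_mapU tensE comul_coef // mulr_sumr; apply: eq_bigr => t _.
by rewrite !mcoeff_basis xpair_eqE -natrM mulnb.
Qed.

Lemma tens_comul_id_coef z u v w : below u v ->
  (tens_map (hcomul H) idfun z)@_(stdw u, stdw v, stdw w)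
  = \sum_(t <- shuffle u v) z@_(stdw t, stdw w).
Proof.
move=> uv; apply: (coef_of_basis (L := tens_map (hcomul H) idfun))
  => [c s r|[a b]]; first exact: tens_mapP.
rewrite tens_mapU tensE comul_coef // mulr_suml; apply: eq_bigr => t _.
by rewrite !mcoeff_basis xpair_eqE -natrM mulnb.
Qed.

Lemma tens_assoc_coef (z : {malg K[(gcperm G * (gcperm G * gcperm G))%type]}) a b c :
  (tens_assoc z)@_(a, b, c) = z@_(a, (b, c)).
Proof.
rewrite (coef_of_basis (r := [:: tt]) (e := fun _ => (a, (b, c)))) ?big_seq1 //.
  exact: tens_assocP.
by case=> [a' [b' c']]; rewrite tens_assocU mcoeff_basis big_seq1 !xpair_eqE andbA.
Qed.

Lemma counitl_coef z a :
  (lext (fun p : gcperm G * gcperm G =>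
           (hcounit H << p.1 >> : K) *: (<< p.2 >> : V)) z)@_a = z@_(stdw [::], a).
Proof.
rewrite (coef_of_basis (r := [:: tt]) (e := fun _ => (stdw [::], a))) ?big_seq1 //.
  by move=> c x y; apply: linearP.
case=> b c; rewrite lextU big_seq1 mcoeffZ counit_coef !mcoeff_basis xpair_eqE.
by rewrite -natrM mulnb.
Qed.

Lemma counitr_coef z a :
  (lext (fun p : gcperm G * gcperm G =>
           (hcounit H << p.2 >> : K) *: (<< p.1 >> : V)) z)@_a = z@_(a, stdw [::]).
Proof.
rewrite (coef_of_basis (r := [:: tt]) (e := fun _ => (a, stdw [::]))) ?big_seq1 //.
  by move=> c x y; apply: linearP.
case=> b c; rewrite lextU big_seq1 mcoeffZ counit_coef !mcoeff_basis xpair_eqE.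
by rewrite andbC -natrM mulnb.
Qed.

Lemma hmul2_basis a b r : hmul2 H << (a, b) >> r =
  lext (fun q => tens (hmul H << a >> << q.1 >>) (hmul H << b >> << q.2 >>)) r.
Proof. exact: lextU. Qed.

(** Both sides are bilinear, so it is enough to compare them on basis
    tensors, where the coefficient factors into two products. *)
Lemma hmul2_coef (s r : {malg K[(gcperm G * gcperm G)%type]}) u v :
  (hmul2 H s r)@_(stdw u, stdw v)
  = \sum_(p <- splits u) \sum_(q <- splits v)
      s@_(stdw p.1, stdw q.1) * r@_(stdw p.2, stdw q.2).
Proof.
pose L s r := (hmul2 H s r)@_(stdw u, stdw v).
pose R (s r : {malg K[(gcperm G * gcperm G)%type]}) :=
  \sum_(p <- splits u) \sum_(q <- splits v)
    s@_(stdw p.1, stdw q.1) * r@_(stdw p.2, stdw q.2).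
have Rl (t : {malg K[(gcperm G * gcperm G)%type]}) : forall c s s',
    R (c *: s + s') t = c * R s t + R s' t.
  move=> c s1 s2; rewrite /R mulr_sumr -big_split; apply: eq_bigr => p _.
  rewrite mulr_sumr -big_split; apply: eq_bigr => q _.
  by rewrite mcoeffD mcoeffZ mulrDl mulrA.
have Rr (t : {malg K[(gcperm G * gcperm G)%type]}) : forall c s s',
    R t (c *: s + s') = c * R t s + R t s'.
  move=> c s1 s2; rewrite /R mulr_sumr -big_split; apply: eq_bigr => p _.
  rewrite mulr_sumr -big_split; apply: eq_bigr => q _.
  by rewrite mcoeffD mcoeffZ mulrDr mulrCA.
have Ll (t : {malg K[(gcperm G * gcperm G)%type]}) : forall c s s',
    L (c *: s + s') t = c * L s t + L s' t.
  by move=> c s1 s2; rewrite /L /hmul2 linearP mcoeffD mcoeffZ.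
have Lr a b c s1 s2 :
    L << (a, b) >> (c *: s1 + s2) = c * L << (a, b) >> s1 + L << (a, b) >> s2.
  by rewrite /L !hmul2_basis (linearP (lext _)) mcoeffD mcoeffZ.
apply: (form_ext (f := L^~ r) (g := R^~ r)) => // -[a b].
apply: (form_ext (f := L << (a, b) >>) (g := R << (a, b) >>)) => // -[a' b'].
rewrite /L /R hmul2_basis lextU tensE !hmul_coef mulr_suml; apply: eq_bigr => p _.
rewrite mulr_sumr; apply: eq_bigr => q _; rewrite !mcoeff_basis !xpair_eqE /=.
by rewrite -!natrM !mulnb; congr (nat_of_bool _)%:R; rewrite andbACA.
Qed.

(** Read on words, the axioms are identities between sums over splittings
    and shuffles: associativity is [sum_splitsA], coassociativity is
    [sum_shuffleA], and the multiplicativity of the coproduct is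
    [sum_splits_shuffle]. *)
Lemma KG_bialgebra : bialgebra H.
Proof.
split.
- move=> x y r; apply: malg_wordP => w.
  transitivity (\sum_(p <- splits w) \sum_(q <- splits p.2)
      x@_(stdw p.1) * (y@_(stdw q.1) * r@_(stdw q.2))).
    apply: etrans (hmul_coef _ _ _) _; apply: eq_bigr => q _.
    by rewrite -mulr_sumr; congr (_ * _); apply: hmul_coef.
  rewrite -(sum_splitsA (fun p q s => x@_(stdw p) * (y@_(stdw q) * r@_(stdw s)))).
  apply: etrans (esym (hmul_coef _ _ _)); apply: eq_bigr => q _.
  under eq_bigr => s _ do rewrite mulrA.
  by rewrite -mulr_suml; congr (_ * _); apply/esym/hmul_coef.
- move=> x; apply: malg_wordP => w; apply: etrans (hmul_coef _ _ _) _.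
  case: w => [|a w]; first by rewrite sum_splits0 one_coef mul1r.
  rewrite sum_splits_cons one_coef mul1r big1 ?addr0 // => q _.
  by rewrite one_coef mul0r.
- move=> x; apply: malg_wordP => w; apply: etrans (hmul_coef _ _ _) _.
  under eq_bigr => q _ do rewrite one_coef.
  exact: (sum_splits_nil (fun s => x@_(stdw s))).
- move=> x; apply: malg_word3P => u v w uv uw vw.
  apply: etrans (tens_assoc_coef _ _ _ _) _.
  apply: etrans (tens_id_comul_coef _ _ vw) _.
  transitivity (\sum_(t <- shuffle v w) \sum_(s <- shuffle u t) x@_(stdw s)).
    by apply: eq_big_seq => t /(below_shuffler uv uw) ut; apply: comul_coef.
  rewrite -(sum_shuffleA (fun s => x@_(stdw s))).
  apply/esym; apply: etrans (tens_comul_id_coef _ _ uv) _.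
  by apply: eq_big_seq => t /(below_shufflel uw vw) tw; apply: comul_coef.
- move=> x; apply: malg_wordP => w; apply: etrans (counitl_coef _ _) _.
  by apply: etrans (comul_coef _ _) _; rewrite ?sum_shuffle0s.
- move=> x; apply: malg_wordP => w; apply: etrans (counitr_coef _ _) _.
  by apply: etrans (comul_coef _ _) _; rewrite ?sum_shuffles0.
- apply: malg_word2P => u v uv; apply: etrans (comul_coef _ uv) _.
  apply: etrans (esym (tensE _ _ _)); rewrite [X in _ = X * _]one_coef.
  rewrite [X in _ = _ * X]one_coef -natrM mulnb; case: u v {uv} => [|a u] [|b v].
  + by rewrite sum_shuffle0s one_coef.
  + by rewrite sum_shuffle0s one_coef.
  + by rewrite sum_shuffles0 one_coef.
  by rewrite sum_shuffle_cons !big1 ?addr0 // => w _; rewrite one_coef.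
- move=> x y; apply: malg_word2P => u v uv; apply: etrans (comul_coef _ uv) _.
  apply: etrans (esym (hmul2_coef _ _ _ _)).
  transitivity (\sum_(w <- shuffle u v) \sum_(p <- splits w)
      x@_(stdw p.1) * y@_(stdw p.2)).
    by apply: eq_bigr => w _; apply: hmul_coef.
  rewrite (sum_splits_shuffle (fun p q => x@_(stdw p) * y@_(stdw q))).
  apply: eq_big_seq => p /splits_cat Eu; apply: eq_big_seq => q /splits_cat Ev.
  have [below1 below2] : below p.1 q.1 /\ below p.2 q.2.
    by apply: below_cat; rewrite -Eu -Ev.
  under eq_bigr => w1 _ do rewrite -mulr_sumr.
  by rewrite -mulr_suml; congr (_ * _); apply/esym/comul_coef.
- by apply: etrans (counit_coef _) _; apply: one_coef.
move=> x y; apply: etrans (counit_coef _) _; apply: etrans (hmul_coef _ _ _) _.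
by rewrite sum_splits0; congr (_ * _); apply/esym/counit_coef.
Qed.

End KGBialgebra.

(** * Spans of classes of coloured permutations *)

Section ClassSpan.
Variables (K : fieldType) (G : finGroupType) (T : eqType).
Variable stat : forall n, cperm G n -> T.
Local Notation V := {malg K[gcperm G]}.
Local Notation H := (KG K G).
Local Notation A := (class_span K stat).
Implicit Types (u v w : seq (nat * G)) (x y z : V).

Lemma class_sum_coef n e a :
  (class_sum K stat n e)@_a = ((tag a == n) && (stat (tagged a) == e))%:R.
Proof.
rewrite /class_sum raddf_sum /=; under eq_bigr => b _ do rewrite mcoeff_basis.
case: a => m a /=; rewrite sum_indicator => [|b b' _ _ /eqP <- /eqP/gc_inj//].
congr (nat_of_bool _)%:R; apply/existsP/andP => [[b /andP[eb /eqP Eab]]|[/eqP Em ea]].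
  by move: (congr1 tag Eab) => /= Em; subst m; rewrite -(gc_inj Eab).
by subst m; exists a; rewrite ea eqxx.
Qed.

Lemma class_sum_in n e (b : cperm G n) :
  (class_sum K stat n e)@_(gc b) = (stat b == e)%:R.
Proof. by rewrite class_sum_coef /= eqxx. Qed.

Lemma class_sum_out n e w : size w != n -> (class_sum K stat n e)@_(stdw w) = 0.
Proof.
move=> ne_w; rewrite class_sum_coef; case: (tag (stdw w) =P n) => // Ew.
by rewrite -Ew tag_stdw eqxx in ne_w.
Qed.

Lemma tens_class_coef n m e e' (a : cperm G n) (b : cperm G m) :
  (tens (class_sum K stat n e) (class_sum K stat m e'))@_(gc a, gc b)
  = (stat a == e)%:R * (stat b == e')%:R.
Proof.
apply: etrans (tensE _ _ _) _.
by congr (_ * _); apply: class_sum_in.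
Qed.

(** The equivalence [R] extends the classes of [stat] from coloured
    permutations to all the words that represent them. *)
Variable R : seq (nat * G) -> seq (nat * G) -> Prop.
Hypothesis R_stat : forall n (a b : cperm G n), stat a = stat b <-> R (cword a) (cword b).
Hypothesis R_size : forall w w', R w w' -> size w = size w'.
Hypothesis R_order : forall w w', order_equiv w w' -> R w w'.
Hypothesis R_sym : forall w w', R w w' -> R w' w.
Hypothesis R_trans : forall w1 w2 w3, R w1 w2 -> R w2 w3 -> R w1 w3.

Definition class_function n x : Prop :=
  (forall w, size w != n -> x@_(stdw w) = 0) /\
  (forall w w', R w w' -> x@_(stdw w) = x@_(stdw w')).

Lemma R_stdw n (a b : cperm G n) w w' : gc a = stdw w -> gc b = stdw w' ->
  R w w' <-> stat a = stat b.
Proof.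
move=> Ea Eb; rewrite R_stat.
have ra: R (cword a) w by apply/R_order; have := stdw_equiv w; rewrite -Ea.
have rb: R (cword b) w' by apply/R_order; have := stdw_equiv w'; rewrite -Eb.
split=> r; first exact: R_trans (R_trans ra r) (R_sym rb).
exact: R_trans (R_trans (R_sym ra) r) rb.
Qed.

Definition class_repr n (a : cperm G n) : cperm G n :=
  odflt a [pick b | stat b == stat a].

Lemma class_reprE n (a : cperm G n) : stat (class_repr a) = stat a.
Proof. by rewrite /class_repr; case: pickP => [b /eqP|/(_ a)]; rewrite ?eqxx. Qed.

Lemma eq_class_repr n (a b : cperm G n) : stat a = stat b -> class_repr a = class_repr b.
Proof.
rewrite /class_repr => ->; case: pickP => //= none.
by have := none b; rewrite eqxx.
Qed.

Lemma class_expand n x : class_function n x ->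
  x = \sum_(a : cperm G n | class_repr a == a) x@_(gc a) *: class_sum K stat n (stat a).
Proof.
move=> [x0 xR]; apply/malgP=> -[m a]; rewrite raddf_sum /=.
under eq_bigr => b _ do rewrite mcoeffZ class_sum_coef /=.
have [Em|ne_m] := eqVneq m n; last first.
  rewrite big1 => [|b _]; last by rewrite mulr0.
  by rewrite -[existT _ _ _]word_ofK x0 // size_word_of.
subst m; rewrite (bigD1 (class_repr a)) /=; last first.
  by apply/eqP/eq_class_repr/class_reprE.
rewrite class_reprE eqxx mulr1 big1 ?addr0 => [|b /andP[/eqP rb ne_b]].
  rewrite -[existT _ _ _]word_ofK -[gc (class_repr a)]word_ofK.
  by apply: xR; apply/R_stat; rewrite class_reprE.
case: eqP => [/eq_class_repr Eab|]; last by rewrite mulr0.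
by case/eqP: ne_b; rewrite Eab rb.
Qed.

(** The class sums are the indicator functions of the classes of one length,
    so that membership in their span is tested coefficientwise. *)
Lemma class_spanP n x : A n x <-> class_function n x.
Proof.
split=> [|x_class]; last first.
  rewrite (class_expand x_class); apply: lspan_sum => a _; rewrite -[_ *: _]addr0.
  by apply: lspanP (lspan0 _); apply: lspan_gen; exists a.
elim/lspan_ind => [|c y z [y0 yR] [z0 zR]|_ [a ->]].
- by split=> [w|w w'] _; rewrite !mcoeff0.
- split=> [w ne_w|w w' ww']; rewrite !mcoeffD !mcoeffZ; last by rewrite (yR _ w') ?(zR _ w').
  by rewrite y0 // z0 // mulr0 addr0.
split=> [w ne_w|w w' ww']; first exact: class_sum_out.
have [sz_w|ne_w] := eqVneq (size w') n; last by rewrite !class_sum_out // (R_size ww').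
have [b Eb] := stdw_gc (etrans (R_size ww') sz_w); have [b' Eb'] := stdw_gc sz_w.
rewrite -Eb -Eb' !class_sum_in; congr (nat_of_bool (_ == _))%:R.
exact/(R_stdw Eb Eb').
Qed.

(** Expanding along one representative of each class in both factors
    exhibits the tensor as a combination of tensors of class sums. *)
Lemma class_tensP n m (z : {malg K[(gcperm G * gcperm G)%type]}) :
    (forall u v, below u v -> (size u, size v) != (n, m) -> z@_(stdw u, stdw v) = 0) ->
    (forall u v u' v', below u v -> below u' v' -> R u u' -> R v v' ->
       z@_(stdw u, stdw v) = z@_(stdw u', stdw v')) ->
  tens_sub (A n) (A m) z.
Proof.
move=> z0 zR.
have ->: z = \sum_(a : cperm G n | class_repr a == a)
    \sum_(b : cperm G m | class_repr b == b)
      z@_(gc a, gc b) *: tens (class_sum K stat n (stat a)) (class_sum K stat m (stat b)).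
  apply: malg_word2P => u v uv; rewrite raddf_sum /=.
  have [[szu szv]|ne_uv] := eqVneq (size u, size v) (n, m); last first.
    rewrite z0 // big1 // => a _; rewrite raddf_sum big1 // => b _ /=.
    rewrite mcoeffZ tensE /=; move: ne_uv; rewrite xpair_eqE.
    case: (size u =P n) => [_ ne_v|/eqP ne_u _]; last by rewrite class_sum_out // mul0r mulr0.
    by rewrite (class_sum_out _ (w := v)) // !mulr0.
  have [a Ea] := stdw_gc szu; have [b Eb] := stdw_gc szv; rewrite -Ea -Eb.
  have inner (c : cperm G n) : (\sum_(b' : cperm G m | class_repr b' == b')
      z@_(gc c, gc b') *: tens (class_sum K stat n (stat c))
                               (class_sum K stat m (stat b')))@_(gc a, gc b)
      = z@_(gc c, gc (class_repr b)) * (stat a == stat c)%:R.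
    rewrite raddf_sum.
    transitivity (\sum_(b' : cperm G m | class_repr b' == b')
        z@_(gc c, gc b') * ((stat a == stat c)%:R * (stat b == stat b')%:R)).
      apply: eq_bigr => b' _; apply: etrans (mcoeffZ _ _ _) _.
      by congr (_ * _); apply: tens_class_coef.
    rewrite (bigD1 (class_repr b)) /=; last by apply/eqP/eq_class_repr/class_reprE.
    rewrite class_reprE eqxx mulr1 big1 ?addr0 // => b' /andP[/eqP rb ne_b].
    case: (stat b =P stat b') => [/eq_class_repr Ebb|]; last by rewrite !mulr0.
    by case/eqP: ne_b; rewrite Ebb rb.
  under eq_bigr => c _ do rewrite inner.
  rewrite (bigD1 (class_repr a)) /=; last by apply/eqP/eq_class_repr/class_reprE.
  rewrite class_reprE eqxx mulr1 big1 ?addr0 => [|c /andP[/eqP rc ne_c]]; last first.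
    case: eqP => [/eq_class_repr Ecc|]; last by rewrite mulr0.
    by case/eqP: ne_c; rewrite Ecc rc.
  pose sh k := shift_word n (word_of k).
  have repr_b k : gc k = stdw (shift_word n (@cword G m k)).
    by rewrite (eq_stdw (order_equiv_shift _ _)) stdw_cword.
  rewrite -(stdw_cword a) -(stdw_cword (class_repr a)) (repr_b b) (repr_b (class_repr b)).
  apply: zR; try exact: below_cword; first by apply/R_stat; rewrite class_reprE.
  have shR k : R (shift_word n (@cword G m k)) (cword k) by apply/R_order/order_equiv_shift.
  apply: R_trans (shR b) _; apply: R_trans (R_sym (shR _)).
  by apply/R_stat; rewrite class_reprE.
apply: lspan_sum => a _; apply: lspan_sum => b _; rewrite -[_ *: _]addr0.
apply: lspanP (lspan0 _); apply: lspan_gen.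
exists (class_sum K stat n (stat a)), (class_sum K stat m (stat b)); split=> //.
  by apply: lspan_gen; exists a.
by apply: lspan_gen; exists b.
Qed.

Hypothesis R_take : forall k w w', R w w' -> R (take k w) (take k w').
Hypothesis R_drop : forall k w w', R w w' -> R (drop k w) (drop k w').
Hypothesis R_along : forall u v u' v' k, below u v -> below u' v' ->
  shuffle_pattern (size u) (size v) k -> R u u' -> R v v' ->
  R (calong (u ++ v) k) (calong (u' ++ v') k).

(** By [hmul_coef] and [comul_coef], the coefficients of products are
    computed on prefixes and suffixes and those of coproducts on shuffles:
    when these operations respect [R], the class functions are stable under
    both. *)
Lemma class_span_subbialgebra : graded_subbialgebra H A.
Proof.
split.
- by move=> n; apply: lspan0.
- by move=> n c x y; apply: lspanP.
- move=> n a Aa sum0 i lt_in; apply: malg_wordP => w; rewrite mcoeff0.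
  have [sz_w|] := eqVneq (size w) i; last by apply: ((class_spanP _ _).1 (Aa i)).1.
  have := congr1 (mcoeff (stdw w)) sum0; rewrite raddf_sum mcoeff0 /=.
  rewrite (bigD1 (Ordinal lt_in)) //= big1 ?addr0 // => j ne_j.
  apply: ((class_spanP _ _).1 (Aa j)).1; rewrite sz_w.
  by apply: contra_neq ne_j => Ei; apply: val_inj.
- move=> i j x y /class_spanP[x0 xR] /class_spanP[y0 yR]; apply/class_spanP; split.
    move=> w ne_w; apply: etrans (hmul_coef _ _ _) _.
    rewrite big_seq big1 // => q /splits_cat Ew.
    have [szq1|/x0->] := eqVneq (size q.1) i; last by rewrite mul0r.
    rewrite (y0 q.2) ?mulr0 //; apply: contra_neq ne_w => szq2.
    by rewrite Ew size_cat szq1 szq2.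
  move=> w w' ww'; apply: etrans (hmul_coef _ _ _) _.
  apply: esym; apply: etrans (hmul_coef _ _ _) _; apply: esym.
  rewrite !splits_iota !big_map -(R_size ww'); apply: eq_bigr => k _ /=.
  by rewrite (xR _ _ (R_take k ww')) (yR _ _ (R_drop k ww')).
- move=> n x /class_spanP[x0 xR].
  pose part i := restrict (fun p : gcperm G * gcperm G => tag p.1 == i) (hcomul H x).
  have partE i u v : (part i)@_(stdw u, stdw v)
      = if size u == i then (hcomul H x)@_(stdw u, stdw v) else 0.
    by rewrite -(tag_stdw u); apply: restrictE.
  exists part; split=> [i le_in|].
    apply: class_tensP => [u v uv ne_uv|u v u' v' uv uv' uu' vv'].
      rewrite partE; case: eqP => // szu; rewrite comul_coef //.
      rewrite big_seq big1 // => w /shuffle_size sz_w; apply: x0.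
      by apply: contra_neq ne_uv => En; rewrite -En sz_w szu addKn.
    rewrite !partE (R_size uu'); case: eqP => // szu.
    apply: etrans (comul_coef _ uv) _; apply: etrans (esym (comul_coef _ uv')).
    apply: sum_shuffle_equiv; rewrite ?(R_size uu') ?(R_size vv') // => k pat.
    by apply: xR; apply: R_along; rewrite // (R_size uu') (R_size vv').
  apply: malg_word2P => u v uv; rewrite [RHS]raddf_sum.
  transitivity (\sum_(i < n.+1)
      (if size u == i then (hcomul H x)@_(stdw u, stdw v) else 0)); last first.
    by apply: eq_bigr => i _; apply/esym/partE.
  have [le_un|lt_nu] := leqP (size u) n.
    rewrite (bigD1 (Ordinal (le_un : (size u < n.+1)%N))) //= eqxx big1 ?addr0 //.
    by move=> i ne_i; rewrite ifN // eq_sym.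
  rewrite big1 => [|i _]; last by rewrite gtn_eqF // (leq_ltn_trans _ lt_nu) // -ltnS.
  apply: etrans (comul_coef _ uv) _; rewrite big_seq big1 // => w /shuffle_size sz_w.
  apply: x0; rewrite sz_w gtn_eqF //.
  exact: leq_trans lt_nu (leq_addr _ _).
- move=> n x /class_spanP[x0 _]; apply: etrans (counit_coef _) _.
  exact: x0.
move=> x; split=> [/class_spanP[x0 _]|[c ->]].
  exists x@_(stdw [::]); apply: malg_wordP => w.
  rewrite mcoeffZ one_coef; case: eqP => [->|/eqP ne_w]; first by rewrite mulr1.
  by rewrite mulr0 x0 // size_eq0.
apply/class_spanP; split=> [w ne_w|w w' ww']; rewrite !mcoeffZ !one_coef.
  by rewrite -size_eq0 (negPf ne_w) mulr0.
by rewrite -!size_eq0 (R_size ww').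
Qed.

End ClassSpan.

(** * The Hopf algebras of coloured permutations and of coloured trees *)

Section TreeEquiv.
Variable G : finGroupType.
Implicit Types (u v w : seq (nat * G)).

Lemma tree_equiv_trans w1 w2 w3 :
  tree_equiv w1 w2 -> tree_equiv w2 w3 -> tree_equiv w1 w3.
Proof. by move=> /word_statP e12 /word_statP e23; apply/word_statP; rewrite e12. Qed.

(** A monochromatic factor of a part is one of the whole word, and domination
    looks only at the letters in between. *)
Lemma tree_equiv_cat u v u' v' : size u = size u' ->
  tree_equiv (u ++ v) (u' ++ v') -> tree_equiv u u' /\ tree_equiv v v'.
Proof.
move=> szu []; rewrite /unzip1 /unzip2 !map_cat -!/(unzip1 _) -!/(unzip2 _) => /eqP.
rewrite eqseq_cat ?size_map // => /andP[/eqP cu /eqP cv] dom.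
split; split=> // k l wk wl mono.
  rewrite -(dominates_catl (unzip1 v)) ?size_map // dom ?size_cat; try lia.
    by rewrite dominates_catl ?size_map -?szu.
  by rewrite monochrome_catl ?size_map.
have := dominates_catr (unzip1 u) (unzip1 v) k l.
have := dominates_catr (unzip1 u') (unzip1 v') k l.
have := monochrome_catr (unzip2 u) (unzip2 v) k l.
rewrite !size_map => mono_uv dom' dom_uv; rewrite -dom_uv -dom' -szu.
by apply: dom; rewrite ?mono_uv // size_cat; lia.
Qed.

Lemma tree_equiv_take k w w' : tree_equiv w w' -> tree_equiv (take k w) (take k w').
Proof.
move=> ww'; have := @tree_equiv_cat (take k w) (drop k w) (take k w') (drop k w').
by rewrite !cat_take_drop !size_take (tree_equiv_size ww') => /(_ erefl ww')[].
Qed.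

Lemma tree_equiv_drop k w w' : tree_equiv w w' -> tree_equiv (drop k w) (drop k w').
Proof.
move=> ww'; have := @tree_equiv_cat (take k w) (drop k w) (take k w') (drop k w').
by rewrite !cat_take_drop !size_take (tree_equiv_size ww') => /(_ erefl ww')[].
Qed.

Lemma tree_stat_equiv n (a b : cperm G n) :
  tree_stat a = tree_stat b <-> tree_equiv (cword a) (cword b).
Proof. exact: word_statP. Qed.

Lemma gc_equiv n (a b : cperm G n) :
  gc a = gc b <-> order_equiv (cword a) (cword b).
Proof.
split=> [/gc_inj->|/eq_stdw]; last by rewrite !stdw_cword.
by split; first by []; split.
Qed.

End TreeEquiv.

(** Of two consecutive positions, the first dominates the second exactly when
    there is no descent between them. *)
Lemma descent_comp_tree v v' :
  word_tree v = word_tree v' -> descent_comp v = descent_comp v'.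
Proof.
move=> /eq_word_treeP[sz dom]; rewrite /descent_comp !size_std sz.
suff ->: descents (std v) = descents (std v') by [].
rewrite /descents !size_std sz; apply: eq_in_filter => i.
rewrite mem_iota => /andP[i_gt0 lt_i].
have [vi vi']: (i < size v)%N /\ (i.-1 < size v)%N by lia.
rewrite !ltn_std -?sz //.
have iff (s : seq nat) : dominates s i.-1 i <-> ~~ klt s i i.-1.
  split=> [dom_s|desc x xi]; first by apply: dom_s; lia.
  have [->//|->] : x = i \/ x = i.-1 by lia.
  by rewrite klt_irr.
by apply/idP/idP; apply: contraTT => /iff/dom/iff; apply.
Qed.

Lemma descent_stat_tree (G : finGroupType) n (a b : cperm G n) :
  tree_stat a = tree_stat b -> descent_stat a = descent_stat b.
Proof.
rewrite /tree_stat /descent_stat; elim: (rainbow _) (rainbow _) => [|[v c] r IHr] [|[v' c'] r'] //=.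
by case=> /descent_comp_tree-> -> /IHr->.
Qed.

Section Main.
Variables (K : fieldType) (G : finGroupType).
Local Notation H := (KG K G).

Lemma tree_partP n x :
  tree_part K G n x <-> class_function (@tree_equiv G) n x.
Proof.
apply: class_spanP => //.
- exact: tree_stat_equiv.
- exact: tree_equiv_size.
- exact: order_equiv_tree.
- exact: tree_equiv_sym.
- exact: tree_equiv_trans.
Qed.

Lemma tree_class_expand n x : class_function (@tree_equiv G) n x ->
  x = \sum_(a : cperm G n | class_repr (@tree_stat G) a == a)
        x@_(gc a) *: class_sum K (@tree_stat G) n (tree_stat a).
Proof. exact/class_expand/tree_stat_equiv. Qed.

Lemma KG_class_spanP n x :
  class_span K (@gc G) n x <-> class_function (@order_equiv G) n x.
Proof.
apply: class_spanP => //.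
- exact: gc_equiv.
- by move=> w w' /order_equiv_tree/tree_equiv_size.
- exact: order_equiv_sym.
- exact: order_equiv_trans.
Qed.

(** The whole algebra is the case of the finest statistic, whose classes are
    single coloured permutations. *)
Lemma KG_partP n x : KG_part K G n x <-> class_span K (@gc G) n x.
Proof.
rewrite KG_class_spanP; split=> [xn|[x0 _] a ax].
  split=> [w ne_w|w w' /eq_stdw->//]; apply: mcoeff_outdom.
  by apply: contra_neqN ne_w => /xn; rewrite tag_stdw.
apply/eqP; apply: contraTT ax => ne_a; rewrite -mcoeff_eq0.
by rewrite -[a]word_ofK x0 // size_word_of.
Qed.

Lemma tree_subbialgebra : graded_subbialgebra H (tree_part K G).
Proof.
apply: (@class_span_subbialgebra _ _ _ _ (@tree_equiv G)).
- exact: tree_stat_equiv.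
- exact: tree_equiv_size.
- exact: order_equiv_tree.
- exact: tree_equiv_sym.
- exact: tree_equiv_trans.
- exact: tree_equiv_take.
- exact: tree_equiv_drop.
- by move=> *; apply: tree_equiv_along.
Qed.

Lemma subbialgebra_ext (A B : nat -> {malg K[gcperm G]} -> Prop) :
  (forall n x, A n x <-> B n x) -> graded_subbialgebra H A -> graded_subbialgebra H B.
Proof.
move=> AB [A0 Alin Adir Amul Acomul Acounit Aconn]; split.
- by move=> n; apply/AB.
- by move=> n c x y /AB Ax /AB Ay; apply/AB/Alin.
- by move=> n a Ba; apply: Adir => i; apply/AB.
- by move=> i j x y /AB Ax /AB Ay; apply/AB/Amul.
- move=> n x /AB/Acomul[t [tA ->]]; exists t; split=> // i /tA.
  elim/lspan_ind => [|c y z|_ [y [z [Ay Az ->]]]]; [exact: lspan0|exact: lspanP|].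
  by apply: lspan_gen; exists y, z; split=> //; apply/AB.
- by move=> n x /AB; apply: Acounit.
by move=> x; rewrite -AB.
Qed.

Lemma KG_subbialgebra : graded_subbialgebra H (KG_part K G).
Proof.
apply: subbialgebra_ext; first by move=> n x; apply: iff_sym; apply: KG_partP.
apply: (@class_span_subbialgebra _ _ _ _ (@order_equiv G)).
- exact: gc_equiv.
- by move=> w w' /order_equiv_tree/tree_equiv_size.
- by [].
- exact: order_equiv_sym.
- exact: order_equiv_trans.
- exact: order_equiv_take.
- exact: order_equiv_drop.
- by move=> *; apply: order_equiv_along.
Qed.

Lemma KG_comul_degree a p :
  p \in msupp (hcomul H << a >>) -> (tag p.1 + tag p.2)%N = tag a.
Proof.
case: p => b c /=; rewrite -mcoeff_neq0 -[b]word_ofK -[c]word_ofK.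
set v := shift_word (tag b) (word_of c).
have Ev : stdw v = stdw (word_of c) by apply/eq_stdw/order_equiv_shift.
rewrite -Ev; have := @comul_coef K G << a >> (word_of b) v (@below_cword _ _ _ _ _).
move=> ->; rewrite !tag_stdw; apply: contraNeq => ne_a.
rewrite big_seq big1 // => w /shuffle_size sz_w; rewrite mcoeff_basis.
case: (a =P stdw w) => // Ea; case/eqP: ne_a.
by rewrite Ea tag_stdw sz_w.
Qed.

Lemma KG_degree0 (a : gcperm G) : tag a = 0%N -> << a >> = hone H.
Proof. by move=> a0; rewrite (eq_tag0 a0 (erefl : tag (gc (cperm_one G 0)) = 0%N)). Qed.

Lemma tree_part_KG n x : tree_part K G n x -> KG_part K G n x.
Proof.
move=> /tree_partP[x0 xR]; apply/KG_partP/KG_class_spanP; split=> // w w'.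
by move=> /order_equiv_tree; apply: xR.
Qed.

(** Any antipode of the ambient algebra preserves the subalgebra, since it
    obeys a recursion on the degree that stays inside it. *)
Lemma tree_hopf_subalgebra :
  graded_connected_hopf_subalgebra H (KG_part K G) (tree_part K G).
Proof.
have gKG := KG_subbialgebra; have gT := tree_subbialgebra.
have bi := KG_bialgebra K G; split.
- exact: gch_takeuchi bi _ KG_comul_degree KG_degree0 _ gKG.
- exact: tree_part_KG.
- exact: gch_takeuchi bi _ KG_comul_degree KG_degree0 _ gT.
move=> S antiS; apply: (left_antipode_graded bi gT) => n x Tx.
exact: (is_antipode_left gKG antiS (tree_part_KG Tx)).
Qed.

Lemma mantaci_reutenauer_tree n x :
  mantaci_reutenauer_part K G n x -> tree_part K G n x.
Proof.
move=> MRx; apply/tree_partP; move: x MRx.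
apply: lspan_ind => [|c y z [y0 yR] [z0 zR]|_ [a ->]].
- by split=> [w|w w'] _; rewrite !mcoeff0.
- split=> [w ne_w|w w' ww']; rewrite !mcoeffD !mcoeffZ; last by rewrite (yR _ w') ?(zR _ w').
  by rewrite y0 // z0 // mulr0 addr0.
split=> [w ne_w|w w' ww']; first exact: class_sum_out.
have sz_ww' := tree_equiv_size ww'.
have [sz_w|ne_w] := eqVneq (size w') n; last by rewrite !class_sum_out // sz_ww'.
have [b Eb] := stdw_gc (etrans sz_ww' sz_w); have [b' Eb'] := stdw_gc sz_w.
rewrite -Eb -Eb' !class_sum_in; congr (nat_of_bool (_ == _))%:R.
apply: descent_stat_tree; apply/tree_stat_equiv.
have eb: order_equiv (cword b) w by have := stdw_equiv w; rewrite -Eb.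
have eb': order_equiv (cword b') w' by have := stdw_equiv w'; rewrite -Eb'.
apply: tree_equiv_trans (order_equiv_tree eb) _; apply: tree_equiv_trans ww' _.
exact/tree_equiv_sym/order_equiv_tree.
Qed.

End Main.

(** * Functoriality in the group of colours *)

Section Push.
Variables (G G' : finGroupType) (f : {multiplicative G -> G'}).

Definition pushc n (a : cperm G n) : cperm G' n :=
  CPerm (cp_perm a) [ffun i => f (cp_col a i)].

Definition pushg (a : gcperm G) : gcperm G' := gc (pushc (tagged a)).

Lemma multiplicative1 : f 1%g = 1%g.
Proof. by apply: (mulgI (f 1%g)); rewrite -gmulfM !mulg1. Qed.

Lemma pushcM n (a b : cperm G n) : pushc (a * b)%g = (pushc a * pushc b)%g.
Proof. by congr CPerm; apply/ffunP=> i; rewrite !ffunE gmulfM. Qed.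

Lemma pushc1 n : pushc (1 : cperm G n)%g = 1%g.
Proof. by congr CPerm; apply/ffunP=> i; rewrite !ffunE multiplicative1. Qed.

Lemma pushcV n (a : cperm G n) : pushc a^-1%g = (pushc a)^-1%g.
Proof. by apply/eqP; rewrite eq_sym eq_invg_mul -pushcM mulgV pushc1. Qed.

Lemma pushc_perm n (u : 'S_n) : pushc (of_perm G u) = of_perm G' u.
Proof. by congr CPerm; apply/ffunP=> i; rewrite !ffunE multiplicative1. Qed.

Lemma pushc_sum n m (a : cperm G n) (b : cperm G m) :
  pushc (cperm_sum a b) = cperm_sum (pushc a) (pushc b).
Proof.
congr CPerm; apply/ffunP=> i; rewrite !ffunE.
by case: (split i) => j; rewrite ffunE.
Qed.

Variable K : fieldType.
Local Notation H := (KG K G).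
Local Notation H' := (KG K G').
Local Notation phi := (push K f).

Lemma pushU a : phi << a >> = << pushg a >>.
Proof. by rewrite /push /= lextU. Qed.

Lemma push2U a b : tens_map phi phi << (a, b) >> = << (pushg a, pushg b) >>.
Proof.
apply: etrans (tens_mapU _ _ _ _) _.
exact: etrans (congr2 (@tens K _ _) (pushU _) (pushU _)) (tensU _ _ _).
Qed.

Lemma push_one : phi (hone H) = hone H'.
Proof. by apply: etrans (pushU _) _; congr << _ >>; apply: eq_tag0. Qed.

Lemma push_mul x y : phi (hmul H x y) = hmul H' (phi x) (phi y).
Proof.
rewrite /hmul -tens_mapE; move: (tens x y).
pose L : {linear _ -> {malg K[gcperm G']}} := phi \o hmulT H.
pose R : {linear _ -> {malg K[gcperm G']}} := hmulT H' \o tens_map phi phi.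
suff: L =1 R by apply.
apply: malg_ext => -[a b].
rewrite -[L _]/(phi (hmulT H << (a, b) >>)) -[R _]/(hmulT H' (tens_map phi phi << (a, b) >>)).
rewrite push2U.
have mulU (F : finGroupType) (p : gcperm F * gcperm F) :
    hmulT (KG K F) << p >> = KG_mul_basis K p by rewrite /= lextU.
rewrite !mulU raddf_sum; apply: eq_bigr => u _.
by apply: etrans (pushU _) _; congr << gc _ >>; rewrite /= pushcM pushc_perm pushc_sum.
Qed.

Lemma push_counit x : hcounit H' (phi x) = hcounit H x.
Proof.
rewrite !counit_coef; move: x.
apply: (form_ext (f := fun x => (phi x)@_(stdw [::])) (g := fun x => x@_(stdw [::]))).
- by move=> c x y; rewrite linearP mcoeffD mcoeffZ.
- by move=> c x y; rewrite mcoeffD mcoeffZ.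
by move=> a; rewrite pushU !mcoeff_basis -!tag0.
Qed.

End Push.

(** The two components are the inverses of the coloured permutations
    represented by a prefix and a suffix of the word of the inverse. *)
Lemma comul_unique (G : finGroupType) n i (a : cperm G n) : (i <= n)%N ->
  exists p0 : cperm G i * cperm G (n - i), forall p,
    [exists u in grassmannian i (n - i),
       gc a^-1%g == gc (of_perm G u * (cperm_sum p.1 p.2)^-1)%g] = (p == p0).
Proof.
move=> le_in.
have [|a' Ea'] := @stdw_gc G (i + (n - i)) (cword a^-1%g).
  by rewrite size_cword subnKC.
have [b [c [u Xu Eu]]] := product_decomposition a'.
exists (b^-1, c^-1)%g => -[b' c'].
rewrite -stdw_cword -Ea' Eu; apply/exists_inP/eqP => [[u' Xu']|[-> ->]].
  rewrite eq_gc cperm_sumV => /eqP/product_decomposition_inj[] // _ -> ->.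
  by rewrite !invgK.
by exists u => //; rewrite eq_gc cperm_sumV !invgK.
Qed.

Section PushComul.
Variables (K : fieldType) (G G' : finGroupType) (f : {multiplicative G -> G'}).
Local Notation H := (KG K G).
Local Notation H' := (KG K G').
Local Notation phi := (push K f).

Lemma push_comul x : tens_map phi phi (hcomul H x) = hcomul H' (phi x).
Proof.
pose L : {linear _ -> {malg K[(gcperm G' * gcperm G')%type]}} := tens_map phi phi \o hcomul H.
pose R : {linear _ -> {malg K[(gcperm G' * gcperm G')%type]}} := hcomul H' \o phi.
suff: L =1 R by apply.
apply: malg_ext => -[n a].
rewrite -[L _]/(tens_map phi phi (hcomul H _)) -[R _]/(hcomul H' (phi _)) pushU /= !lextU.
rewrite /KG_comul_basis raddf_sum; apply: eq_bigr => i _.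
have le_in : (i <= n)%N by rewrite -ltnS.
have [p0 Ep0] := comul_unique a le_in; have [q0 Eq0] := comul_unique (pushc f a) le_in.
rewrite (big_pred1 p0) // (big_pred1 q0) //.
apply: etrans (push2U _ _ _ _) _.
suff: (pushc f p0.1, pushc f p0.2) == q0 by move=> /eqP<-.
rewrite -Eq0; have := Ep0 p0; rewrite eqxx => /exists_inP[u Xu /eqP Eu].
apply/exists_inP; exists u => //; apply/eqP.
have := congr1 (pushg f) Eu; rewrite /pushg /= pushcV pushcM pushcV pushc_perm pushc_sum.
by move=> E; apply: E.
Qed.

(** A factor that is monochromatic for [g] is monochromatic for its image,
    so recolouring by a lift preserves equivalence. *)
Lemma push_tree_equiv n (s s' : 'S_n) (b b' : {ffun 'I_n -> G'}) (g : {ffun 'I_n -> G}) :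
    [ffun i => f (g i)] = b ->
    tree_equiv (cword (CPerm s b)) (cword (CPerm s' b')) ->
  tree_equiv (cword (CPerm s g)) (cword (CPerm s' g)).
Proof.
move=> Eb [_]; rewrite !unzip1_cword !unzip2_cword !size_cword /= => dom.
rewrite /tree_equiv !unzip1_cword !unzip2_cword !size_cword /=.
split=> // k l nk nl mono; apply: dom => // x xkl; have nx : (x < n)%N by lia.
have := mono x xkl; rewrite !(nth_map_ord _ _ nx) !(nth_map_ord _ _ nk) -Eb !ffunE.
by move=> ->.
Qed.

(** The coefficient of [b] in the image of a class sum counts the lifts of
    the colours of [b] that put the permutation of [b] in the class. An
    equivalent [b'] has the same colours, hence the same lifts, and a lift
    that puts one of them in the class puts the other in it as well. *)
Lemma push_graded n x : tree_part K G n x -> tree_part K G' n (phi x).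
Proof.
move: x; apply: lspan_ind => [|c x y Tx Ty|_ [a0 ->]].
- by rewrite linear0; apply: lspan0.
- by rewrite linearP; apply: lspanP.
move: (tree_stat a0) => e; apply/tree_partP.
have coefE b : (phi (class_sum K (@tree_stat G) n e))@_b
    = \sum_(a : cperm G n | tree_stat a == e) (gc (pushc f a) == b)%:R.
  have ->: phi (class_sum K (@tree_stat G) n e)
      = \sum_(a : cperm G n | tree_stat a == e) << gc (pushc f a) >>.
    by rewrite /class_sum raddf_sum; apply: eq_bigr => a _; apply: pushU.
  by rewrite raddf_sum; apply: eq_bigr => a _; apply: mcoeff_basis.
split=> [w ne_w|w w' ww'].
  rewrite coefE big1 // => a _; case: (gc _ =P stdw w) => // /(congr1 tag) E.
  by case/eqP: ne_w; rewrite -(tag_stdw w) -E.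
have sz_ww' := tree_equiv_size ww'; rewrite !coefE.
have [sz_w|ne_w] := eqVneq (size w') n; last first.
  rewrite !big1 // => a _.
    case: (gc _ =P stdw w') => // /(congr1 tag) E.
    by case/eqP: ne_w; rewrite -(tag_stdw w') -E.
  case: (gc _ =P stdw w) => // /(congr1 tag) E.
  by case/eqP: ne_w; rewrite -sz_ww' -(tag_stdw w) -E.
have [b Eb] := stdw_gc (etrans sz_ww' sz_w); have [b' Eb'] := stdw_gc sz_w.
have bb' : tree_equiv (cword b) (cword b').
  have eb: order_equiv (cword b) w by have := stdw_equiv w; rewrite -Eb.
  have eb': order_equiv (cword b') w' by have := stdw_equiv w'; rewrite -Eb'.
  apply: tree_equiv_trans (order_equiv_tree eb) _; apply: tree_equiv_trans ww' _.
  exact/tree_equiv_sym/order_equiv_tree.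
have cols : cp_col b = cp_col b'.
  apply/ffunP=> i; have := bb'.1; rewrite !unzip2_cword => /eq_in_map; apply.
  by rewrite mem_enum.
rewrite -Eb -Eb'; under eq_bigr => a _ do rewrite eq_gc.
under [RHS]eq_bigr => a _ do rewrite eq_gc.
have cond d : \sum_(a : cperm G n | tree_stat a == e) (pushc f a == d)%:R
    = \sum_(a : cperm G n | (tree_stat a == e) && (pushc f a == d)) 1 :> K.
  by rewrite big_mkcondr; apply: eq_bigr => a _; case: (_ == d).
rewrite !cond.
(* Colourings lifting that of [b] are exchanged between [b] and [b']. *)
pose h (a : cperm G n) := CPerm (cp_perm b) (cp_col a).
pose h' (a : cperm G n) := CPerm (cp_perm b') (cp_col a).
rewrite (reindex_onto h h') => [|a /andP[_ /eqP Ea]]; last first.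
  by rewrite /h /h' -Ea; case: (a).
apply: eq_bigl => -[s g]; rewrite /h /h' /pushc /=.
have eqE (x y : cperm G' n) : (x == y) = (cp_perm x == cp_perm y) && (cp_col x == cp_col y).
  by case: x y => s1 g1 [s2 g2]; apply/eqP/andP => [[-> ->]|[/eqP /= -> /eqP /= ->]].
have eqE' (x y : cperm G n) : (x == y) = (cp_perm x == cp_perm y) && (cp_col x == cp_col y).
  by case: x y => s1 g1 [s2 g2]; apply/eqP/andP => [[-> ->]|[/eqP /= -> /eqP /= ->]].
rewrite !eqE eqE' /= !eqxx andbT /= cols.
have [Ec|] := eqVneq [ffun i => f (g i)] (cp_col b'); last by rewrite !andbF.
have [<-|_] := eqVneq (cp_perm b') s; last by rewrite /= !andbF.
rewrite !andbT; congr (_ == e); apply/tree_stat_equiv.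
apply: (push_tree_equiv (b := cp_col b) (b' := cp_col b')); first by rewrite cols.
by move: bb'; case: (b); case: (b').
Qed.

(** Compatibility with the antipodes is automatic, by [antipode_natural]. *)
Lemma push_morphism :
  graded_hopf_morphism H (tree_part K G) H' (tree_part K G') phi.
Proof.
split.
- exact: push_graded.
- exact: push_one.
- by move=> x y _ _; apply: push_mul.
- by move=> x _; apply: push_counit.
- by move=> x _; apply: push_comul.
move=> S S' antiS antiS' x [n [a [Ta ->]]].
rewrite (linear_sum S) !(linear_sum phi) (linear_sum S').
apply: eq_bigr => i _; apply: (antipode_natural (KG_bialgebra K G) (KG_bialgebra K G')
  (tree_subbialgebra K G) (tree_subbialgebra K G') push_graded) (Ta i).
- exact: push_one.
- exact: push_mul.
- exact: push_comul.
- exact: is_antipode_left (tree_subbialgebra K G) antiS.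
- exact: is_antipode_left (tree_subbialgebra K G') antiS'.
Qed.

End PushComul.

Local Open Scope nat_scope.

(** * Coloured left-to-right minima and free generators *)

(** The right subtrees along the left branch, from the leftmost one up to the
    root. *)
Fixpoint spine (t : tree) : seq tree :=
  if t is Graft l r then rcons (spine l) r else [::].

Fixpoint graft_leftmost (t s : tree) : tree :=
  if t is Graft l r then Graft (graft_leftmost l s) r else s.

Lemma spine_graft t s : spine (graft_leftmost t (Graft Leaf s)) = s :: spine t.
Proof. by elim: t => //= l -> r _. Qed.

(** When the next word starts below the minimum [a] of the first one, the
    whole first word lies to the left of that word's leftmost node. *)
Lemma word_tree_catl a v z : all (leq a) v -> head a z < a -> 
  word_tree ((a :: v) ++ z) = graft_leftmost (word_tree z) (word_tree (a :: v)).
Proof.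
move=> av; elim: {z}(size z).+1 {-2}z (ltnSn (size z)) => // n IHn z le_zn lt_za.
have [Ez|/min_splitP[u [b [t [Ez sp]]]]] := eqVneq z [::]; first by rewrite Ez ltnn in lt_za.
have [bu bt] := andP sp.
have lt_ba : b < a.
  by move: lt_za bu; rewrite Ez; case: (u) => //= d u' lt_da /andP[/ltn_trans-> //].
have sp' : min_split ((a :: v) ++ u) b t.
  rewrite /min_split all_cat bu bt /= lt_ba !andbT.
  by apply: sub_all av => y; apply: leq_trans lt_ba.
rewrite Ez catA !word_tree_split //=; congr Graft.
case: u Ez bu {sp sp'} => [|d u] Ez bu; first by rewrite cats0.
rewrite -[_ :: _ ++ _]/((a :: v) ++ (d :: u)) IHn //; last by move: lt_za; rewrite Ez.
by move: le_zn; rewrite Ez size_cat /= !ltnS; lia.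
Qed.

Section Lead.
Variable G : finGroupType.
Implicit Types (w r : seq (nat * G)) (u v : seq nat) (c : G).

(** Cutting a tree along its left branch cuts a word at its left-to-right
    minima. Doing so inside each monochromatic block gives the leading
    monomial of the class of [w]. *)
Definition lead_of (s : seq (tree * G)) : seq (tree * G) :=
  flatten [seq [seq (t, p.2) | t <- spine p.1] | p <- s].

Definition lead w : seq (tree * G) := lead_of (word_stat w).

(** Puts back the first entry of a leading monomial: the new piece either
    grows the left branch of the first tree, when the colours agree, or starts
    a block of its own. *)
Definition glue (p : tree * G) (s : seq (tree * G)) : seq (tree * G) :=
  if s is (t, c) :: s' then
    if c == p.2 then (graft_leftmost t (Graft Leaf p.1), c) :: s'
    else (Graft Leaf p.1, p.2) :: s
  else [:: (Graft Leaf p.1, p.2)].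

Lemma lead_of_glue p s : lead_of (glue p s) = p :: lead_of s.
Proof.
case: p s => [T c] [|[t d] s] //=; case: eqP => [->|_] //=.
by rewrite /lead_of /= spine_graft.
Qed.

(** A block of colour [c] and minimum [a] ends where the colour changes or a
    smaller letter of the same colour appears. *)
Definition breaks (a : nat) c r : bool :=
  if r is (b, d) :: _ then ~~ ((d == c) && (a <= b)) else true.

Lemma word_stat_glue a v c r : all (leq a) v -> breaks a c r ->
  word_stat (block (a :: v) c ++ r) = glue (word_tree v, c) (word_stat r).
Proof.
move=> av; have wt_av : word_tree (a :: v) = Graft Leaf (word_tree v).
  by rewrite (@word_tree_split [::] a v) // /min_split av.
have [->|/block_splitP[z [d [r' [Er z0 r'd]]]]] := eqVneq r [::].
  by rewrite word_stat_block // wt_av.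
rewrite Er => brk; have [Edc|ne_dc] := eqVneq d c.
  rewrite Edc in brk r'd *.
  have -> : block (a :: v) c ++ block z c ++ r' = block ((a :: v) ++ z) c ++ r'.
    by rewrite catA /block map_cat.
  rewrite !word_stat_block // -1?size_eq0 //= eqxx -wt_av -word_tree_catl //.
  by case: z z0 brk {Er} => //= b z _; rewrite eqxx /= -ltnNge.
rewrite word_stat_block //; last first.
  by case: z z0 {Er brk} => //= b z _; apply: contra_neq ne_dc => -[].
by rewrite [word_stat (block z d ++ r')]word_stat_block //= (negPf ne_dc) wt_av.
Qed.

Lemma lead_block a v c r : all (leq a) v -> breaks a c r ->
  lead (block (a :: v) c ++ r) = (word_tree v, c) :: lead r.
Proof. by move=> av brk; rewrite /lead word_stat_glue // lead_of_glue. Qed.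

Lemma prefix_split (T : Type) (P : pred T) (s : seq T) : exists s1 s2,
  [/\ s = s1 ++ s2, all P s1 & (if s2 is x :: _ then ~~ P x else true)].
Proof.
elim: s => [|x s [s1 [s2 [-> P1 P2]]]]; first by exists [::], [::].
have [Px|nPx] := boolP (P x); first by exists (x :: s1), s2; rewrite /= Px.
by exists [::], (x :: s1 ++ s2).
Qed.

Lemma continue_block a c r : exists t r',
  [/\ r = block t c ++ r', all (leq a) t & breaks a c r'].
Proof.
have [s1 [s2 [-> P1 P2]]] := prefix_split (fun l => (l.2 == c) && (a <= l.1)) r.
exists (unzip1 s1), s2; split; last by case: (s2) P2 => [|[]].
  congr (_ ++ _); elim: s1 P1 {P2} => //= -[b d] s1 IHs /andP[/andP[/= /eqP -> _]].
  by move=> /IHs <-.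
by rewrite all_map; apply: sub_all P1 => l /= /andP[].
Qed.

Lemma lead_splitP w : w != [::] -> exists a v c r,
  [/\ w = block (a :: v) c ++ r, all (leq a) v & breaks a c r].
Proof.
case: w => // -[a c] w _; have [v [r [-> av brk]]] := continue_block a c w.
by exists a, v, c, r.
Qed.

Lemma word_ind (P : seq (nat * G) -> Prop) :
  P [::] ->
  (forall a v c r, all (leq a) v -> breaks a c r -> P r ->
     P (block (a :: v) c ++ r)) ->
  forall w, P w.
Proof.
move=> P0 Pb w; elim: {w}(size w).+1 {-2}w (ltnSn (size w)) => // n IHn w.
have [->//|/lead_splitP[a [v [c [r [-> av brk]]]]]] := eqVneq w [::].
rewrite size_cat size_block /= => lt_n; apply: Pb => //; apply: IHn; lia.
Qed.

(** Gluing the pieces back shows that the leading monomial loses no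
    information, so that it indexes the classes. *)
Lemma word_stat_lead w : word_stat w = foldr glue [::] (lead w).
Proof.
elim/word_ind: w => // a v c r av brk IHr.
by rewrite lead_block // word_stat_glue //= -IHr.
Qed.

Lemma eq_lead w w' : lead w = lead w' <-> word_stat w = word_stat w'.
Proof. by split=> [eq_l|eq_s]; [rewrite !word_stat_lead eq_l|rewrite /lead eq_s]. Qed.

(** The coefficient of [w] in the product of the generators indexed by [m],
    by [monomial_coef]: it is 0 or 1 since the lengths of the pieces fix where
    [w] is cut. *)
Fixpoint fits (m : seq (tree * G)) w : bool :=
  if m is p :: m' then
    (word_stat (take (internal p.1).+1 w) == [:: (Graft Leaf p.1, p.2)])
    && fits m' (drop (internal p.1).+1 w)
  else w == [::].

(** The left subtree of the root is empty when the smallest letter comes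
    first. *)
Lemma generator_wordP p w :
  word_stat w = [:: (Graft Leaf p.1, p.2)] <->
  exists a v, [/\ w = block (a :: v) p.2, all (leq a) v & word_tree v = p.1].
Proof.
split=> [|[a [v [-> av <-]]]]; last first.
  by rewrite -[block _ _]cats0 word_stat_glue.
have [->//|/block_splitP[v [c [r [-> v0 rc]]]]] := eqVneq w [::].
rewrite word_stat_block // => -[+ <-].
have [u [a [v' [-> sp]]]] := min_splitP v0.
rewrite word_tree_split // => -[Eu Ev] Er; exists a, v'; split=> //.
- have := congr1 internal Eu; rewrite internal_word_tree => /size0nil->.
  have -> : r = [::].
    case: r Er {rc} => // -[b d] r.
    have [//|z [e [r' [-> z0 r'e]]]] := @block_splitP _ ((b, d) :: r).
    by rewrite word_stat_block.
  by rewrite cats0.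
by case/andP: sp.
Qed.

Lemma fits_cons p m w : fits (p :: m) w <->
  exists a v r, [/\ w = block (a :: v) p.2 ++ r, all (leq a) v,
                    word_tree v = p.1 & fits m r].
Proof.
split=> [/andP[/eqP/generator_wordP[a [v [Ew av Ev]]] fit_m]|].
  by exists a, v, (drop (internal p.1).+1 w); rewrite -Ew cat_take_drop.
case=> [a [v [r [-> av Ev fit_m]]]]; rewrite /=.
have -> : internal p.1 = size v by rewrite -Ev internal_word_tree.
rewrite take_size_cat ?drop_size_cat ?size_block // fit_m andbT.
by apply/eqP/generator_wordP; exists a, v.
Qed.

Lemma fits_lead w : fits (lead w) w.
Proof.
elim/word_ind: w => // a v c r av brk IHr; rewrite lead_block //.
by apply/fits_cons; exists a, v, r.
Qed.

Lemma fits_size m w : fits m w -> size w = \sum_(p <- m) (internal p.1).+1.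
Proof.
elim: m w => [|p m IHm] w; first by rewrite big_nil => /eqP->.
move/fits_cons=> [a [v [r [-> _ Ev /IHm szr]]]].
by rewrite big_cons size_cat size_block szr -Ev internal_word_tree.
Qed.

(** A nonempty block of letters at least [a], followed by a word that ends the
    block of [a], contains a coloured left-to-right minimum of its own. *)
Lemma size_lead_block a t c r : t != [::] -> all (leq a) t -> breaks a c r ->
  size (lead r) < size (lead (block t c ++ r)).
Proof.
elim: {t}(size t).+1 {-2}t (ltnSn (size t)) a => // n IHn [//|b t] lt_n a _ /andP[ab at_] brk.
have [s1 [s2 [Et b1 b2]]] := prefix_split (leq b) t.
have Ew : block (b :: t) c ++ r = block (b :: s1) c ++ (block s2 c ++ r).
  by rewrite catA; congr (_ ++ r); rewrite Et /block /= map_cat.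
rewrite Ew lead_block //; last first.
  case: s2 b2 {Et Ew} => [_|d s2 /= db]; last by rewrite eqxx.
  case: (r) brk => //= -[d e] r0; apply: contra => /andP[-> bd] /=.
  exact: leq_trans ab bd.
case: s2 Et b2 {Ew} => [//|d s2] Et _.
have IH: size (lead r) < size (lead (block (d :: s2) c ++ r)).
  apply: (IHn (d :: s2) _ a) => //.
    by move: lt_n; rewrite Et /= size_cat /=; lia.
  by move: (at_ : all (leq a) t); rewrite Et all_cat => /andP[].
exact: leqW IH.
Qed.

(** A piece that fits is monochromatic and starts with its smallest letter,
    so that a cut is needed at each coloured left-to-right minimum; any
    further cut makes the monomial longer. *)
Lemma fits_leq m w : fits m w ->
  size (lead w) <= size m ?= iff (m == lead w).
Proof.
elim: m w => [|[T c] m IHm] w; first by move=> /eqP->; split.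
move=> /fits_cons[a [v [r [-> av /= Ev /IHm[le_m eq_m]]]]].
have [t [r' [Er a_t brk]]] := continue_block a c r.
have Ew : block (a :: v) c ++ r = block (a :: v ++ t) c ++ r'.
  by rewrite Er catA; congr (_ ++ r'); rewrite /block /= map_cat.
have lead_w : lead (block (a :: v) c ++ r) = (word_tree (v ++ t), c) :: lead r'.
  by rewrite Ew lead_block // all_cat av.
rewrite lead_w /=; case: (eqVneq t [::]) => [Et|t0].
  rewrite Et cats0 Ev in lead_w *; have -> : r' = r by rewrite Er Et.
  split=> //=; rewrite eqSS eq_m eqseq_cons eqxx //.
have lt_r := size_lead_block t0 a_t brk; rewrite -Er in lt_r.
have lt_m := leq_trans lt_r le_m; split; first exact: leqW lt_m.
rewrite ltn_eqF ?ltnS //; apply/esym/negbTE; apply: contraTneq lt_m => -[_ ->].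
by rewrite ltnn.
Qed.

Lemma word_tree_surj t : exists v, word_tree v = t.
Proof.
elim: t => [|l [u <-] r [v <-]]; first by exists [::].
exists (map succn u ++ 0 :: v); rewrite word_tree_split.
  by congr Graft; apply/eq_word_tree/same_order_map => x y.
by rewrite /min_split all_map; apply/andP; split; apply/allP.
Qed.

(** Each new piece is written with letters above all those that follow, so
    that the next piece starts a new left-to-right minimum. *)
Lemma lead_surj m : exists w, lead w = m.
Proof.
elim: m => [|[T c] m [r <-]]; first by exists [::].
have [v <-] := word_tree_surj T.
have [N rN] : exists N, all (fun l => l.1 < N) r.
  elim: r => [|l r [N rN]]; first by exists 0.
  exists (maxn N l.1.+1); rewrite /= leq_max ltnSn orbT.
  by apply: sub_all rN => x xN; rewrite leq_max xN.
exists (block (N :: map (addn N) v) c ++ r); rewrite lead_block.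
- congr ((_, _) :: _); apply/eq_word_tree/same_order_map => x y.
  by rewrite ltn_add2l.
- by rewrite all_map; apply/allP=> x _ /=; rewrite leq_addr.
by case: r rN => //= -[b d] r /andP[/= bN _]; rewrite leqNgt bN andbF.
Qed.

End Lead.

Local Open Scope ring_scope.

(** * Free generation *)

Section FreeGeneration.
Variables (K : fieldType) (G : finGroupType).
Local Notation I := (tree * G)%type.
Local Notation H := (KG K G).
Local Notation V := {malg K[gcperm G]}.
Local Notation gen := (tree_generator K G).
Local Notation A := (tree_part K G).
Implicit Types (w : seq (nat * G)) (m : seq I).

Let bi := KG_bialgebra K G.
Let gA := tree_subbialgebra K G.

Lemma word_stat_stdw w : tree_stat (tagged (stdw w)) = word_stat w.
Proof. by apply/word_statP/order_equiv_tree/stdw_equiv. Qed.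

Lemma generator_coef p w :
  (gen p)@_(stdw w) = (word_stat w == [:: (Graft Leaf p.1, p.2)])%:R.
Proof.
rewrite /tree_generator class_sum_coef word_stat_stdw; congr (nat_of_bool _)%:R.
case: (word_stat w =P _) => [|_]; last by rewrite andbF.
case/generator_wordP=> [a [v [-> _ <-]]].
by rewrite tag_stdw size_block /= internal_word_tree eqxx.
Qed.

Definition monomial m : V := foldr (fun p => hmul H (gen p)) (hone H) m.

Lemma monomial_cons p m : monomial (p :: m) = hmul H (gen p) (monomial m).
Proof. by []. Qed.

Lemma monomial_cat m1 m2 : monomial (m1 ++ m2) = hmul H (monomial m1) (monomial m2).
Proof.
elim: m1 => [|p m1 IHm]; first by apply/esym/(bi_mul1 bi).
by rewrite cat_cons !monomial_cons IHm; apply: (bi_mulA bi).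
Qed.

Lemma monomial_coef m w : (monomial m)@_(stdw w) = (fits m w)%:R.
Proof.
elim: m w => [|p m IHm] w; first exact: one_coef.
apply: etrans (hmul_coef _ _ _) _.
transitivity (\sum_(q <- splits w)
    ((word_stat q.1 == [:: (Graft Leaf p.1, p.2)]) && fits m q.2)%:R : K).
  apply: eq_bigr => q _; rewrite -mulnb natrM.
  by congr (_ * _); [apply: generator_coef|apply: IHm].
have small_q (q : seq (nat * G)) : word_stat q == [:: (Graft Leaf p.1, p.2)] ->
    size q = (internal p.1).+1.
  by move=> /eqP/generator_wordP[a [v [-> _ <-]]]; rewrite size_block internal_word_tree.
rewrite splits_iota big_map; set k := (internal p.1).+1.
have [le_kw|lt_wk] := leqP k (size w).
  rewrite (bigD1_seq k) ?iota_uniq ?mem_iota //.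
  rewrite big_seq_cond big1 => [|i /andP[]]; first by rewrite [LHS]addr0.
  rewrite mem_iota add0n ltnS => /andP[_ le_i] ne_ik.
  case: eqP => //= /eqP/small_q; rewrite (size_takel le_i) => Ei.
  by rewrite Ei -/k eqxx in ne_ik.
rewrite big_seq big1 => [|i]; last first.
  rewrite mem_iota add0n ltnS => /andP[_ le_i]; case: eqP => //= /eqP/small_q.
  by rewrite (size_takel le_i) -/k => Ei; move: lt_wk; rewrite -Ei ltnNge le_i.
case: (boolP (fits (p :: m) w)) => // /fits_size; rewrite big_cons -/k => szw.
by move: lt_wk; rewrite szw ltnNge leq_addr.
Qed.

Lemma tree_generator_part p : A (internal p.1).+1 (gen p).
Proof.
have [v Ev] := word_tree_surj p.1.
pose w : seq (nat * G) := block (0%N :: map succn v) p.2.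
have wt_v : word_tree (map succn v) = p.1 by rewrite -Ev; apply/eq_word_tree/same_order_map.
have sz_w : size w = (internal p.1).+1.
  by rewrite size_block /= -wt_v internal_word_tree.
have [a Ea] := stdw_gc sz_w; apply: lspan_gen; exists a; congr (class_sum _ _ _ _).
have -> : tree_stat a = tree_stat (tagged (stdw w)) by rewrite -Ea.
rewrite word_stat_stdw; apply/esym/generator_wordP.
by exists 0%N, (map succn v); split=> //; apply/allP.
Qed.

Lemma monomial_part m : A (\sum_(p <- m) (internal p.1).+1)%N (monomial m).
Proof.
elim: m => [|p m IHm]; first by rewrite big_nil; apply/(gs_connected gA); exists 1; rewrite scale1r.
by rewrite big_cons; apply: (gs_mul gA) (tree_generator_part p) IHm.
Qed.

Fact free_map_key : {F : {linear {malg K[{fmonom I}]} -> V} |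
  forall p, F p = lext (fun m : {fmonom I} => monomial m) p}.
Proof. by exists (lext (fun m : {fmonom I} => monomial m)). Qed.

(** The algebra map from the free algebra, characterised by [free_mapE]. *)
Definition free_map : {linear {malg K[{fmonom I}]} -> V} := sval free_map_key.

Lemma free_mapE p : free_map p = lext (fun m : {fmonom I} => monomial m) p.
Proof. exact: (svalP free_map_key). Qed.

Lemma free_mapU (m : {fmonom I}) : free_map << m >> = monomial m.
Proof. by rewrite free_mapE lextU. Qed.

Lemma mulr_scaler (p q : {malg K[{fmonom I}]}) c : p * (c *: q) = c *: (p * q).
Proof.
apply/malgP=> k; rewrite mcoeffZ.
apply: etrans (mcoeffMlw k (fsubset_refl (msupp p)) (msuppZ_le c q)) _.
have eq_pq := mcoeffMlw k (fsubset_refl (msupp p)) (fsubset_refl (msupp q)).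
apply: etrans (congr1 ( *%R c) (esym eq_pq)); rewrite mulr_sumr.
apply: eq_bigr => k1 _; rewrite mulr_sumr; apply: eq_bigr => k2 _.
by rewrite mcoeffZ mulrCA mulrnAr.
Qed.

Lemma basis_mul (k l : {fmonom I}) :
  << k >> * << l >> = << mmul k l >> :> {malg K[{fmonom I}]}.
Proof. by rewrite malgM_def fgmulUU mulr1. Qed.

Lemma malg_mulPl c (p p' q : {malg K[{fmonom I}]}) :
  (c *: p + p') * q = c *: (p * q) + p' * q.
Proof. by rewrite mulrDl scalerAl. Qed.

Lemma malg_mulPr c (p q q' : {malg K[{fmonom I}]}) :
  p * (c *: q + q') = c *: (p * q) + p * q'.
Proof. by rewrite mulrDr mulr_scaler. Qed.

Lemma free_mapM p q : free_map (p * q) = hmul H (free_map p) (free_map q).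
Proof.
have linE c x y : free_map (c *: x + y) = c *: free_map x + free_map y.
  exact: linearP.
elim/malg_ind: p => [c p p' IHp IHp'||k].
- apply: etrans (congr1 free_map (malg_mulPl c p p' q)) _.
  apply: etrans (linE _ _ _) _.
  apply: etrans (congr2 (fun x y => c *: x + y) IHp IHp') _.
  apply: etrans (esym (hmulPl H c _ _ _)) _.
  exact: (congr1 (fun x => hmul H x (free_map q)) (esym (linE c p p'))).
- by rewrite mul0r (linear0 free_map) hmul0l.
elim/malg_ind: q => [c q q' IHq IHq'||l].
- apply: etrans (congr1 free_map (malg_mulPr c << k >> q q')) _.
  apply: etrans (linE _ _ _) _.
  apply: etrans (congr2 (fun x y => c *: x + y) IHq IHq') _.
  apply: etrans (esym (hmulPr H c _ _ _)) _.
  exact: (congr1 (hmul H (free_map << k >>)) (esym (linE c q q'))).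
- by rewrite mulr0 (linear0 free_map) hmul0r.
apply: etrans (congr1 free_map (basis_mul k l)) _.
apply: etrans (free_mapU _) _; apply: etrans (congr1 monomial (fmM k l)) _.
apply: etrans (monomial_cat k l) _.
exact: (congr2 (hmul H) (esym (free_mapU k)) (esym (free_mapU l))).
Qed.

Lemma free_map_coef p w :
  (free_map p)@_(stdw w) = \sum_(m <- msupp p) p@_m * (fits m w)%:R.
Proof.
rewrite free_mapE /lext raddf_sum; apply: eq_bigr => m _ /=.
by rewrite mcoeffZ monomial_coef.
Qed.

Lemma seq_argmax (T : eqType) (f : T -> nat) (s : seq T) : s != [::] ->
  exists2 x, x \in s & forall y, y \in s -> (f y <= f x)%N.
Proof.
elim: s => // x s IHs _; have [->|/IHs[y ys max_y]] := eqVneq s [::].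
  by exists x => [|y]; rewrite ?mem_head // inE => /eqP->.
have [le_xy|lt_yx] := leqP (f x) (f y).
  by exists y; [rewrite inE ys orbT|move=> z; rewrite inE => /predU1P[->|/max_y]].
exists x; first exact: mem_head.
by move=> z; rewrite inE => /predU1P[->//|/max_y le_z]; apply: leq_trans le_z (ltnW lt_yx).
Qed.

(** A longest monomial of a relation is the only one of its monomials that
    fits the words it leads. *)
Lemma free_map_inj : injective free_map.
Proof.
apply: raddf_inj => p p0; apply/eqP; rewrite -msupp_eq0; apply/negPn/negP => supp_p.
have [|m mp max_m] := @seq_argmax _ (fun m : {fmonom I} => size m) (msupp p).
  by apply: contraNneq supp_p => E; apply/eqP/fsetP=> k; rewrite -[LHS]/(k \in enum_fset _) E.
have [w Ew] := lead_surj m; have := congr1 (mcoeff (stdw w)) p0.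
rewrite free_map_coef mcoeff0 (big_fsetD1 m) //= big_seq big1 => [|m' ]; last first.
  rewrite in_fsetD1 => /andP[ne_m m'p]; case: (boolP (fits m' w)); last by rewrite mulr0.
  move=> /fits_leq fit; case/eqP: ne_m; apply/eqP; rewrite fmP -Ew -fit.
  by rewrite eqn_leq fit Ew max_m.
by rewrite -{1}Ew fits_lead mulr1 addr0 => /eqP; rewrite mcoeff_eq0 mp.
Qed.

Lemma direct_sumP c x y : direct_sum A x -> direct_sum A y -> direct_sum A (c *: x + y).
Proof.
move=> [n [a [Aa ->]]] [k [b [Ab ->]]].
exists (n + k)%N, (fun i => c *: (if (i < n)%N then a i else 0) + (if (i < k)%N then b i else 0)).
split=> [i|].
  by apply: (gs_lin gA); case: ifP => _ //; apply: (gs_zero gA).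
rewrite big_split -scaler_sumr /= -!big_mkcond /=.
by rewrite -big_ord_widen ?leq_addr // -big_ord_widen ?leq_addl.
Qed.

Lemma free_map_direct p : direct_sum A (free_map p).
Proof.
elim/malg_ind: p => [c p q IHp IHq||m].
- by rewrite (linearP free_map); apply: direct_sumP.
- by rewrite (linear0 free_map); apply: (part_direct_sum gA (n := 0)); apply: (gs_zero gA).
by rewrite free_mapU; apply: part_direct_sum gA _ _ (monomial_part m).
Qed.

Lemma image_linear c x y : (exists p, free_map p = x) -> (exists p, free_map p = y) ->
  exists p, free_map p = c *: x + y.
Proof. by move=> [p <-] [q <-]; exists (c *: p + q); rewrite (linearP free_map). Qed.

Lemma image0 : exists p, free_map p = 0.
Proof. by exists 0; rewrite (linear0 free_map). Qed.

(** The class of [a] is its leading monomial up to classes with shorter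
    leading monomials. *)
Lemma class_sum_image n (a : cperm G n) :
  exists p, free_map p = class_sum K (@tree_stat G) n (tree_stat a).
Proof.
elim: {a}(size (lead (cword a))).+1 {-2}a (ltnSn (size (lead (cword a)))) => // N IHN a.
rewrite ltnS => le_N; pose m := lead (cword a).
have sz_m : (\sum_(p <- m) (internal p.1).+1)%N = n.
  by rewrite -(fits_size (fits_lead (cword a))) size_cword.
pose y : V := monomial m - class_sum K (@tree_stat G) n (tree_stat a).
have Ay : A n y.
  rewrite /y -scaleN1r addrC; apply: (gs_lin gA); first by apply: lspan_gen; exists a.
  by rewrite -sz_m; apply: monomial_part.
suff [q Eq]: exists q, free_map q = y.
  exists (<< (FMonom m : {fmonom I}) >> - q); rewrite (linearB free_map) Eq.
  by rewrite free_mapU /y opprB addrC subrK.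
have /tree_partP y_class := Ay; rewrite (tree_class_expand y_class).
elim/big_ind: _ => [|x z [p <-] [q <-]|b _]; first exact: image0.
  by exists (p + q); rewrite linearD.
have yb : y@_(gc b) = (fits m (cword b))%:R - (tree_stat b == tree_stat a)%:R.
  rewrite /y mcoeffB class_sum_in -[gc b]stdw_cword; congr (_ - _).
  exact: monomial_coef.
have [E0|ne0] := eqVneq y@_(gc b) 0; first by rewrite E0 scale0r; apply: image0.
have [|p Ep] := IHN b; last by exists (y@_(gc b) *: p); rewrite linearZ Ep.
move: ne0; rewrite yb; case: (tree_stat b =P tree_stat a) => [Eab|ne_ab].
  have /eq_lead Eab' : word_stat (cword b) = word_stat (cword a) := Eab.
  by rewrite /m -Eab' fits_lead subrr eqxx.
case: (boolP (fits m (cword b))) => [/fits_leq fit _|]; last by rewrite subrr eqxx.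
apply: leq_trans le_N; rewrite ltn_neqAle !fit andbT; apply/eqP => /esym/eq_lead.
exact: ne_ab.
Qed.

Lemma tree_generators_free : freely_generated H (direct_sum A) gen.
Proof.
exists free_map; split.
- by apply: etrans (free_mapU _) _; rewrite fm1.
- exact: free_mapM.
- move=> i; apply: etrans (free_mapU _) _; rewrite fmU.
  exact: (bi_mulr1 bi).
- exact: free_map_inj.
move=> x; split=> [[n [a [Aa ->]]]|[p <-]]; last exact: free_map_direct.
elim/big_ind: _ => [|y z [p <-] [q <-]|i _]; first exact: image0.
  by exists (p + q); rewrite linearD.
move: (a i) (Aa i); apply: lspan_ind => [|c y z|_ [b ->]].
- exact: image0.
- exact: image_linear.
exact: class_sum_image.
Qed.

End FreeGeneration.

Lemma direct_sum_mono (K : fieldType) (X : choiceType) (A B : nat -> {malg K[X]} -> Prop) :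
  (forall n x, A n x -> B n x) -> forall x, direct_sum A x -> direct_sum B x.
Proof. by move=> AB x [n [a [Aa ->]]]; exists n, a; split=> // i; apply/AB. Qed.

Lemma push_id (K : fieldType) (G : finGroupType) x : push K (@idfun G) x = x.
Proof.
move: x; apply: (malg_ext (g := idfun)) => -[n [s g]].
rewrite /push /= lextU /=; congr << gc (CPerm _ _) >>.
by apply/ffunP=> i; rewrite ffunE.
Qed.

Lemma push_comp (K : fieldType) (G G' G'' : finGroupType) (f : G -> G') (f' : G' -> G'') x :
  push K (f' \o f) x = push K f' (push K f x).
Proof.
move: x; apply: (malg_ext (g := push K f' \o push K f)) => -[n [s g]].
rewrite /push /= !lextU /=; congr << gc (CPerm _ _) >>.
by apply/ffunP=> i; rewrite !ffunE.
Qed.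

Theorem theorem4p3 (K : fieldType) (charK0 : [pchar K] =i pred0) :
  (forall G : finGroupType, abelian [set: G] ->
    [/\ graded_connected_hopf_subalgebra (KG K G)
          (KG_part K G) (tree_part K G),
        forall x, direct_sum (mantaci_reutenauer_part K G) x ->
          direct_sum (tree_part K G) x
      & freely_generated (KG K G) (direct_sum (tree_part K G))
          (tree_generator K G)])
  /\
  [/\ forall (G G' : finGroupType) (f : {multiplicative G -> G'}),
        abelian [set: G] -> abelian [set: G'] ->
        graded_hopf_morphism (KG K G) (tree_part K G)
          (KG K G') (tree_part K G') (push K f),
      forall G : finGroupType, abelian [set: G] ->
        forall x, direct_sum (tree_part K G) x -> push K (@idfun G) x = x
    & forall (G G' G'' : finGroupType) (f : {multiplicative G -> G'})
          (f' : {multiplicative G' -> G''}),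
        abelian [set: G] -> abelian [set: G'] -> abelian [set: G''] ->
        forall x, direct_sum (tree_part K G) x ->
          push K (f' \o f) x = push K f' (push K f x)].
Proof.
split; first (move=> G _; split).
- exact: tree_hopf_subalgebra.
- exact: direct_sum_mono (@mantaci_reutenauer_tree K G).
- exact: tree_generators_free.
split=> [G G' f _ _|G _ x _|G G' G'' f f' _ _ _ x _].
- exact: push_morphism.
- exact: push_id.
exact: push_comp.
Qed.
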